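(* Let $f$ satisfy (G1) and (G2) (see context) with $1\le q<2$. Let $U_\infty$ be the radial singular solution of $-\Delta u=f(u)$ in $\mathbb{R}^2$ described in the context, let $r_0>0$ be its first zero and put $\lambda_\infty:=r_0^2$. Then the bifurcation curve $\{(\lambda(\alpha),u(\cdot,\alpha)):\alpha>0\}$ of $$-\Delta u=\lambda f(u)\ \text{ in } B_1,\qquad u=0\ \text{ on }\partial B_1,$$ where $B_1\subset\mathbb{R}^2$ is the unit disc, has infinitely many turning points around $\lambda=\lambda_\infty$. In particular, for $\lambda=\lambda_\infty$ this problem has infinitely many solutions.
   Context: Standing assumptions: $f\in C^1[0,\infty)$, $f>0$ on $[0,\infty)$; $g:=\log f$; $H(s):=\frac{g(s)g''(s)}{(g'(s))^2}$ (for large $s$). (G1): $g(s)>0$ for large $s$, $\int_s^\infty\frac{du}{g(u)}<\infty$ for all large $s$, and the limit $\frac1q=\lim_{s\to\infty}H(s)$ exists ($q$ a finite real number). (G2): there exist $C>0$ and $s_0>0$ such that $g\in C^5(s_0,\infty)$ and $|H^{(k)}(s)|<C\big(\frac{g'(s)}{g(s)}\big)^k$ for $k\in\{1,2,3\}$ and all $s>s_0$. It is known that under (G1), (G2) one has $q\ge1$, and $g$ is strictly increasing and convex for large $s$ with $g(s)\to\infty$; $g^{-1}$ denotes the inverse of $g$ near infinity. Radial singular solution: $U(x)=U(r)$, $r=|x|$, $U\in C^2(0,\infty)$, with $-U''-\frac1rU'=f(U)$ for $r>0$ and $U(r)\to\infty$ as $r\to0^+$ (where a solution is negative, $f$ is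 extended by $f(s):=f(0)$ for $s<0$). $U_\infty$ is the radial singular solution such that for every $\varepsilon\in(0,\frac12]$, as $r\to0^+$, $$g(U_\infty(r))=-2\log r-2\log(-2\log r)+\log\Big[\frac g{g'}(g^{-1}(-2\log r))\Big]+\log4+\log H(g^{-1}(-2\log r))+o((-\log r)^{-1+\varepsilon});$$ it has a first zero $r_0$. Bifurcation curve: for $\alpha>0$ let $v(\cdot,\alpha)$ solve $v''+\frac1rv'+f(v)=0$ for $r>0$, $v(0)=\alpha$, $v'(0)=0$, and let $\rho(\alpha)$ be its first zero. Then $\lambda(\alpha)=\rho(\alpha)^2$ and $u(r,\alpha)=v(\rho(\alpha)r,\alpha)$; this is the solution with $\|u\|_{L^\infty}=u(0)=\alpha$, and $\alpha\mapsto(\lambda(\alpha),u(\cdot,\alpha))$ is a $C^1$ curve. ''Infinitely many turning points around $\lambda=\lambda_\infty$'' means that $\lambda(\alpha)$ oscillates infinitely many times around $\lambda_\infty$: $\lambda(\alpha)-\lambda_\infty$ changes sign infinitely many times as $\alpha\to\infty$ (so that $\lambda(\cdot)$ has infinitely many local maxima with value $>\lambda_\infty$ and local minima with value $<\lambda_\infty$). *)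

(* Defs.v *)
From Stdlib Require Import Reals.
From Coquelicot Require Import Coquelicot.

Open Scope R_scope.

(* A nonlinearity on [0,oo) is a total [f : R -> R] whose values at negative
   arguments are never used: [D_in] and [continue_in] relativize limits to the
   half-line, so at 0 they are one-sided. *)
Definition C1_half_line (f : R -> R) : Prop :=
  exists f' : R -> R, forall s, 0 <= s ->
    D_in f f' (fun t => 0 <= t) s /\ continue_in f' (fun t => 0 <= t) s.

(* [f] extended by the constant [f 0] to the negative half-line. *)
Definition extend (f : R -> R) (s : R) : R := f (Rmax 0 s).

(* Class C^n on the open half-line (a,oo).  All orders [k <= n] are listed
   because [ex_derive_n w n x] alone says nothing about the lower ones. *)
Definition Cn_beyond (n : nat) (a : R) (w : R -> R) : Prop :=
  forall x, a < x ->
    (forall k, (k <= n)%nat -> ex_derive_n w k x) /\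
    continuous (Derive_n w n) x.

Definition logf (f : R -> R) (s : R) : R := ln (f s).

Definition H (f : R -> R) (s : R) : R :=
  logf f s * Derive_n (logf f) 2 s / (Derive (logf f) s) ^ 2.

(* The third clause says that the quotient [H] is well defined for large s,
   which Rocq's total derivative and division would otherwise hide. *)
Definition G1 (f : R -> R) (q : R) : Prop :=
  Rbar_locally p_infty (fun s => 0 < logf f s) /\
  Rbar_locally p_infty (fun s =>
    ex_RInt_gen (fun u => / logf f u) (at_point s) (Rbar_locally p_infty)) /\
  Rbar_locally p_infty (fun s =>
    ex_derive_n (logf f) 2 s /\ Derive (logf f) s <> 0) /\
  q <> 0 /\
  is_lim (H f) p_infty (/ q).

Definition G2 (f : R -> R) : Prop :=
  exists C s0 : R, 0 < C /\ 0 < s0 /\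
    Cn_beyond 5 s0 (logf f) /\
    forall (k : nat) (s : R), (1 <= k <= 3)%nat -> s0 < s ->
      Rabs (Derive_n (H f) k s) < C * (Derive (logf f) s / logf f s) ^ k.

(* This determines [ginv t] for all large t, as g tends to infinity. *)
Definition inverse_near_infinity (g ginv : R -> R) : Prop :=
  exists S : R,
    (forall s, S <= s -> ginv (g s) = s) /\
    (forall t, g S <= t -> S <= ginv t /\ g (ginv t) = t).

Definition radial_equation (f w : R -> R) : Prop :=
  Cn_beyond 2 0 w /\
  forall r, 0 < r -> - Derive_n w 2 r - / r * Derive w r = extend f (w r).

Definition radial_singular_solution (f U : R -> R) : Prop :=
  radial_equation f U /\
  filterlim U (at_right 0) (Rbar_locally p_infty).

Definition singular_main_terms (f ginv : R -> R) (r : R) : R :=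
  let s := ginv (-2 * ln r) in
  -2 * ln r - 2 * ln (-2 * ln r) + ln (logf f s / Derive (logf f) s)
  + ln 4 + ln (H f s).

Definition singular_expansion (f ginv U : R -> R) : Prop :=
  forall eps : R, 0 < eps <= 1 / 2 ->
    filterlim
      (fun r => (logf f (U r) - singular_main_terms f ginv r)
                / Rpower (- ln r) (-1 + eps))
      (at_right 0) (locally 0).

Definition first_zero (w : R -> R) (r0 : R) : Prop :=
  0 < r0 /\ w r0 = 0 /\ forall r, 0 < r < r0 -> w r <> 0.

(* The derivative at 0 is one-sided, since w is only meaningful on [0,oo). *)
Definition regular_solution (f : R -> R) (alpha : R) (w : R -> R) : Prop :=
  radial_equation f w /\
  w 0 = alpha /\
  filterlim (fun r => (w r - w 0) / r) (at_right 0) (locally 0).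

(* Here [v alpha] is the profile r |-> v(r,alpha). *)
Definition bifurcation_curve (v : R -> R -> R) (rho : R -> R) (alpha : R) :
    R * (R -> R -> R) :=
  ((rho alpha) ^ 2,
   fun x y => v alpha (rho alpha * sqrt (x ^ 2 + y ^ 2))).

(* For the continuous function [h], taking both strict signs at arbitrarily
   large arguments is the same as changing sign infinitely often. *)
Definition changes_sign_infinitely_often (h : R -> R) : Prop :=
  forall A : R, (exists a, A < a /\ h a < 0) /\ (exists a, A < a /\ 0 < h a).

Definition infinitely_many_turning_points_around
    (curve : R -> R * (R -> R -> R)) (l : R) : Prop :=
  let lam := fun alpha => fst (curve alpha) in
  changes_sign_infinitely_often (fun alpha => lam alpha - l) /\
  forall A : R,
    (exists a, A < a /\ l < lam a /\ locally a (fun b => lam b <= lam a)) /\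
    (exists a, A < a /\ lam a < l /\ locally a (fun b => lam a <= lam b)).

(* Classical solutions of -Delta u = lambda f(u) in the open unit disc, u = 0
   on the unit circle, continuous on the closed disc.  The sign condition
   keeps u in the domain [0,oo) of f; values of u outside the closed disc are
   irrelevant. *)
Definition dirichlet_solution (f : R -> R) (lambda : R) (u : R -> R -> R) : Prop :=
  (forall x y, x ^ 2 + y ^ 2 < 1 ->
     ex_diff_n u 2 x y /\
     0 <= u x y /\
     - (partial_derive 2 0 u x y + partial_derive 0 2 u x y)
       = lambda * f (u x y)) /\
  (forall x y, x ^ 2 + y ^ 2 <= 1 ->
     filterlim (fun p : R * R => u (fst p) (snd p))
       (within (fun p : R * R => fst p ^ 2 + snd p ^ 2 <= 1) (locally (x, y)))
       (locally (u x y))) /\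
  (forall x y, x ^ 2 + y ^ 2 = 1 -> u x y = 0).

Definition infinitely_many_solutions (f : R -> R) (lambda : R) : Prop :=
  exists w : nat -> R -> R -> R,
    (forall n, dirichlet_solution f lambda (w n)) /\
    (forall m n, m <> n ->
       exists x y, x ^ 2 + y ^ 2 < 1 /\ w m x y <> w n x y).

(* Main.v *)
Require Import Defs.
From Stdlib Require Import Reals.
From Stdlib Require Import Lra Lia Psatz Ranalysis5 ClassicalEpsilon.
From Coquelicot Require Import Coquelicot.

Open Scope R_scope.

(** In the variable t = - log r, radial solutions satisfy y'' = - e^(-2t) f(y).
    Along the singular solution U the linearized coefficient e^(-2t) f'(U) is
    comparable with 1/t, hence much larger than 1/t^2, so by Sturm comparison a
    regular solution v cannot stay above U, or close below U, on an interval of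
    length proportional to t.  If v drops far below U, its slope stays nearly
    constant and, by a Pohozaev-type functional, is at most 4/g'(v); since
    H > 1/2 (this is q < 2), g grows so fast that v meets U again before t has
    decreased by more than a fixed factor.  Hence the number of zeros of
    D = v(.,alpha) - U on [t0,oo), t0 = - log r0, tends to infinity with alpha.
    A zero of D is always simple, so the polar angle of (D, D') at t0 is a
    continuous function of alpha; it is unbounded, and therefore v(r0,alpha),
    which has the sign of rho(alpha) - r0, changes sign infinitely often. *)

(** * Calculus on intervals *)

(* [auto_derive] leaves [Derive (fun x => f x) x] for unknown [f]. *)
Ltac derive_at d :=
  match type of d with
  | is_derive ?f ?x ?l =>
      replace (Derive (fun z : R => f z) x) with l
        by (symmetry; apply is_derive_unique; exact d)
  end.

(** With a coefficient of order c / t, an interval of length eta t has Sturm number c eta^2 t, which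
    tends to infinity for every fixed eta > 0. Hence crude two-sided constants in the asymptotics of
    U suffice, and no limit profile of rescaled solutions enters. The delicate case is v far below
    U, where linearizing at U is meaningless. There the force on v is a small fraction of the force
    on U, v is almost straight, and a race decides: in the available time v covers at most about 2
    g/g', whereas it would have to cover sigma g/g' with sigma > 2 in order to stay below U. The
    last step rests on where zeros can come from. While alpha stays bounded, none enters from t =
    +oo, since v <= alpha < U there; simple zeros neither merge nor split. New zeros must therefore
    pass through t0, and D(t0) changes sign each time. The polar angle records this without
    following individual zeros. *)

Lemma is_derive_Rminus (f g : R -> R) (x a b : R) :
  is_derive f x a -> is_derive g x b -> is_derive (fun t => f t - g t) x (a - b).
Proof. exact (is_derive_minus f g x a b). Qed.

Lemma is_derive_Ropp (f : R -> R) (x a : R) :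
  is_derive f x a -> is_derive (fun t => - f t) x (- a).
Proof. exact (is_derive_opp f x a). Qed.

Lemma mean_value (f df : R -> R) (a b : R) :
  a < b -> (forall x, a <= x <= b -> is_derive f x (df x)) ->
  exists c, a < c < b /\ f b - f a = df c * (b - a).
Proof.
intros ab d.
destruct (MVT_cor2 f df a b ab) as [c [e hc]].
{ intros c hc; apply is_derive_Reals; auto. }
exists c; auto.
Qed.

Lemma nondecreasing_of_derive (f df : R -> R) (a b : R) :
  a <= b -> (forall x, a <= x <= b -> is_derive f x (df x)) ->
  (forall x, a <= x <= b -> 0 <= df x) -> f a <= f b.
Proof.
intros ab d p.
destruct (Req_dec a b) as [<-|ne]; [lra|].
destruct (mean_value f df a b) as [c [hc e]]; [lra|auto|].
assert (0 <= df c) by (apply p; lra).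
nra.
Qed.

Lemma continuity_pt_of_derive (f : R -> R) (x l : R) :
  is_derive f x l -> continuity_pt f x.
Proof.
intros d; apply continuity_pt_filterlim.
apply (ex_derive_continuous f); exists l; exact d.
Qed.

Lemma intermediate_zero (f : R -> R) (a b : R) :
  a <= b -> (forall x, a <= x <= b -> continuity_pt f x) ->
  f a * f b <= 0 -> exists x, a <= x <= b /\ f x = 0.
Proof.
intros ab c s.
destruct (Req_dec (f a) 0) as [za|na]; [exists a; split; [lra|exact za]|].
destruct (Req_dec (f b) 0) as [zb|nb]; [exists b; split; [lra|exact zb]|].
assert (ab' : a < b).
{ destruct (Req_dec a b) as [e|]; [|lra]. subst b. nra. }
destruct (Rlt_dec (f a) 0) as [la|la].
- destruct (IVT_interv f a b c ab' la) as [z hz]; [nra|].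
  exists z; auto.
- destruct (IVT_interv (fun x => - f x) a b) as [z [hz ez]];
    [intros; apply continuity_pt_opp; auto | exact ab' | lra | nra |].
  exists z; split; [auto|lra].
Qed.

Lemma intermediate_value (f : R -> R) (a b m : R) :
  a <= b -> (forall x, a <= x <= b -> continuity_pt f x) ->
  (f a - m) * (f b - m) <= 0 -> exists x, a <= x <= b /\ f x = m.
Proof.
intros ab c s.
destruct (intermediate_zero (fun x => f x - m) a b ab) as [z [hz e]].
- intros x hx; apply continuity_pt_minus; [auto|].
  apply continuity_pt_const; intros u w; reflexivity.
- exact s.
- exists z; split; [auto|lra].
Qed.

Lemma gronwall (E dE : R -> R) (c a b : R) :
  a <= b -> (forall x, a <= x <= b -> is_derive E x (dE x)) ->
  (forall x, a <= x <= b -> dE x <= c * E x) ->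
  E b <= E a * exp (c * (b - a)).
Proof.
intros ab d le.
assert (m : - (E a * exp (- (c * (a - a)))) <= - (E b * exp (- (c * (b - a))))).
{ apply (nondecreasing_of_derive (fun x => - (E x * exp (- (c * (x - a)))))
    (fun x => (c * E x - dE x) * exp (- (c * (x - a))))); [exact ab| |].
  - intros x hx. pose proof (d x hx) as dx.
    auto_derive; [exists (dE x); exact dx|].
    derive_at dx.
    unfold Rminus; ring.
  - intros x hx. apply Rmult_le_pos; [specialize (le x hx); lra|].
    left; apply exp_pos. }
replace (c * (a - a)) with 0 in m by ring.
rewrite Ropp_0, exp_0, exp_Ropp in m.
pose proof (exp_pos (c * (b - a))) as p.
apply Rmult_le_reg_r with (/ exp (c * (b - a))).
- apply Rinv_0_lt_compat, p.
- rewrite Rmult_assoc, Rinv_r; lra.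
Qed.

Lemma nondecreasing_le_limit (f df : R -> R) (a l : R) :
  (forall x, a <= x -> is_derive f x (df x)) ->
  (forall x, a <= x -> 0 <= df x) ->
  is_lim f p_infty l -> f a <= l.
Proof.
intros d p lim.
assert (h : Rbar_le (f a) l); [|exact h].
apply (is_lim_le_loc (fun _ => f a) f p_infty (f a) l);
  [|apply is_lim_const|exact lim].
exists a; intros x hx.
apply (nondecreasing_of_derive f df); [lra| |]; intros; [apply d|apply p]; lra.
Qed.

(* If w > 0 inside, the Wronskian of w with the sine arch on [a,b] would be
   strictly increasing and yet not larger at b than at a. *)
Lemma sturm_zero (w w1 w2 : R -> R) (c a b : R) :
  a < b -> 16 < c * (b - a) ^ 2 ->
  (forall x, a <= x <= b -> is_derive w x (w1 x)) ->
  (forall x, a <= x <= b -> is_derive w1 x (w2 x)) ->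
  (forall x, a <= x <= b -> 0 <= w x) ->
  (forall x, a <= x <= b -> w2 x <= - c * w x) ->
  exists m, a < m < b /\ w m = 0.
Proof.
intros ab cL d1 d2 pos conc.
destruct (classic (exists m, a < m < b /\ w m = 0)) as [|no]; [assumption|exfalso].
set (k := PI / (b - a)).
assert (PI4 : PI <= 4) by apply PI_4.
assert (PIp : 0 < PI) by apply PI_RGT_0.
assert (kp : 0 < k) by (apply Rdiv_lt_0_compat; lra).
assert (kL : k * (b - a) = PI) by (unfold k; field; lra).
(* The constant 16 in the statement is the square of the bound [PI <= 4]. *)
assert (k2 : k ^ 2 < c).
{ assert ((k * (b - a)) ^ 2 <= 16) by (rewrite kL; nra).
  apply Rmult_lt_reg_r with ((b - a) ^ 2); [apply pow_lt; lra|].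
  rewrite <- Rpow_mult_distr; lra. }
destruct (mean_value
  (fun x => w x * (k * cos (k * (x - a))) - w1 x * sin (k * (x - a)))
  (fun x => - (w2 x + k ^ 2 * w x) * sin (k * (x - a))) a b ab) as [x [hx e]].
{ intros x hx. pose proof (d1 x hx) as e1. pose proof (d2 x hx) as e2.
  auto_derive; [repeat split; [exists (w1 x); exact e1|exists (w2 x); exact e2]|].
  derive_at e1.
  derive_at e2.
  unfold Rminus; ring. }
rewrite kL in e; rewrite Rminus_diag, Rmult_0_r in e.
rewrite sin_0, cos_0, sin_PI, cos_PI in e.
assert (wx : 0 < w x).
{ destruct (Rle_lt_or_eq_dec 0 (w x)) as [|z]; [apply pos; lra|assumption|].
  exfalso; apply no; exists x; auto. }
assert (sx : 0 < sin (k * (x - a))).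
{ apply sin_gt_0; [apply Rmult_lt_0_compat; lra|].
  rewrite <- kL; apply Rmult_lt_compat_l; lra. }
assert (0 < - (w2 x + k ^ 2 * w x)).
{ assert (w2 x <= - c * w x) by (apply conc; lra). nra. }
assert (0 < - (w2 x + k ^ 2 * w x) * sin (k * (x - a)) * (b - a)).
{ repeat apply Rmult_lt_0_compat; lra. }
assert (0 <= w a) by (apply pos; lra).
assert (0 <= w b) by (apply pos; lra).
nra.
Qed.

(** Turns an interior zero of a nonnegative difference into a double zero, which uniqueness for the
    equation will exclude. *)
Lemma interior_minimum_critical (w w1 : R -> R) (a b m : R) :
  a < m < b -> (forall x, a <= x <= b -> is_derive w x (w1 x)) ->
  (forall x, a <= x <= b -> w m <= w x) -> w1 m = 0.
Proof.
intros hm d mini.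
assert (dm : derivable_pt_lim w m (w1 m)) by (apply is_derive_Reals, d; lra).
change (w1 m) with (derive_pt w m (exist _ (w1 m) dm)).
apply deriv_minimum with a b; [lra|lra|].
intros x h1 h2; apply mini; lra.
Qed.

(** * Growth of the nonlinearity *)

(* [g], [g1], [g2] stand for log f and its first two derivatives, so the last
   two clauses say [h <= H <= 2]; the hypothesis q < 2 is what allows
   [1 / 2 < h]. *)
Record rapid_growth (F g g1 g2 : R -> R) (h s1 : R) : Prop := {
  rg_h : 1 / 2 < h < 1;
  rg_exp : forall s, s1 <= s -> F s = exp (g s);
  rg_d1 : forall s, s1 <= s -> is_derive g s (g1 s);
  rg_d2 : forall s, s1 <= s -> is_derive g1 s (g2 s);
  rg_ge1 : forall s, s1 <= s -> 1 <= g s;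
  rg_g1 : forall s, s1 <= s -> 0 < g1 s;
  rg_lo : forall s, s1 <= s -> h * g1 s ^ 2 <= g s * g2 s;
  rg_hi : forall s, s1 <= s -> g s * g2 s <= 2 * g1 s ^ 2 }.

Section Growth.

Context (F g g1 g2 : R -> R) (h s1 : R).
Context (rg : rapid_growth F g g1 g2 h s1).

Lemma rg_g2_pos (s : R) : s1 <= s -> 0 < g2 s.
Proof.
intros hs.
pose proof (rg_h _ _ _ _ _ _ rg). pose proof (rg_ge1 _ _ _ _ _ _ rg s hs).
pose proof (rg_g1 _ _ _ _ _ _ rg s hs). pose proof (rg_lo _ _ _ _ _ _ rg s hs).
assert (0 < g1 s ^ 2) by (apply pow_lt; lra).
destruct (Rlt_le_dec 0 (g2 s)) as [|n]; [assumption|nra].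
Qed.

Lemma rg_g_le (a b : R) : s1 <= a -> a <= b -> g a <= g b.
Proof.
intros ha ab. apply (nondecreasing_of_derive g g1); [exact ab| |]; intros x hx.
- apply (rg_d1 _ _ _ _ _ _ rg); lra.
- left; apply (rg_g1 _ _ _ _ _ _ rg); lra.
Qed.

Lemma rg_g1_le (a b : R) : s1 <= a -> a <= b -> g1 a <= g1 b.
Proof.
intros ha ab. apply (nondecreasing_of_derive g1 g2); [exact ab| |]; intros x hx.
- apply (rg_d2 _ _ _ _ _ _ rg); lra.
- left; apply rg_g2_pos; lra.
Qed.

Lemma rg_secant (a b : R) :
  s1 <= a -> a <= b -> g1 a * (b - a) <= g b - g a <= g1 b * (b - a).
Proof.
intros ha ab.
destruct (Req_dec a b) as [<-|ne]; [nra|].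
destruct (mean_value g g1 a b) as [c [hc e]]; [lra| |].
{ intros; apply (rg_d1 _ _ _ _ _ _ rg); lra. }
assert (g1 a <= g1 c) by (apply rg_g1_le; lra).
assert (g1 c <= g1 b) by (apply rg_g1_le; lra).
rewrite e; split; apply Rmult_le_compat_r; lra.
Qed.

Lemma rg_g_lt_inv (a b : R) : s1 <= a -> s1 <= b -> g a < g b -> a < b.
Proof.
intros ha hb l. destruct (Rlt_le_dec a b) as [|n]; [assumption|].
pose proof (rg_g_le b a hb n). lra.
Qed.

(** The tangent inequality for the convex [g], followed by 1 + x <= e^x. As [g1 * F] is the
    derivative of [F], this is the lower bound on the coefficient that Sturm comparison needs. *)
Lemma rg_F_secant (a b : R) :
  s1 <= a -> a <= b -> g1 a * F a * (b - a) <= F b - F a.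
Proof.
intros ha ab.
rewrite (rg_exp _ _ _ _ _ _ rg a), (rg_exp _ _ _ _ _ _ rg b) by lra.
destruct (rg_secant a b ha ab) as [l _].
assert (e : 1 + (g b - g a) <= exp (g b - g a)).
{ destruct (Req_dec (g b - g a) 0) as [->|n]; [rewrite exp_0; lra|].
  left; apply exp_ineq1; exact n. }
replace (g b) with (g a + (g b - g a)) at 1 by ring.
rewrite exp_plus. pose proof (exp_pos (g a)).
apply Rle_trans with (exp (g a) * (g b - g a)).
- replace (g1 a * exp (g a) * (b - a)) with (exp (g a) * (g1 a * (b - a))) by ring.
  apply Rmult_le_compat_l; lra.
- replace (exp (g a) * exp (g b - g a) - exp (g a))
    with (exp (g a) * (exp (g b - g a) - 1)) by ring.
  apply Rmult_le_compat_l; lra.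
Qed.

Lemma rg_F_le (a b : R) : s1 <= a -> a <= b -> F a <= F b.
Proof.
intros ha ab. pose proof (rg_F_secant a b ha ab).
pose proof (rg_g1 _ _ _ _ _ _ rg a ha).
assert (0 < F a) by (rewrite (rg_exp _ _ _ _ _ _ rg a) by lra; apply exp_pos).
assert (0 <= g1 a * F a * (b - a)); [|lra].
apply Rmult_le_pos; [apply Rmult_le_pos|]; lra.
Qed.

(* [g1 / g ^ 2] is nonincreasing since [H <= 2]. *)
Lemma rg_g1_ratio (a b : R) :
  s1 <= a -> a <= b -> g1 b * g a ^ 2 <= g1 a * g b ^ 2.
Proof.
intros ha ab.
assert (ga : 1 <= g a) by (apply (rg_ge1 _ _ _ _ _ _ rg); lra).
assert (gb : 1 <= g b) by (apply (rg_ge1 _ _ _ _ _ _ rg); lra).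
assert (m : - (g1 a / g a ^ 2) <= - (g1 b / g b ^ 2)).
{ apply (nondecreasing_of_derive (fun x => - (g1 x / g x ^ 2))
    (fun x => (2 * g1 x ^ 2 - g x * g2 x) / g x ^ 3)); [exact ab| |];
    intros x hx;
    assert (gx : 1 <= g x) by (apply (rg_ge1 _ _ _ _ _ _ rg); lra).
  - assert (e1 : is_derive g x (g1 x)) by (apply (rg_d1 _ _ _ _ _ _ rg); lra).
    assert (e2 : is_derive g1 x (g2 x)) by (apply (rg_d2 _ _ _ _ _ _ rg); lra).
    auto_derive.
    { repeat split; [exists (g2 x); exact e2|exists (g1 x); exact e1|].
      apply Rgt_not_eq; nra. }
    derive_at e1.
    derive_at e2.
    field; lra.
  - assert (hi : g x * g2 x <= 2 * g1 x ^ 2)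
      by (apply (rg_hi _ _ _ _ _ _ rg); lra).
    apply Rmult_le_pos; [lra|].
    left; apply Rinv_0_lt_compat, pow_lt; lra. }
assert (pa : 0 < g a ^ 2) by (apply pow_lt; lra).
assert (pb : 0 < g b ^ 2) by (apply pow_lt; lra).
apply Rmult_le_reg_r with (/ (g a ^ 2 * g b ^ 2)).
{ apply Rinv_0_lt_compat, Rmult_lt_0_compat; assumption. }
replace (g1 b * g a ^ 2 * / (g a ^ 2 * g b ^ 2)) with (g1 b / g b ^ 2)
  by (field; lra).
replace (g1 a * g b ^ 2 * / (g a ^ 2 * g b ^ 2)) with (g1 a / g a ^ 2)
  by (field; lra).
lra.
Qed.

(** Time controls the size of [g] along a trajectory; this converts comparable values of [g] into
    comparable slopes. *)
Lemma rg_g1_ratio_le (a b C : R) :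
  s1 <= a -> a <= b -> g b <= C * g a -> g1 b <= C ^ 2 * g1 a.
Proof.
intros ha ab hC.
assert (ga : 1 <= g a) by (apply (rg_ge1 _ _ _ _ _ _ rg); lra).
assert (gb : g a <= g b) by (apply rg_g_le; lra).
pose proof (rg_g1_ratio a b ha ab) as r.
pose proof (rg_g1 _ _ _ _ _ _ rg a ha).
assert (0 < g a ^ 2) by (apply pow_lt; lra).
apply Rmult_le_reg_r with (g a ^ 2); [assumption|].
apply Rle_trans with (1 := r).
replace (C ^ 2 * g1 a * g a ^ 2) with (g1 a * (C * g a) ^ 2) by ring.
apply Rmult_le_compat_l; [lra|]. apply pow_incr; lra.
Qed.

Lemma rg_unbounded (M : R) : exists b, s1 <= b /\ forall s, b <= s -> M <= g s.
Proof.
pose proof (rg_g1 _ _ _ _ _ _ rg s1 (Rle_refl _)) as p.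
exists (Rmax s1 (s1 + (M - g s1) / g1 s1)); split; [apply Rmax_l|].
intros s hs.
assert (s1 <= s) by (apply Rle_trans with (2 := hs), Rmax_l).
assert (s1 + (M - g s1) / g1 s1 <= s) by (apply Rle_trans with (2 := hs), Rmax_r).
destruct (rg_secant s1 s) as [l _]; [lra|lra|].
assert (g1 s1 * ((M - g s1) / g1 s1) <= g1 s1 * (s - s1))
  by (apply Rmult_le_compat_l; lra).
replace (g1 s1 * ((M - g s1) / g1 s1)) with (M - g s1) in * by (field; lra).
lra.
Qed.

(* The slope of [g / g1] is [1 - H <= 1 - h < 1 / 2], so [g] stays comparable
   to [g b] on an interval of length [sigma * g b / g1 b], [sigma > 2]. A
   trajectory leaving [b] with the maximal slope [4 / g1 b] at time
   [g b / 2] moves only by [2 * g b / g1 b] up to time 0. *)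
Lemma rg_long_descent :
  exists sigma kappa b0, 2 < sigma /\ 0 < kappa < 1 /\ s1 <= b0 /\
    forall b, b0 <= b ->
      s1 <= b - sigma * (g b / g1 b) /\ kappa * g b <= g (b - sigma * (g b / g1 b)).
Proof.
pose proof (rg_h _ _ _ _ _ _ rg) as hh.
(* The midpoint of 2 and 1 / (1 - h), an interval that is nonempty exactly because h > 1/2. The
   constant [c] below is the share of [g b / g1 b] that [g / g1] still has at distance
   [sigma * (g b / g1 b)] below [b]. *)
set (sigma := (2 + / (1 - h)) / 2).
assert (i2 : 2 < / (1 - h)).
{ rewrite <- (Rinv_inv 2). apply Rinv_lt_contravar; [|lra].
  apply Rmult_lt_0_compat; lra. }
set (c := 1 - (1 - h) * sigma).
assert (cval : c = (1 - 2 * (1 - h)) / 2) by (unfold c, sigma; field; lra).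
assert (cpos : 0 < c < 1) by lra.
assert (spos : 2 < sigma) by (unfold sigma; lra).
assert (slope : forall x b, s1 <= x -> x <= b ->
  g b / g1 b - g x / g1 x <= (1 - h) * (b - x)).
{ intros x b hx xb.
  cut ((1 - h) * x - g x / g1 x <= (1 - h) * b - g b / g1 b); [lra|].
  apply (nondecreasing_of_derive (fun y => (1 - h) * y - g y / g1 y)
    (fun y => (g y * g2 y - h * g1 y ^ 2) / g1 y ^ 2)); [exact xb| |];
    intros y hy;
    assert (p : 0 < g1 y) by (apply (rg_g1 _ _ _ _ _ _ rg); lra).
  - assert (e1 : is_derive g y (g1 y)) by (apply (rg_d1 _ _ _ _ _ _ rg); lra).
    assert (e2 : is_derive g1 y (g2 y)) by (apply (rg_d2 _ _ _ _ _ _ rg); lra).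
    auto_derive.
    { repeat split; [exists (g1 y); exact e1|exists (g2 y); exact e2|lra]. }
    derive_at e1.
    derive_at e2.
    field; lra.
  - assert (lo : h * g1 y ^ 2 <= g y * g2 y)
      by (apply (rg_lo _ _ _ _ _ _ rg); lra).
    apply Rmult_le_pos; [lra|].
    left; apply Rinv_0_lt_compat, pow_lt; lra. }
set (gam1 := g s1 / g1 s1).
(* Solves [sigma * (gam1 + (1 - h) * (b - s1)) <= b - s1] for [b], so that the descent from [b] ends
   above [s1]. *)
set (b0 := Rmax s1 ((sigma * gam1 + s1 - (1 - h) * sigma * s1) / c)).
exists sigma, (exp (- (sigma / c))), b0.
split; [exact spos|]. split.
{ split; [apply exp_pos|]. rewrite <- exp_0. apply exp_increasing.
  apply Ropp_lt_gt_0_contravar, Rdiv_lt_0_compat; lra. }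
split; [apply Rmax_l|]. intros b hb.
assert (sb : s1 <= b) by (apply Rle_trans with (2 := hb), Rmax_l).
assert (hb2 : sigma * gam1 + s1 - (1 - h) * sigma * s1 <= c * b).
{ apply Rmult_le_reg_r with (/ c); [apply Rinv_0_lt_compat; lra|].
  apply Rle_trans with b; [apply Rle_trans with (2 := hb), Rmax_r|].
  right; field; lra. }
set (gb := g b / g1 b).
assert (gbp : 0 < gb).
{ apply Rdiv_lt_0_compat; [|apply (rg_g1 _ _ _ _ _ _ rg); lra].
  pose proof (rg_ge1 _ _ _ _ _ _ rg b sb); lra. }
assert (hgb : gb <= gam1 + (1 - h) * (b - s1)).
{ pose proof (slope s1 b (Rle_refl _) sb). unfold gb, gam1. lra. }
assert (ha : s1 <= b - sigma * gb).
{ assert (sigma * gb <= sigma * (gam1 + (1 - h) * (b - s1)))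
    by (apply Rmult_le_compat_l; lra).
  unfold c in hb2. nra. }
split; [exact ha|].
set (a := b - sigma * gb) in *.
assert (ab : a <= b) by (unfold a; nra).
assert (ga : 1 <= g a) by (apply (rg_ge1 _ _ _ _ _ _ rg); lra).
assert (gbb : 1 <= g b) by (apply (rg_ge1 _ _ _ _ _ _ rg); lra).
(* On [a, b] the logarithmic derivative of [g] is at most [/ (c * gb)]. Over the length [sigma * gb]
   this costs at most [sigma / c] in [ln g], whence [kappa]. *)
assert (m : a / (c * gb) - ln (g a) <= b / (c * gb) - ln (g b)).
{ apply (nondecreasing_of_derive (fun x => x / (c * gb) - ln (g x))
    (fun x => / (c * gb) - g1 x / g x)); [exact ab| |]; intros x hx;
    assert (gx : 1 <= g x) by (apply (rg_ge1 _ _ _ _ _ _ rg); lra).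
  - assert (e1 : is_derive g x (g1 x)) by (apply (rg_d1 _ _ _ _ _ _ rg); lra).
    auto_derive; [repeat split; [exists (g1 x); exact e1|lra]|].
    derive_at e1.
    field; split; [lra|split; lra].
  - assert (p : 0 < g1 x) by (apply (rg_g1 _ _ _ _ _ _ rg); lra).
    assert (low : c * gb <= g x / g1 x).
    { assert (sl : g b / g1 b - g x / g1 x <= (1 - h) * (b - x))
        by (apply slope; lra).
      fold gb in sl.
      assert ((1 - h) * (b - x) <= (1 - h) * (sigma * gb)).
      { apply Rmult_le_compat_l; [lra|]. unfold a in hx; lra. }
      unfold c; nra. }
    replace (g1 x / g x) with (/ (g x / g1 x)) by (field; split; lra).
    assert (/ (g x / g1 x) <= / (c * gb)); [|lra].
    apply Rinv_le_contravar; [apply Rmult_lt_0_compat; lra|exact low]. }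
assert (m2 : ln (g b) - sigma / c <= ln (g a)).
{ replace (sigma / c) with (b / (c * gb) - a / (c * gb)); [lra|].
  unfold a; field; split; lra. }
apply Rle_trans with (exp (ln (g b) - sigma / c)).
- unfold Rminus; rewrite exp_plus, exp_ln by lra. lra.
- rewrite <- (exp_ln (g a)) by lra.
  destruct (Rle_lt_or_eq_dec _ _ m2) as [l| ->]; [|lra].
  left; apply exp_increasing; exact l.
Qed.

End Growth.

(** * Radial solutions in the variable t = - log r *)

(** The Lipschitz bound holds on whole half-lines (-oo, M]: regular solutions are bounded above by
    alpha but not below, and [F] is constant on the negative side. *)
Record nonlinearity (F : R -> R) : Prop := {
  nl_pos : forall x, 0 < F x;
  nl_neg : forall x, x <= 0 -> F x = F 0;
  nl_lip : forall M, exists L, 0 <= L /\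
    forall x y, x <= M -> y <= M -> Rabs (F x - F y) <= L * Rabs (x - y) }.

Definition log_solution (F y y1 : R -> R) : Prop :=
  forall t, is_derive y t (y1 t) /\ is_derive y1 t (- (exp (-2 * t) * F (y t))).

(** A finite limit at t = +oo encodes both conditions at r = 0. Since [F] is positive, [y] is
    concave; a finite limit then forces a positive slope tending to 0, and the equation makes this
    slope O(e^(-2t)). *)
Definition log_regular (F : R -> R) (alpha : R) (y y1 : R -> R) : Prop :=
  log_solution F y y1 /\ is_lim y p_infty alpha.

Lemma log_solution_continuity (F y y1 : R -> R) (t : R) :
  log_solution F y y1 -> continuity_pt y t /\ continuity_pt y1 t.
Proof.
intros s; destruct (s t) as [d1 d2].
split; eapply continuity_pt_of_derive; eassumption.
Qed.

Lemma nonlinearity_bounded (F : R -> R) (M : R) :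
  nonlinearity F -> exists C, 0 < C /\ forall x, x <= M -> F x <= C.
Proof.
intros nl. destruct (nl_lip _ nl (Rmax 0 M)) as [L [L0 hL]].
pose proof (Rmax_l 0 M) as m0. pose proof (Rmax_r 0 M) as mM.
exists (F 0 + L * Rmax 0 M); split.
{ pose proof (nl_pos _ nl 0). assert (0 <= L * Rmax 0 M) by (apply Rmult_le_pos; lra).
  lra. }
intros x hx. destruct (Rle_lt_dec x 0) as [n|p].
- rewrite (nl_neg _ nl x n). assert (0 <= L * Rmax 0 M) by (apply Rmult_le_pos; lra).
  lra.
- assert (e : Rabs (F x - F 0) <= L * Rabs (x - 0)) by (apply hL; lra).
  rewrite Rminus_0_r, (Rabs_pos_eq x) in e by lra.
  pose proof (Rle_abs (F x - F 0)).
  assert (L * x <= L * Rmax 0 M) by (apply Rmult_le_compat_l; lra). lra.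
Qed.

Lemma nonlinearity_continuity (F : R -> R) (x : R) :
  nonlinearity F -> continuity_pt F x.
Proof.
intros nl. destruct (nl_lip _ nl (x + 1)) as [L [L0 hL]].
intros eps he. exists (Rmin 1 (eps / (L + 1))). split.
{ apply Rmin_pos; [lra|apply Rdiv_lt_0_compat; lra]. }
intros z [_ hz]. simpl in hz |- *; unfold R_dist in hz |- *.
assert (z1 : Rabs (z - x) < 1) by (apply Rlt_le_trans with (1 := hz), Rmin_l).
assert (z2 : Rabs (z - x) < eps / (L + 1))
  by (apply Rlt_le_trans with (1 := hz), Rmin_r).
apply Rabs_def2 in z1.
assert (e : Rabs (F z - F x) <= L * Rabs (z - x)) by (apply hL; lra).
assert (e2 : (L + 1) * Rabs (z - x) < eps).
{ replace eps with ((L + 1) * (eps / (L + 1))) by (field; lra).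
  apply Rmult_lt_compat_l; lra. }
pose proof (Rabs_pos (z - x)). nra.
Qed.

Lemma log_solution_slope_decreasing (F y y1 : R -> R) (a b : R) :
  nonlinearity F -> log_solution F y y1 -> a < b -> y1 b < y1 a.
Proof.
intros nl s ab.
destruct (mean_value y1 (fun t => - (exp (-2 * t) * F (y t))) a b ab)
  as [c [hc e]]; [intros; apply s|].
assert (0 < exp (-2 * c) * F (y c))
  by (apply Rmult_lt_0_compat; [apply exp_pos|apply nl_pos, nl]).
nra.
Qed.

Lemma log_solution_slope_le (F y y1 : R -> R) (a b : R) :
  nonlinearity F -> log_solution F y y1 -> a <= b -> y1 b <= y1 a.
Proof.
intros nl s [ab| ->]; [|lra].
left; eapply log_solution_slope_decreasing; eassumption.
Qed.

(** Gronwall for the squared distance in the phase plane: to the right of [a] the weight is at most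
    e^(-2a), and the maxima of both solutions on [a, t] select the Lipschitz constant. The direction
    t -> +oo is the one where U leaves every regular solution behind. *)
Lemma log_solution_unique (F y y1 z z1 : R -> R) (a : R) :
  nonlinearity F -> log_solution F y y1 -> log_solution F z z1 ->
  y a = z a -> y1 a = z1 a -> forall t, a <= t -> y t = z t.
Proof.
intros nl sy sz e0 e1 t at_.
destruct (continuity_ab_maj y a t at_) as [my [hmy _]].
{ intros; apply (log_solution_continuity F y y1); exact sy. }
destruct (continuity_ab_maj z a t at_) as [mz [hmz _]].
{ intros; apply (log_solution_continuity F z z1); exact sz. }
destruct (nl_lip _ nl (Rmax (y my) (z mz))) as [L [L0 hL]].
set (E := fun x => (y x - z x) ^ 2 + (y1 x - z1 x) ^ 2).
assert (g : E t <= E a * exp ((1 + exp (-2 * a) * L) * (t - a))).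
{ apply (gronwall E (fun x => 2 * (y x - z x) * (y1 x - z1 x)
      + 2 * (y1 x - z1 x) * (- (exp (-2 * x) * (F (y x) - F (z x)))))); [exact at_| |].
  - intros x hx. destruct (sy x) as [dy dy1]. destruct (sz x) as [dz dz1].
    unfold E. auto_derive.
    { repeat split; eexists; eassumption. }
    derive_at dy.
    derive_at dy1.
    derive_at dz.
    derive_at dz1.
    ring.
  - intros x hx. unfold E.
    set (D := y x - z x). set (D1 := y1 x - z1 x).
    assert (l : Rabs (F (y x) - F (z x)) <= L * Rabs D).
    { apply hL; [apply Rle_trans with (y my); [apply hmy; lra|apply Rmax_l]
        |apply Rle_trans with (z mz); [apply hmz; lra|apply Rmax_r]]. }
    assert (ex : exp (-2 * x) <= exp (-2 * a)).
    { destruct (Req_dec x a) as [->|n]; [lra|].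
      left; apply exp_increasing; lra. }
    pose proof (exp_pos (-2 * x)) as ep.
    assert (b1 : 2 * Rabs D * Rabs D1 <= D ^ 2 + D1 ^ 2).
    { rewrite <- (pow2_abs D), <- (pow2_abs D1).
      pose proof (pow2_ge_0 (Rabs D - Rabs D1)). nra. }
    assert (t1 : 2 * D * D1 <= D ^ 2 + D1 ^ 2)
      by (pose proof (pow2_ge_0 (D - D1)); nra).
    assert (t2 : 2 * D1 * (- (exp (-2 * x) * (F (y x) - F (z x))))
      <= exp (-2 * a) * L * (D ^ 2 + D1 ^ 2)).
    { apply Rle_trans with (1 := Rle_abs _).
      rewrite !Rabs_mult, Rabs_Ropp, Rabs_mult, (Rabs_pos_eq 2),
        (Rabs_pos_eq (exp (-2 * x))) by lra.
      pose proof (Rabs_pos D). pose proof (Rabs_pos D1).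
      pose proof (Rabs_pos (F (y x) - F (z x))).
      apply Rle_trans with (2 * Rabs D1 * (exp (-2 * a) * (L * Rabs D))).
      - apply Rmult_le_compat_l; [lra|]. apply Rmult_le_compat; lra.
      - replace (2 * Rabs D1 * (exp (-2 * a) * (L * Rabs D)))
          with (exp (-2 * a) * L * (2 * Rabs D * Rabs D1)) by ring.
        apply Rmult_le_compat_l; [|lra].
        apply Rmult_le_pos; lra. }
    lra. }
assert (Ea : E a = 0) by (unfold E; rewrite e0, e1; ring).
rewrite Ea, Rmult_0_l in g. unfold E in g.
pose proof (pow2_ge_0 (y t - z t)). pose proof (pow2_ge_0 (y1 t - z1 t)).
assert (sq : (y t - z t) ^ 2 = 0) by lra. nra.
Qed.

(** * Regular solutions: concavity, decay of the slope, dependence on alpha *)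

Section Regular.

Context (F : R -> R) (nl : nonlinearity F).

Lemma log_regular_near (alpha : R) (y y1 : R -> R) (eps : R) :
  log_regular F alpha y y1 -> 0 < eps ->
  exists X, forall x, X <= x -> Rabs (y x - alpha) < eps.
Proof.
intros [_ l] he. apply is_lim_spec in l.
destruct (l (mkposreal eps he)) as [X hX]. exists (X + 1).
intros x hx. apply hX. lra.
Qed.

(** By strict concavity a nonpositive slope would stay below some -c < 0 from then on. In time 3 / c
    the solution would fall by at least 3, although two values within 1 of alpha differ by less than
    2. *)
Lemma log_regular_slope_pos (alpha : R) (y y1 : R -> R) (t : R) :
  log_regular F alpha y y1 -> 0 < y1 t.
Proof.
intros r. destruct (Rlt_le_dec 0 (y1 t)) as [|n]; [assumption|exfalso].
destruct (log_regular_near alpha y y1 1 r) as [X hX]; [lra|].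
destruct r as [s _].
assert (d : y1 (t + 1) < y1 t)
  by (apply (log_solution_slope_decreasing F y); auto; lra).
set (c := - y1 (t + 1)). assert (cp : 0 < c) by (unfold c; lra).
set (x0 := Rmax X (t + 1)).
assert (x0X : X <= x0) by apply Rmax_l. assert (x0t : t + 1 <= x0) by apply Rmax_r.
assert (p3 : 0 < 3 / c) by (apply Rdiv_lt_0_compat; lra).
destruct (mean_value y y1 x0 (x0 + 3 / c)) as [m [hm e]];
  [lra|intros; apply s|].
assert (y1 m <= - c).
{ unfold c; rewrite Ropp_involutive.
  apply (log_solution_slope_le F y); auto; lra. }
assert (A : Rabs (y x0 - alpha) < 1) by (apply hX; lra).
assert (B : Rabs (y (x0 + 3 / c) - alpha) < 1) by (apply hX; lra).
apply Rabs_def2 in A. apply Rabs_def2 in B.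
assert (y1 m * (3 / c) <= - c * (3 / c)) by (apply Rmult_le_compat_r; lra).
replace (- c * (3 / c)) with (-3) in * by (field; lra).
replace (x0 + 3 / c - x0) with (3 / c) in e by ring. lra.
Qed.

Lemma log_regular_increasing (alpha : R) (y y1 : R -> R) (a b : R) :
  log_regular F alpha y y1 -> a < b -> y a < y b.
Proof.
intros r ab.
destruct (mean_value y y1 a b ab) as [m [hm e]]; [intros; apply (proj1 r)|].
pose proof (log_regular_slope_pos alpha y y1 m r). nra.
Qed.

Lemma log_regular_le (alpha : R) (y y1 : R -> R) (t : R) :
  log_regular F alpha y y1 -> y t <= alpha.
Proof.
intros r. apply (nondecreasing_le_limit y y1).
- intros; apply (proj1 r).
- intros; left; apply (log_regular_slope_pos alpha y y1); exact r.
- exact (proj2 r).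
Qed.

Lemma log_regular_slope_lim (alpha : R) (y y1 : R -> R) :
  log_regular F alpha y y1 -> is_lim y1 p_infty 0.
Proof.
intros r. apply is_lim_spec. intros [eps he].
destruct (log_regular_near alpha y y1 1 r) as [X hX]; [lra|].
assert (p3 : 0 < 3 / eps) by (apply Rdiv_lt_0_compat; lra).
exists (X + 3 / eps). intros x hx. simpl. rewrite Rminus_0_r.
pose proof (log_regular_slope_pos alpha y y1 x r) as px.
rewrite Rabs_pos_eq by lra.
destruct (Rlt_le_dec (y1 x) eps) as [|n]; [assumption|exfalso].
destruct (mean_value y y1 X (X + 3 / eps)) as [m [hm e]];
  [lra|intros; apply (proj1 r)|].
assert (y1 x <= y1 m) by (apply (log_solution_slope_le F y); [exact nl|apply r|lra]).
assert (A : Rabs (y X - alpha) < 1) by (apply hX; lra).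
assert (B : Rabs (y (X + 3 / eps) - alpha) < 1) by (apply hX; lra).
apply Rabs_def2 in A. apply Rabs_def2 in B.
assert (eps * (3 / eps) <= y1 m * (3 / eps)) by (apply Rmult_le_compat_r; lra).
replace (eps * (3 / eps)) with 3 in * by (field; lra).
replace (X + 3 / eps - X) with (3 / eps) in e by ring. lra.
Qed.

Lemma is_lim_exp_decay (c : R) : is_lim (fun t => c * exp (-2 * t)) p_infty 0.
Proof.
replace (Finite 0) with (Rbar_mult c 0) by (simpl; f_equal; ring).
apply is_lim_scal_l.
apply is_lim_comp with m_infty; [apply is_lim_exp_m| |].
- apply is_lim_spec. intros M. exists (Rabs M). intros x hx.
  pose proof (Rle_abs (- M)). rewrite Rabs_Ropp in *. pose proof (Rabs_pos M). lra.
- exists 0; intros; discriminate.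
Qed.

(** This is the equation integrated over [t, oo), with slope 0 at infinity; monotonicity towards a
    limit takes the place of an improper integral. *)
Lemma log_regular_slope_bound (alpha C : R) (y y1 : R -> R) (a t : R) :
  log_regular F alpha y y1 -> (forall s, a <= s -> F (y s) <= C) -> a <= t ->
  y1 t <= C / 2 * exp (-2 * t).
Proof.
intros r hC at_.
cut (y1 t - C / 2 * exp (-2 * t) <= 0); [lra|].
apply (nondecreasing_le_limit (fun s => y1 s - C / 2 * exp (-2 * s))
  (fun s => exp (-2 * s) * (C - F (y s)))).
- intros x hx. destruct (proj1 r x) as [_ d].
  auto_derive; [eexists; exact d|].
  derive_at d. field.
- intros x hx. apply Rmult_le_pos; [left; apply exp_pos|].
  assert (F (y x) <= C) by (apply hC; lra). lra.
- replace (Finite 0) with (Rbar_minus 0 0) by (simpl; f_equal; ring).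
  apply (is_lim_minus y1 (fun s => C / 2 * exp (-2 * s)) p_infty 0 0).
  + apply (log_regular_slope_lim alpha y); exact r.
  + apply is_lim_exp_decay.
  + unfold is_Rbar_minus, is_Rbar_plus; simpl. f_equal; f_equal; ring.
Qed.

Lemma log_regular_slope_lower (alpha C : R) (y y1 : R -> R) (a t : R) :
  log_regular F alpha y y1 -> (forall s, a <= s -> C <= F (y s)) -> a <= t ->
  C / 2 * exp (-2 * t) <= y1 t.
Proof.
intros r hC at_.
cut (C / 2 * exp (-2 * t) - y1 t <= 0); [lra|].
apply (nondecreasing_le_limit (fun s => C / 2 * exp (-2 * s) - y1 s)
  (fun s => exp (-2 * s) * (F (y s) - C))).
- intros x hx. destruct (proj1 r x) as [_ d].
  auto_derive; [eexists; exact d|]. derive_at d. field.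
- intros x hx. apply Rmult_le_pos; [left; apply exp_pos|].
  assert (C <= F (y x)) by (apply hC; lra). lra.
- replace (Finite 0) with (Finite (0 - 0)) by (f_equal; ring).
  apply (is_lim_minus' (fun s => C / 2 * exp (-2 * s)) y1 p_infty).
  + apply is_lim_exp_decay.
  + apply (log_regular_slope_lim alpha y); exact r.
Qed.

Lemma log_regular_value_bound (alpha C : R) (y y1 : R -> R) (a : R) :
  log_regular F alpha y y1 -> (forall s, a <= s -> F (y s) <= C) ->
  alpha - C / 4 * exp (-2 * a) <= y a.
Proof.
intros r hC.
cut (- y a - C / 4 * exp (-2 * a) <= - alpha); [lra|].
apply (nondecreasing_le_limit (fun s => - y s - C / 4 * exp (-2 * s))
  (fun s => - y1 s + C / 2 * exp (-2 * s))).
- intros x hx. destruct (proj1 r x) as [d _].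
  auto_derive; [eexists; exact d|].
  derive_at d. field.
- intros x hx. pose proof (log_regular_slope_bound alpha C y y1 a x r hC hx). lra.
- replace (Finite (- alpha)) with (Finite (- alpha - 0)) by (f_equal; ring).
  apply (is_lim_minus' (fun s => - y s) (fun s => C / 4 * exp (-2 * s)) p_infty).
  + apply (is_lim_opp y p_infty alpha), r.
  + apply is_lim_exp_decay.
Qed.

(* In the variable r the energy is [D ^ 2 + (dD/dr) ^ 2]; the singular term
   of the radial Laplacian has the favourable sign. *)
Lemma log_regular_dependence (alpha beta M L : R) (y y1 z z1 : R -> R) (t : R) :
  log_regular F alpha y y1 -> log_regular F beta z z1 ->
  alpha <= M -> beta <= M -> 0 <= L ->
  (forall u w, u <= M -> w <= M -> Rabs (F u - F w) <= L * Rabs (u - w)) ->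
  (y t - z t) ^ 2 + exp (2 * t) * (y1 t - z1 t) ^ 2
    <= (alpha - beta) ^ 2 * exp ((1 + L) * exp (- t)).
Proof.
intros ry rz hy hz L0 hL.
set (E := fun x => (y x - z x) ^ 2 + exp (2 * x) * (y1 x - z1 x) ^ 2).
set (dE := fun x => 2 * (y x - z x) * (y1 x - z1 x)
  + 2 * exp (2 * x) * (y1 x - z1 x) ^ 2
  - 2 * (y1 x - z1 x) * (F (y x) - F (z x))).
(* Gronwall in the variable r = e^(-x): the energy grows in r at rate at most 1 + L, so its product
   with e^(-(1 + L) r) is nondecreasing in x. *)
assert (mono : forall x, t <= x ->
  E t * exp (- ((1 + L) * exp (- t))) <= E x * exp (- ((1 + L) * exp (- x)))).
{ intros x tx.
  apply (nondecreasing_of_derive (fun x => E x * exp (- ((1 + L) * exp (- x))))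
   (fun x => (dE x + (1 + L) * exp (- x) * E x) * exp (- ((1 + L) * exp (- x)))));
   [exact tx| |]; intros s hs.
  - destruct (proj1 ry s) as [dy dy1]. destruct (proj1 rz s) as [dz dz1].
    assert (dEs : is_derive E s (dE s)).
    { unfold E, dE. auto_derive; [repeat split; eexists; eassumption|].
      derive_at dy.
      derive_at dy1.
      derive_at dz.
      derive_at dz1.
      assert (ee : exp (2 * s) * exp (-2 * s) = 1).
      { rewrite <- exp_plus, <- exp_0; f_equal; ring. }
      replace (2 * (y1 s - z1 s) * (F (y s) - F (z s)))
        with (2 * (y1 s - z1 s) * (exp (2 * s) * exp (-2 * s)) * (F (y s) - F (z s)))
        by (rewrite ee; ring).
      ring. }
    auto_derive; [eexists; exact dEs|].
    derive_at dEs. ring.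
  - apply Rmult_le_pos; [|left; apply exp_pos].
    unfold dE, E. set (D := y s - z s). set (D1 := y1 s - z1 s).
    assert (l : Rabs (F (y s) - F (z s)) <= L * Rabs D).
    { apply hL; [apply Rle_trans with alpha|apply Rle_trans with beta]; auto;
      eapply log_regular_le; eassumption. }
    set (e := exp s). assert (ep : 0 < e) by apply exp_pos.
    replace (exp (2 * s)) with (e ^ 2)
      by (unfold e; rewrite <- Rsqr_pow2; unfold Rsqr; rewrite <- exp_plus; f_equal; ring).
    rewrite exp_Ropp. fold e.
    assert (k : 0 <= 2 * e ^ 2 * D1 ^ 2).
    { apply Rmult_le_pos; [|apply pow2_ge_0].
      apply Rmult_le_pos; [lra|apply pow2_ge_0]. }
    assert (b1 : 2 * (Rabs D * Rabs D1) <= / e * (D ^ 2 + e ^ 2 * D1 ^ 2)).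
    { rewrite <- (pow2_abs D), <- (pow2_abs D1).
      apply Rmult_le_reg_l with e; [exact ep|].
      rewrite <- (Rmult_assoc e (/ e)), Rinv_r by lra.
      pose proof (pow2_ge_0 (Rabs D - e * Rabs D1)). nra. }
    assert (t1 : - (2 * D * D1) <= 2 * (Rabs D * Rabs D1)).
    { rewrite <- Rabs_mult. pose proof (Rle_abs (- (D * D1))).
      rewrite Rabs_Ropp in *. lra. }
    assert (t2 : 2 * D1 * (F (y s) - F (z s)) <= L * (2 * (Rabs D * Rabs D1))).
    { apply Rle_trans with (1 := Rle_abs _).
      rewrite !Rabs_mult, (Rabs_pos_eq 2) by lra.
      apply Rle_trans with (2 * Rabs D1 * (L * Rabs D)); [|right; ring].
      apply Rmult_le_compat_l; [pose proof (Rabs_pos D1); lra|exact l]. }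
    assert (t3 : L * (2 * (Rabs D * Rabs D1)) <= L * (/ e * (D ^ 2 + e ^ 2 * D1 ^ 2)))
      by (apply Rmult_le_compat_l; lra).
    lra. }
destruct (nonlinearity_bounded F M nl) as [C [Cp hC]].
(* The second term of [E] has the indeterminate form e^(2x) times the square of a vanishing slope.
   Both slopes lie between 0 and C/2 e^(-2x), so the term is at most the vanishing one used here. *)
set (G := fun x => (y x - z x) ^ 2 + C ^ 2 * exp (-2 * x)).
assert (lower : forall x, t <= x -> E t * exp (- ((1 + L) * exp (- t))) <= G x).
{ intros x tx. apply Rle_trans with (1 := mono x tx).
  assert (Ep : 0 <= E x).
  { unfold E. pose proof (pow2_ge_0 (y x - z x)). pose proof (pow2_ge_0 (y1 x - z1 x)).
    pose proof (exp_pos (2 * x)). nra. }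
  apply Rle_trans with (E x).
  { rewrite <- (Rmult_1_r (E x)) at 2. apply Rmult_le_compat_l; [exact Ep|].
    apply Rle_trans with (exp 0); [|rewrite exp_0; lra].
    left. apply exp_increasing, Ropp_lt_gt_0_contravar.
    apply Rmult_lt_0_compat; [lra|apply exp_pos]. }
  unfold E, G. apply Rplus_le_compat_l.
  assert (b1 : y1 x <= C / 2 * exp (-2 * x)).
  { apply (log_regular_slope_bound alpha C y y1 x); [exact ry| |lra].
    intros s _; apply hC, Rle_trans with alpha; [|exact hy].
    apply (log_regular_le alpha y y1); exact ry. }
  assert (b2 : z1 x <= C / 2 * exp (-2 * x)).
  { apply (log_regular_slope_bound beta C z z1 x); [exact rz| |lra].
    intros s _; apply hC, Rle_trans with beta; [|exact hz].
    apply (log_regular_le beta z z1); exact rz. }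
  pose proof (log_regular_slope_pos alpha y y1 x ry).
  pose proof (log_regular_slope_pos beta z z1 x rz).
  pose proof (exp_pos (-2 * x)) as ep.
  assert (sq : (y1 x - z1 x) ^ 2 <= (C * exp (-2 * x)) ^ 2).
  { assert (0 < C * exp (-2 * x)) by (apply Rmult_lt_0_compat; lra).
    assert (- (C * exp (-2 * x)) <= y1 x - z1 x <= C * exp (-2 * x)) by lra. nra. }
  apply Rle_trans with (exp (2 * x) * (C * exp (-2 * x)) ^ 2).
  { apply Rmult_le_compat_l; [left; apply exp_pos|exact sq]. }
  assert (ee : exp (2 * x) * exp (-2 * x) = 1).
  { rewrite <- exp_plus, <- exp_0; f_equal; ring. }
  right. replace (exp (2 * x) * (C * exp (-2 * x)) ^ 2)
    with (C ^ 2 * exp (-2 * x) * (exp (2 * x) * exp (-2 * x))) by ring.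
  rewrite ee; ring. }
assert (lim : is_lim G p_infty ((alpha - beta) ^ 2)).
{ replace (Finite ((alpha - beta) ^ 2))
    with (Finite ((alpha - beta) * (alpha - beta) + 0)) by (f_equal; ring).
  assert (dl : is_lim (fun x => y x - z x) p_infty (alpha - beta))
    by (apply is_lim_minus'; [apply ry|apply rz]).
  apply is_lim_plus'.
  - apply is_lim_ext with (fun x => (y x - z x) * (y x - z x)); [intros; ring|].
    apply (is_lim_mult _ _ p_infty (alpha - beta) (alpha - beta)); auto.
    exact I.
  - apply is_lim_exp_decay. }
assert (fin : Rbar_le (E t * exp (- ((1 + L) * exp (- t)))) ((alpha - beta) ^ 2)).
{ apply (is_lim_le_loc (fun _ => E t * exp (- ((1 + L) * exp (- t)))) G p_infty);
    [exists t; intros; apply lower; lra|apply is_lim_const|exact lim]. }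
simpl in fin. rewrite exp_Ropp in fin.
pose proof (exp_pos ((1 + L) * exp (- t))) as p.
apply Rmult_le_reg_r with (/ exp ((1 + L) * exp (- t)));
  [apply Rinv_0_lt_compat, p|].
rewrite Rmult_assoc, Rinv_r by lra. fold (E t). lra.
Qed.

End Regular.

(** * Intersections of regular solutions with the singular one *)

(** The last two clauses bound the linearized coefficient e^(-2t) F'(U), because [g1 * F] is F'. The
    parameter [delta] measures how close g(U) is to 2t from below; it is chosen later, with [c0] and
    [C0] independent of it and only [T] adapting. *)
Record singular_asymptotics (F g g1 U : R -> R) (s1 c0 C0 delta T : R) : Prop := {
  sa_T : 0 < T;
  sa_c0 : 0 < c0;
  sa_C0 : 0 < C0;
  sa_s1 : forall t, T <= t -> s1 <= U t;
  sa_g_lo : forall t, T <= t -> 2 * (1 - delta) * t <= g (U t);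
  sa_g_hi : forall t, T <= t -> g (U t) <= 3 * t;
  sa_lo : forall t, T <= t -> c0 / t <= exp (-2 * t) * (g1 (U t) * F (U t));
  sa_hi : forall t, T <= t -> exp (-2 * t) * (g1 (U t) * F (U t)) <= C0 / t }.

Section Intersections.

Context (F g g1 g2 : R -> R) (h s1 : R).
Context (nl : nonlinearity F) (rg : rapid_growth F g g1 g2 h s1).

(* Pohozaev-type functional: [Q = g1(v) v1^2 / 2 - 2 v1 + e^(g(v) - 2 t)]
   satisfies [Q' = g2(v) v1^3 / 2 >= 0] and tends to 0, hence [Q <= 0]. *)
Lemma log_regular_slope_le_4 (alpha : R) (v v1 : R -> R) (t : R) :
  log_regular F alpha v v1 -> s1 <= v t -> g1 (v t) * v1 t <= 4.
Proof.
intros r hv.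
assert (incr : forall x, t <= x -> s1 <= v x).
{ intros x [tx| <-]; [|exact hv].
  pose proof (log_regular_increasing F nl alpha v v1 t x r tx). lra. }
set (Q := fun x => g1 (v x) * v1 x ^ 2 / 2 - 2 * v1 x + exp (g (v x) - 2 * x)).
assert (ha : s1 <= alpha).
{ apply Rle_trans with (v t); [exact hv|eapply log_regular_le; eassumption]. }
(* Freezing the coefficients of [Q] at alpha gives a majorant whose limit 0 follows from that of
   [v1]. *)
set (B := fun x => g1 alpha / 2 * (v1 x * v1 x) + exp (g alpha) * exp (-2 * x)).
assert (upper : forall x, t <= x -> Q t <= B x).
{ intros x tx. apply Rle_trans with (Q x).
  - apply (nondecreasing_of_derive Q (fun s => g2 (v s) * v1 s ^ 3 / 2));
      [exact tx| |]; intros s hs; assert (hvs : s1 <= v s) by (apply incr; lra).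
    + destruct (proj1 r s) as [d d1].
      pose proof (rg_d1 _ _ _ _ _ _ rg _ hvs) as e1.
      pose proof (rg_d2 _ _ _ _ _ _ rg _ hvs) as e2.
      unfold Q. auto_derive; [repeat split; eexists; eassumption|].
      derive_at d. derive_at d1. derive_at e1. derive_at e2.
      rewrite (rg_exp _ _ _ _ _ _ rg _ hvs).
      replace (exp (g (v s) + - (2 * s))) with (exp (-2 * s) * exp (g (v s)))
        by (rewrite <- exp_plus; f_equal; ring).
      field.
    + pose proof (log_regular_slope_pos F nl alpha v v1 s r).
      pose proof (rg_g2_pos _ _ _ _ _ _ rg _ hvs).
      assert (0 < v1 s ^ 3) by (apply pow_lt; assumption). nra.
  - pose proof (log_regular_slope_pos F nl alpha v v1 x r) as p.
    pose proof (log_regular_le F nl alpha v v1 x r) as le.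
    pose proof (incr x tx) as hx.
    pose proof (rg_g1_le _ _ _ _ _ _ rg _ _ hx le) as m1.
    pose proof (rg_g_le _ _ _ _ _ _ rg _ _ hx le) as m0.
    assert (ex : exp (g (v x) - 2 * x) <= exp (g alpha) * exp (-2 * x)).
    { rewrite <- exp_plus.
      destruct (Rle_lt_or_eq_dec _ _ m0) as [lt|eq].
      - left; apply exp_increasing; lra.
      - right; f_equal; rewrite eq; ring. }
    unfold Q, B.
    assert (g1 (v x) * v1 x ^ 2 / 2 <= g1 alpha / 2 * (v1 x * v1 x)); [|lra].
    assert (0 <= v1 x * v1 x) by nra.
    replace (g1 (v x) * v1 x ^ 2 / 2) with (g1 (v x) / 2 * (v1 x * v1 x)) by field.
    apply Rmult_le_compat_r; lra. }
assert (limB : is_lim B p_infty 0).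
{ replace (Finite 0) with (Finite (g1 alpha / 2 * (0 * 0) + 0))
    by (f_equal; ring).
  apply is_lim_plus'; [|apply is_lim_exp_decay].
  apply (is_lim_scal_l (fun x => v1 x * v1 x) (g1 alpha / 2) p_infty (0 * 0)).
  apply (is_lim_mult v1 v1 p_infty 0 0); [| |exact I];
    eapply log_regular_slope_lim; eassumption. }
assert (Qle : Rbar_le (Q t) 0).
{ apply (is_lim_le_loc (fun _ => Q t) B p_infty);
    [exists t; intros; apply upper; lra|apply is_lim_const|exact limB]. }
simpl in Qle. unfold Q in Qle.
pose proof (log_regular_slope_pos F nl alpha v v1 t r) as p.
pose proof (exp_pos (g (v t) - 2 * t)).
assert ((g1 (v t) * v1 t - 4) * v1 t < 0) by nra.
nra.
Qed.

Context (U U1 : R -> R) (solU : log_solution F U U1).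
Context (c0 C0 delta T : R).
Context (sa : singular_asymptotics F g g1 U s1 c0 C0 delta T).

(** On [t1/2, t1] the difference w = v - U satisfies w'' <= - (c0 / t1) w. The Sturm number is c0 /
    t1 times (t1/2)^2, that is c0 t1 / 4, and it exceeds 16 as soon as c0 t1 > 64. *)
Lemma above_singular_touches (t1 : R) (v v1 : R -> R) :
  log_solution F v v1 -> 2 * T <= t1 -> 64 < c0 * t1 ->
  (forall t, t1 / 2 <= t <= t1 -> U t <= v t) ->
  exists m, v m = U m /\ v1 m = U1 m.
Proof.
intros sv hT hc above.
pose proof (sa_T _ _ _ _ _ _ _ _ _ sa) as Tp.
pose proof (sa_c0 _ _ _ _ _ _ _ _ _ sa) as c0p.
assert (d : forall x, is_derive (fun t => v t - U t) x (v1 x - U1 x)).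
{ intros x. apply is_derive_Rminus; [apply sv|apply solU]. }
destruct (sturm_zero (fun t => v t - U t) (fun t => v1 t - U1 t)
  (fun t => - (exp (-2 * t) * F (v t)) - - (exp (-2 * t) * F (U t)))
  (c0 / t1) (t1 / 2) t1) as [m [hm zm]].
- lra.
- replace (c0 / t1 * (t1 - t1 / 2) ^ 2) with (c0 * t1 / 4) by (field; lra). lra.
- intros; apply d.
- intros x _. apply is_derive_Rminus; [apply sv|apply solU].
- intros x hx. specialize (above x hx). lra.
- intros x hx. specialize (above x hx).
  assert (Tx : T <= x) by lra.
  pose proof (sa_s1 _ _ _ _ _ _ _ _ _ sa x Tx) as hs.
  pose proof (rg_F_secant _ _ _ _ _ _ rg _ _ hs above) as fs.
  pose proof (sa_lo _ _ _ _ _ _ _ _ _ sa x Tx) as lo.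
  assert (c0 / t1 <= c0 / x).
  { apply Rmult_le_compat_l; [lra|]. apply Rinv_le_contravar; lra. }
  assert (c0 / t1 * (v x - U x)
    <= exp (-2 * x) * (g1 (U x) * F (U x)) * (v x - U x))
    by (apply Rmult_le_compat_r; lra).
  assert (exp (-2 * x) * (g1 (U x) * F (U x) * (v x - U x))
    <= exp (-2 * x) * (F (v x) - F (U x)))
    by (apply Rmult_le_compat_l; [left; apply exp_pos|exact fs]).
  lra.
- exists m; split; [lra|].
  cut (v1 m - U1 m = 0); [lra|].
  apply (interior_minimum_critical (fun t => v t - U t) (fun t => v1 t - U1 t)
    (t1 / 2) t1); [exact hm|intros; apply d|].
  intros x hx. rewrite zm. specialize (above x hx). lra.
Qed.

(* Going down from [t1], a solution [v] below [U] either stays so close to [U]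
   on some interval of length [eta * t1] that Sturm comparison applies, or
   drops below it so much that its slope stays near its value at [t1], which
   is at most [4 / g1 (v t1)]; by [rg_long_descent] it would then be larger
   than [U] near [theta * t1]. *)
Lemma below_singular_touches (sigma kappa b0 : R) :
  2 < sigma -> 0 < kappa < 1 -> s1 <= b0 ->
  (forall b, b0 <= b ->
    s1 <= b - sigma * (g b / g1 b) /\ kappa * g b <= g (b - sigma * (g b / g1 b))) ->
  0 < delta < 1 -> delta * (sigma + 2) < sigma - 2 ->
  exists theta T', 0 < theta <= 1 / 2 /\ 0 < T' /\
    forall (t1 : R) (v v1 : R -> R),
      log_solution F v v1 -> T' <= t1 -> s1 <= v t1 -> 0 <= v1 t1 ->
      2 * (1 - delta) * t1 <= g (v t1) -> g1 (v t1) * v1 t1 <= 4 ->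
      (forall t, theta * t1 <= t <= t1 -> v t <= U t) ->
      exists m, v m = U m /\ v1 m = U1 m.
Proof.
intros hsig hkap hb0 desc hdel hds.
pose proof (sa_T _ _ _ _ _ _ _ _ _ sa) as Tp.
pose proof (sa_c0 _ _ _ _ _ _ _ _ _ sa) as c0p.
pose proof (sa_C0 _ _ _ _ _ _ _ _ _ sa) as C0p.
(* Chosen so that v(theta t1) < a, where [a] is the end of the long descent from v(t1). Otherwise
   g(U(theta t1)) would be at least g(a) >= 2 kappa (1 - delta) t1, while it is at most 3 theta t1,
   which is half of that. *)
set (theta := kappa * (1 - delta) / 3).
assert (thp : 0 < theta <= 1 / 2) by (unfold theta; split; nra).
set (R0 := 3 / (2 * (1 - delta) * kappa)).
assert (dk : 0 < 2 * (1 - delta) * kappa) by nra.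
assert (R0k : R0 * kappa = 3 / (2 * (1 - delta))) by (unfold R0; field; lra).
assert (R0p : 0 < R0) by (apply Rdiv_lt_0_compat; lra).
assert (R0k1 : 1 <= R0 * kappa).
{ rewrite R0k. apply Rmult_le_reg_r with (2 * (1 - delta)); [lra|].
  unfold Rdiv; rewrite Rmult_assoc, Rinv_l; lra. }
(* [R0] bounds the ratios g(U)/g(a) and g(b)/g(a) during the descent, so [Cr] bounds the ratios of
   the slopes of [g]. With P = g1(b), the force along U is at most N / (t1 P); [eta] is the fraction
   of t1 on which this force changes the slope by delta / P. [K] is the gap, in units of 1 / P,
   beyond which the force on v is so weak that it adds at most 2 delta / P over the whole
   descent. *)
set (Cr := R0 ^ 2).
assert (Crp : 0 < Cr) by (apply pow_lt; exact R0p).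
set (N := C0 * Cr / theta).
assert (Np : 0 < N) by (apply Rdiv_lt_0_compat; [nra|lra]).
set (eta := delta / N).
assert (etap : 0 < eta) by (apply Rdiv_lt_0_compat; lra).
set (K := Cr * (N / (2 * delta))).
assert (Kp : 0 < K).
{ apply Rmult_lt_0_compat; [exact Crp|]. apply Rdiv_lt_0_compat; lra. }
(* While the gap is at most K / P, passing from U down to v loses at most the factor e^(- Cr K) in
   [F] and the factor [Cr] in [g1]; hence c2 / t1 bounds the coefficient at v from below. *)
set (c2 := exp (- (Cr * K)) / Cr * c0).
assert (c2p : 0 < c2).
{ apply Rmult_lt_0_compat; [apply Rdiv_lt_0_compat; [apply exp_pos|lra]|lra]. }
set (T' := Rmax (T / theta) (Rmax (17 / (c2 * eta ^ 2)) ((g b0 + 1) / (2 * (1 - delta))))).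
exists theta, T'. split; [exact thp|]. split.
{ apply Rlt_le_trans with (T / theta); [apply Rdiv_lt_0_compat; lra|apply Rmax_l]. }
intros t1 v v1 sv ht1 hs1 hv1 hg hslope below.
assert (h1 : T <= theta * t1).
{ assert (T / theta <= t1) by (apply Rle_trans with (2 := ht1), Rmax_l).
  replace T with (theta * (T / theta)) by (field; lra).
  apply Rmult_le_compat_l; lra. }
assert (t1p : 0 < t1) by (destruct (Rlt_le_dec 0 t1); [assumption|nra]).
assert (h2 : 16 < c2 / t1 * (eta * t1) ^ 2).
{ assert (q : 17 / (c2 * eta ^ 2) <= t1).
  { apply Rle_trans with (2 := ht1).
    apply Rle_trans with (2 := Rmax_r _ _). apply Rmax_l. }
  replace (c2 / t1 * (eta * t1) ^ 2) with (c2 * eta ^ 2 * t1) by (field; lra).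
  assert (ce : 0 < c2 * eta ^ 2)
    by (apply Rmult_lt_0_compat; [exact c2p|apply pow_lt; exact etap]).
  apply Rlt_le_trans with 17; [lra|].
  replace 17 with (c2 * eta ^ 2 * (17 / (c2 * eta ^ 2))).
  - apply Rmult_le_compat_l; lra.
  - field. split; [apply Rgt_not_eq, etap|apply Rgt_not_eq, c2p]. }
assert (h3 : g b0 < g (v t1)).
{ assert (q : (g b0 + 1) / (2 * (1 - delta)) <= t1).
  { apply Rle_trans with (2 := ht1).
    apply Rle_trans with (2 := Rmax_r _ _). apply Rmax_r. }
  assert (2 * (1 - delta) * ((g b0 + 1) / (2 * (1 - delta))) <= 2 * (1 - delta) * t1)
    by (apply Rmult_le_compat_l; lra).
  replace (2 * (1 - delta) * ((g b0 + 1) / (2 * (1 - delta)))) with (g b0 + 1) in *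
    by (field; lra).
  lra. }
set (b := v t1) in *.
assert (hb : b0 <= b) by (left; apply (rg_g_lt_inv _ _ _ _ _ _ rg); assumption).
destruct (desc b hb) as [ha hga].
set (P := g1 b) in *. set (a := b - sigma * (g b / P)) in *.
assert (Pp : 0 < P) by (apply (rg_g1 _ _ _ _ _ _ rg); exact hs1).
assert (gbp : 1 <= g b) by (apply (rg_ge1 _ _ _ _ _ _ rg); exact hs1).
assert (gP : 0 < g b / P) by (apply Rdiv_lt_0_compat; lra).
assert (ab : a < b) by (unfold a; nra).
assert (v1pos : forall t, t <= t1 -> 0 <= v1 t).
{ intros t ht. apply Rle_trans with (1 := hv1).
  apply (log_solution_slope_le F v); assumption. }
assert (vmono : forall x y, x <= y -> y <= t1 -> v x <= v y).
{ intros x y xy yt. apply (nondecreasing_of_derive v v1); [exact xy| |].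
  - intros; apply sv.
  - intros; apply v1pos; lra. }
assert (low : v (theta * t1) < a).
{ apply Rnot_le_lt; intros n.
  assert (bU : v (theta * t1) <= U (theta * t1)) by (apply below; nra).
  pose proof (rg_g_le _ _ _ _ _ _ rg _ _ ha (Rle_trans _ _ _ n bU)) as m.
  pose proof (sa_g_hi _ _ _ _ _ _ _ _ _ sa _ h1) as hi.
  assert (kappa * (2 * (1 - delta) * t1) <= kappa * g b)
    by (apply Rmult_le_compat_l; lra).
  assert (3 * (theta * t1) = kappa * (1 - delta) * t1) by (unfold theta; field).
  assert (0 < kappa * (1 - delta) * t1)
    by (apply Rmult_lt_0_compat; [nra|lra]).
  lra. }
destruct (intermediate_value v (theta * t1) t1 a) as [tau [htau vtau]].
{ nra. }
{ intros; apply (log_solution_continuity F v v1); exact sv. }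
{ fold b. nra. }
assert (taut : tau < t1).
{ destruct (Req_dec tau t1) as [e|]; [|lra]. rewrite e in vtau. fold b in vtau. lra. }
set (w := fun t => U t - v t). set (w1 := fun t => U1 t - v1 t).
set (w2 := fun t => - (exp (-2 * t) * F (U t)) - - (exp (-2 * t) * F (v t))).
assert (dw : forall t, is_derive w t (w1 t)).
{ intros x. apply is_derive_Rminus; [apply solU|apply sv]. }
assert (dw1 : forall t, is_derive w1 t (w2 t)).
{ intros x. apply is_derive_Rminus; [apply solU|apply sv]. }
(* Along the descent all the slopes of [g] are comparable with [P]. *)
assert (range : forall t, tau <= t <= t1 ->
  T <= t /\ theta * t1 <= t /\ a <= v t /\ v t <= U t).
{ intros t ht. assert (theta * t1 <= t) by lra.
  repeat split; [lra|assumption| |apply below; lra].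
  rewrite <- vtau. apply vmono; lra. }
assert (P_le : P <= Cr * g1 a).
{ apply (rg_g1_ratio_le _ _ _ _ _ _ rg); [exact ha|lra|].
  apply Rle_trans with (R0 * (kappa * g b)).
  - rewrite <- Rmult_assoc. nra.
  - apply Rmult_le_compat_l; lra. }
assert (gU_le : forall t, tau <= t <= t1 -> g1 (U t) <= Cr * g1 a).
{ intros t ht. destruct (range t ht) as [Tt [_ [av vU]]].
  apply (rg_g1_ratio_le _ _ _ _ _ _ rg); [exact ha|lra|].
  pose proof (sa_g_hi _ _ _ _ _ _ _ _ _ sa _ Tt) as hi.
  apply Rle_trans with (R0 * (kappa * g b)); [|apply Rmult_le_compat_l; lra].
  rewrite <- Rmult_assoc, R0k.
  apply Rle_trans with (3 * t1); [lra|].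
  replace (3 * t1) with (3 / (2 * (1 - delta)) * (2 * (1 - delta) * t1))
    by (field; lra).
  apply Rmult_le_compat_l; [|lra]. left; apply Rdiv_lt_0_compat; lra. }
assert (ga_le : g1 a <= P) by (apply (rg_g1_le _ _ _ _ _ _ rg); [exact ha|lra]).
assert (gap : 0 < g1 a) by (apply (rg_g1 _ _ _ _ _ _ rg); exact ha).
assert (force : forall t, tau <= t <= t1 -> exp (-2 * t) * F (U t) <= N / (t1 * P)).
{ intros t ht. destruct (range t ht) as [Tt [tht [av vU]]].
  pose proof (sa_hi _ _ _ _ _ _ _ _ _ sa _ Tt) as hi.
  assert (gU : g1 a <= g1 (U t)) by (apply (rg_g1_le _ _ _ _ _ _ rg); lra).
  assert (PU : P <= Cr * g1 (U t)).
  { apply Rle_trans with (1 := P_le). apply Rmult_le_compat_l; lra. }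
  assert (ef : 0 < exp (-2 * t) * F (U t))
    by (apply Rmult_lt_0_compat; [apply exp_pos|apply nl_pos, nl]).
  assert (hi2 : exp (-2 * t) * F (U t) * P <= Cr * (C0 / t)).
  { apply Rle_trans with (exp (-2 * t) * F (U t) * (Cr * g1 (U t))).
    - apply Rmult_le_compat_l; lra.
    - replace (exp (-2 * t) * F (U t) * (Cr * g1 (U t)))
        with (Cr * (exp (-2 * t) * (g1 (U t) * F (U t)))) by ring.
      apply Rmult_le_compat_l; lra. }
  assert (C0 / t <= C0 / (theta * t1)).
  { apply Rmult_le_compat_l; [lra|]. apply Rinv_le_contravar; [nra|lra]. }
  apply Rmult_le_reg_r with P; [exact Pp|].
  replace (N / (t1 * P) * P) with (Cr * (C0 / (theta * t1)))
    by (unfold N; field; repeat split; lra).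
  apply Rle_trans with (1 := hi2). apply Rmult_le_compat_l; lra. }
assert (Fv_le : forall t, tau <= t <= t1 -> F (v t) <= F (U t)).
{ intros t ht. destruct (range t ht) as [_ [_ [av vU]]].
  apply (rg_F_le _ _ _ _ _ _ rg); lra. }
destruct (classic (exists p, tau <= p /\ p + eta * t1 <= t1 /\
  forall t, p <= t <= p + eta * t1 -> w t <= K / P)) as [[p [tp [pt small]]]|far].
{ destruct (sturm_zero w w1 w2 (c2 / t1) p (p + eta * t1)) as [m [hm zm]].
  - nra.
  - replace (p + eta * t1 - p) with (eta * t1) by ring. exact h2.
  - intros; apply dw.
  - intros; apply dw1.
  - intros t ht. destruct (range t) as [_ [_ [_ vU]]]; [lra|]. unfold w; lra.
  - intros t ht. assert (ht' : tau <= t <= t1) by lra.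
    destruct (range t ht') as [Tt [tht [av vU]]].
    pose proof (small t ht) as wt.
    assert (wp : 0 <= w t) by (unfold w; lra).
    assert (hv : s1 <= v t) by lra.
    pose proof (rg_F_secant _ _ _ _ _ _ rg _ _ hv vU) as fs.
    destruct (rg_secant _ _ _ _ _ _ rg _ _ hv vU) as [_ gs].
    fold (w t) in fs, gs.
    pose proof (sa_lo _ _ _ _ _ _ _ _ _ sa _ Tt) as lo.
    assert (gv : g1 a <= g1 (v t)) by (apply (rg_g1_le _ _ _ _ _ _ rg); lra).
    assert (gUp : 0 < g1 (U t)) by (apply (rg_g1 _ _ _ _ _ _ rg); lra).
    assert (gUC : g1 (U t) <= Cr * P).
    { apply Rle_trans with (1 := gU_le t ht'). apply Rmult_le_compat_l; lra. }
    assert (gUv : g1 (U t) <= Cr * g1 (v t)).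
    { apply Rle_trans with (1 := gU_le t ht'). apply Rmult_le_compat_l; lra. }
    assert (gap_le : g (U t) - g (v t) <= Cr * K).
    { apply Rle_trans with (1 := gs).
      apply Rle_trans with (Cr * P * (K / P)).
      - apply Rmult_le_compat; lra.
      - right; field; lra. }
    assert (Fr : exp (- (Cr * K)) * F (U t) <= F (v t)).
    { rewrite (rg_exp _ _ _ _ _ _ rg (U t)), (rg_exp _ _ _ _ _ _ rg (v t)) by lra.
      rewrite <- exp_plus.
      destruct (Rle_lt_or_eq_dec (- (Cr * K) + g (U t)) (g (v t))) as [l|e];
        [lra|left; apply exp_increasing; exact l|rewrite e; lra]. }
    assert (Fp : 0 < F (v t)) by apply nl_pos, nl.
    assert (FUp : 0 < F (U t)) by apply nl_pos, nl.
    assert (ep : 0 < exp (- (Cr * K))) by apply exp_pos.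
    assert (prod : exp (- (Cr * K)) / Cr * (g1 (U t) * F (U t)) <= g1 (v t) * F (v t)).
    { replace (exp (- (Cr * K)) / Cr * (g1 (U t) * F (U t)))
        with (g1 (U t) / Cr * (exp (- (Cr * K)) * F (U t))) by (field; lra).
      apply Rmult_le_compat; [|nra| |exact Fr].
      - left; apply Rdiv_lt_0_compat; lra.
      - apply Rmult_le_reg_l with Cr; [lra|].
        replace (Cr * (g1 (U t) / Cr)) with (g1 (U t)) by (field; lra). lra. }
    assert (coef : c2 / t1 <= exp (-2 * t) * (g1 (v t) * F (v t))).
    { apply Rle_trans with (exp (- (Cr * K)) / Cr *
        (exp (-2 * t) * (g1 (U t) * F (U t)))).
      - unfold c2. replace (exp (- (Cr * K)) / Cr * c0 / t1)
          with (exp (- (Cr * K)) / Cr * (c0 / t1)) by (field; lra).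
        apply Rmult_le_compat_l; [left; apply Rdiv_lt_0_compat; lra|].
        apply Rle_trans with (2 := lo).
        apply Rmult_le_compat_l; [lra|]. apply Rinv_le_contravar; nra.
      - replace (exp (- (Cr * K)) / Cr * (exp (-2 * t) * (g1 (U t) * F (U t))))
          with (exp (-2 * t) * (exp (- (Cr * K)) / Cr * (g1 (U t) * F (U t)))) by ring.
        apply Rmult_le_compat_l; [left; apply exp_pos|exact prod]. }
    assert (c2 / t1 * w t <= exp (-2 * t) * (g1 (v t) * F (v t)) * w t)
      by (apply Rmult_le_compat_r; lra).
    assert (exp (-2 * t) * (g1 (v t) * F (v t) * w t)
      <= exp (-2 * t) * (F (U t) - F (v t)))
      by (apply Rmult_le_compat_l; [left; apply exp_pos|exact fs]).
    unfold w2. lra.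
  - exists m; split; [unfold w in zm; lra|].
    cut (w1 m = 0); [unfold w1; lra|].
    apply (interior_minimum_critical w w1 p (p + eta * t1));
      [exact hm|intros; apply dw|].
    intros x hx. rewrite zm. destruct (range x) as [_ [_ [_ vU]]]; [lra|].
    unfold w; lra. }
exfalso.
assert (w1mono : forall x y, tau <= x -> x <= y -> y <= t1 -> w1 y <= w1 x).
{ intros x y tx xy yt. cut (- w1 x <= - w1 y); [lra|].
  apply (nondecreasing_of_derive (fun t => - w1 t) (fun t => - w2 t)); [exact xy| |];
    intros t ht.
  - apply is_derive_Ropp. apply dw1.
  - assert (F (v t) <= F (U t)) by (apply Fv_le; lra).
    unfold w2. pose proof (exp_pos (-2 * t)). nra. }
(* The gap w is concave because F(v) <= F(U). A small value at t would persist on the side towards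
   which w decreases, filling a window of length eta t1, which the alternative [far] excludes. *)
assert (wfar : forall t, tau + eta * t1 <= t <= t1 - eta * t1 -> K / P < w t).
{ intros t ht. apply Rnot_le_lt; intros wt. apply far.
  assert (et : 0 < eta * t1) by nra.
  destruct (Rle_lt_dec 0 (w1 t)) as [pos|neg].
  - exists (t - eta * t1). split; [lra|]. split; [lra|]. intros x hx.
    apply Rle_trans with (2 := wt).
    apply (nondecreasing_of_derive w w1); [lra|intros; apply dw|].
    intros y hy. apply Rle_trans with (1 := pos). apply w1mono; lra.
  - exists t. split; [lra|]. split; [lra|]. intros x hx.
    apply Rle_trans with (2 := wt).
    cut (- w t <= - w x); [lra|].
    apply (nondecreasing_of_derive (fun t => - w t) (fun t => - w1 t)); [lra| |].
    + intros; apply is_derive_Ropp; apply dw.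
    + intros y hy. assert (w1 y <= w1 t) by (apply w1mono; lra). lra. }
assert (kick : forall x y B, tau <= x -> x <= y -> y <= t1 ->
  (forall t, x <= t <= y -> exp (-2 * t) * F (v t) <= B) ->
  v1 x <= v1 y + B * (y - x)).
{ intros x y B tx xy yt hB.
  cut (v1 x + B * x <= v1 y + B * y); [lra|].
  apply (nondecreasing_of_derive (fun t => v1 t + B * t)
    (fun t => - (exp (-2 * t) * F (v t)) + B)); [exact xy| |]; intros t ht.
  - destruct (sv t) as [_ d]. auto_derive; [eexists; exact d|].
    derive_at d. ring.
  - specialize (hB t ht). lra. }
assert (force_v : forall t, tau <= t <= t1 -> exp (-2 * t) * F (v t) <= N / (t1 * P)).
{ intros t ht. apply Rle_trans with (2 := force t ht).
  apply Rmult_le_compat_l; [left; apply exp_pos|apply Fv_le; exact ht]. }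
assert (NtP : 0 < N / (t1 * P)) by (apply Rdiv_lt_0_compat; nra).
assert (v1t1 : v1 t1 <= 4 / P).
{ apply Rmult_le_reg_l with P; [exact Pp|].
  replace (P * (4 / P)) with 4 by (field; lra). exact hslope. }
assert (endp : N / (t1 * P) * (eta * t1) = delta / P)
  by (unfold eta; field; repeat split; lra).
(* Each of the two end windows of length eta t1 costs delta / P, and the stretch between them, where
   the gap is large, costs 2 delta / P. If the descent is shorter than two windows, 2 delta / P is
   enough. *)
assert (v1tau : v1 tau <= 4 * (1 + delta) / P).
{ destruct (Rle_lt_dec (t1 - tau) (2 * (eta * t1))) as [short|long].
  - assert (k : v1 tau <= v1 t1 + N / (t1 * P) * (t1 - tau)).
    { apply kick; [lra|lra|lra|]. intros; apply force_v; lra. }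
    assert (N / (t1 * P) * (t1 - tau) <= N / (t1 * P) * (2 * (eta * t1)))
      by (apply Rmult_le_compat_l; lra).
    assert (N / (t1 * P) * (2 * (eta * t1)) = 2 * delta / P) by lra.
    assert (0 < delta / P) by (apply Rdiv_lt_0_compat; lra).
    replace (4 * (1 + delta) / P) with (4 / P + 4 * (delta / P)) by (field; lra).
    lra.
  - assert (et : 0 < eta * t1) by nra.
    assert (k1 : v1 (t1 - eta * t1) <= v1 t1 + N / (t1 * P) * (t1 - (t1 - eta * t1))).
    { apply kick; [lra|lra|lra|]. intros; apply force_v; lra. }
    assert (k3 : v1 tau <= v1 (tau + eta * t1) + N / (t1 * P) * (tau + eta * t1 - tau)).
    { apply kick; [lra|lra|lra|]. intros; apply force_v; lra. }
    assert (k2 : v1 (tau + eta * t1) <= v1 (t1 - eta * t1)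
      + exp (- (K / Cr)) * (N / (t1 * P)) * (t1 - eta * t1 - (tau + eta * t1))).
    { apply kick; [lra|lra|lra|]. intros t ht.
      assert (ht' : tau <= t <= t1) by lra.
      destruct (range t ht') as [_ [_ [av vU]]].
      pose proof (wfar t ht) as wt. pose proof (force t ht') as fo.
      assert (hv : s1 <= v t) by lra.
      destruct (rg_secant _ _ _ _ _ _ rg _ _ hv vU) as [gs _].
      fold (w t) in gs.
      assert (gv : g1 a <= g1 (v t)) by (apply (rg_g1_le _ _ _ _ _ _ rg); lra).
      assert (KP : 0 < K / P) by (apply Rdiv_lt_0_compat; lra).
      assert (drop : K / Cr <= g (U t) - g (v t)).
      { apply Rle_trans with (2 := gs).
        apply Rle_trans with (P / Cr * (K / P)); [right; field; lra|].
        apply Rmult_le_compat; [left; apply Rdiv_lt_0_compat; lra|lra| |lra].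
        apply Rle_trans with (2 := gv).
        apply Rmult_le_reg_l with Cr; [lra|].
        replace (Cr * (P / Cr)) with P by (field; lra). lra. }
      assert (Fr : F (v t) <= exp (- (K / Cr)) * F (U t)).
      { rewrite (rg_exp _ _ _ _ _ _ rg (U t)), (rg_exp _ _ _ _ _ _ rg (v t)) by lra.
        rewrite <- exp_plus.
        destruct (Rle_lt_or_eq_dec (g (v t)) (- (K / Cr) + g (U t))) as [l|e];
          [lra|left; apply exp_increasing; exact l|rewrite e; lra]. }
      apply Rle_trans with (exp (-2 * t) * (exp (- (K / Cr)) * F (U t))).
      - apply Rmult_le_compat_l; [left; apply exp_pos|exact Fr].
      - replace (exp (-2 * t) * (exp (- (K / Cr)) * F (U t)))
          with (exp (- (K / Cr)) * (exp (-2 * t) * F (U t))) by ring.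
        apply Rmult_le_compat_l; [left; apply exp_pos|exact fo]. }
    assert (mid : exp (- (K / Cr)) * (N / (t1 * P)) * (t1 - eta * t1 - (tau + eta * t1))
      <= 2 * delta / P).
    { replace (K / Cr) with (N / (2 * delta)) by (unfold K; field; lra).
      set (X := N / (2 * delta)).
      assert (Xp : 0 < X) by (apply Rdiv_lt_0_compat; lra).
      assert (eX : exp (- X) <= / X).
      { rewrite exp_Ropp. apply Rinv_le_contravar; [exact Xp|].
        pose proof (exp_ineq1 X). lra. }
      apply Rle_trans with (/ X * (N / (t1 * P)) * t1).
      - apply Rmult_le_compat; [|lra| |].
        + left; apply Rmult_lt_0_compat; [apply exp_pos|exact NtP].
        + apply Rmult_le_compat_r; lra.
        + assert (0 < tau) by nra. lra.
      - right; unfold X; field; repeat split; lra. }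
    assert (0 < delta / P) by (apply Rdiv_lt_0_compat; lra).
    replace (t1 - (t1 - eta * t1)) with (eta * t1) in k1 by ring.
    replace (tau + eta * t1 - tau) with (eta * t1) in k3 by ring.
    rewrite endp in k1, k3.
    replace (2 * delta / P) with (2 * (delta / P)) in mid by (field; lra).
    replace (4 * (1 + delta) / P) with (4 / P + 4 * (delta / P)) by (field; lra).
    lra. }
assert (reach : b - 4 * (1 + delta) / P * (t1 - tau) <= v tau).
{ destruct (mean_value v v1 tau t1 taut) as [m [hm e]]; [intros; apply sv|].
  assert (v1 m <= v1 tau) by (apply (log_solution_slope_le F v); [exact nl|exact sv|lra]).
  assert (v1 m * (t1 - tau) <= 4 * (1 + delta) / P * (t1 - tau))
    by (apply Rmult_le_compat_r; lra).
  fold b in e. lra. }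
rewrite vtau in reach. unfold a in reach.
(* Since g(b) >= 2 (1 - delta) t1, this reduces to 2 (1 + delta) <= sigma (1 - delta), which follows
   from the condition relating [delta] and [sigma]. Thus v cannot have come down to [a] by the time
   tau. *)
assert (final : 4 * (1 + delta) / P * (t1 - tau) < sigma * (g b / P)).
{ apply Rlt_le_trans with (4 * (1 + delta) / P * t1).
  - apply Rmult_lt_compat_l; [apply Rdiv_lt_0_compat; lra|].
    assert (0 < tau) by nra. lra.
  - replace (4 * (1 + delta) / P * t1) with (4 * (1 + delta) * t1 * / P) by (field; lra).
    replace (sigma * (g b / P)) with (sigma * g b * / P) by (field; lra).
    apply Rmult_le_compat_r; [left; apply Rinv_0_lt_compat; exact Pp|].
    apply Rle_trans with (sigma * (2 * (1 - delta) * t1));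
      [|apply Rmult_le_compat_l; lra].
    replace (sigma * (2 * (1 - delta) * t1)) with (2 * (sigma * (1 - delta)) * t1) by ring.
    apply Rmult_le_compat_r; [lra|]. lra. }
lra.
Qed.

End Intersections.

Lemma is_lim_p_infty_ge (f : R -> R) (M : R) :
  is_lim f p_infty p_infty -> exists X, forall x, X <= x -> M < f x.
Proof.
intros l. apply is_lim_spec in l. destruct (l M) as [X hX].
exists (X + 1). intros x hx. apply hX. lra.
Qed.

(** * Chains of intersections for large alpha *)

Section ManyIntersections.

Context (F g g1 g2 : R -> R) (h s1 : R).
Context (nl : nonlinearity F) (rg : rapid_growth F g g1 g2 h s1).
Context (U U1 : R -> R) (solU : log_solution F U U1).
Context (limU : is_lim U p_infty p_infty).

(** Equal Cauchy data would make v and U coincide from [m] on, but v <= alpha while U tends to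
    infinity. *)
Lemma regular_singular_transversal (alpha : R) (v v1 : R -> R) (m : R) :
  log_regular F alpha v v1 -> v m = U m -> v1 m <> U1 m.
Proof.
intros r e e1.
destruct (is_lim_p_infty_ge U alpha limU) as [X hX].
pose proof (Rmax_l X m) as l1. pose proof (Rmax_r X m) as l2.
assert (eq : v (Rmax X m) = U (Rmax X m))
  by (apply (log_solution_unique F v v1 U U1 m); auto; apply r).
pose proof (hX _ l1). pose proof (log_regular_le F nl alpha v v1 (Rmax X m) r). lra.
Qed.

Lemma difference_constant_sign (v v1 : R -> R) (a b x y : R) :
  log_solution F v v1 -> (forall t, a <= t < b -> v t <> U t) ->
  a <= x < b -> a <= y < b -> v x < U x -> v y < U y.
Proof.
intros sv ne hx hy lx. apply Rnot_le_lt; intros ly.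
assert (cont : forall t, continuity_pt (fun t => v t - U t) t).
{ intros t. apply continuity_pt_minus;
    [apply (log_solution_continuity F v v1 t sv)|
     apply (log_solution_continuity F U U1 t solU)]. }
destruct (Rle_dec x y) as [xy|yx].
- destruct (intermediate_zero (fun t => v t - U t) x y) as [z [hz e]];
    [lra|auto|nra|]. apply (ne z); lra.
- destruct (intermediate_zero (fun t => v t - U t) y x) as [z [hz e]];
    [lra|auto|nra|]. apply (ne z); lra.
Qed.

Lemma ln_le_linear (eps x : R) : 0 < eps -> 0 < x -> ln x <= eps * x - 1 - ln eps.
Proof.
intros he hx.
assert (p : 0 < eps * x) by (apply Rmult_lt_0_compat; assumption).
assert (e : ln (eps * x) <= eps * x - 1).
{ rewrite <- (ln_exp (eps * x - 1)). apply ln_le; [exact p|].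
  destruct (Req_dec (eps * x - 1) 0) as [z|n].
  - rewrite z, exp_0. lra.
  - pose proof (exp_ineq1 _ n). lra. }
rewrite ln_mult in e by assumption. lra.
Qed.

(* At the time [t1] with [2 t1 = g alpha + ln (g1 alpha)] the solution has
   dropped from [alpha] by at most [1 / (4 g1 alpha)]. *)
Lemma regular_solution_start (delta T : R) :
  0 < delta < 1 ->
  exists A, s1 <= A /\ forall alpha v v1, A <= alpha -> log_regular F alpha v v1 ->
    exists t1, T <= t1 /\ s1 <= v t1 /\ 2 * (1 - delta) * t1 <= g (v t1).
Proof.
intros hd.
pose proof (rg_g1 _ _ _ _ _ _ rg s1 (Rle_refl _)) as p1.
pose proof (rg_ge1 _ _ _ _ _ _ rg s1 (Rle_refl _)) as gs1.
set (C := g1 s1 / g s1 ^ 2).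
assert (gs2 : 0 < g s1 ^ 2) by (apply pow_lt; lra).
assert (Cp : 0 < C) by (apply Rdiv_lt_0_compat; assumption).
set (B := Rabs (ln C + 2 * (-1 - ln (delta / 4)))).
destruct (nonlinearity_bounded F s1 nl) as [Fs [Fsp hFs]].
(* The first bound makes F(alpha) the maximum of [F] on (-oo, alpha], the second makes ln (g1 alpha)
   small compared with g(alpha), and the third yields t1 >= T. *)
destruct (rg_unbounded _ _ _ _ _ _ rg
  (Rmax (Fs + 1) (Rmax (2 * (B + 1) / delta) (2 * T - ln (g1 s1))))) as [A0 [hA0 gA0]].
exists (Rmax A0 (s1 + / g1 s1)). split.
{ apply Rle_trans with (1 := hA0), Rmax_l. }
intros alpha v v1 hal r.
assert (al0 : A0 <= alpha) by (apply Rle_trans with (2 := hal), Rmax_l).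
assert (al1 : s1 + / g1 s1 <= alpha) by (apply Rle_trans with (2 := hal), Rmax_r).
assert (als : s1 <= alpha) by lra.
specialize (gA0 alpha al0).
assert (k1 : Fs + 1 <= g alpha) by (apply Rle_trans with (2 := gA0), Rmax_l).
assert (k2 : 2 * (B + 1) / delta <= g alpha).
{ apply Rle_trans with (2 := gA0). apply Rle_trans with (2 := Rmax_r _ _).
  apply Rmax_l. }
assert (k3 : 2 * T - ln (g1 s1) <= g alpha).
{ apply Rle_trans with (2 := gA0). apply Rle_trans with (2 := Rmax_r _ _).
  apply Rmax_r. }
assert (G1p : g1 s1 <= g1 alpha) by (apply (rg_g1_le _ _ _ _ _ _ rg); lra).
assert (lnG : ln (g1 s1) <= ln (g1 alpha)) by (apply ln_le; lra).
exists ((g alpha + ln (g1 alpha)) / 2). split; [lra|].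
set (t1 := (g alpha + ln (g1 alpha)) / 2).
assert (Fal : F alpha = exp (g alpha)) by (apply (rg_exp _ _ _ _ _ _ rg); exact als).
assert (maxF : forall x, x <= alpha -> F x <= F alpha).
{ intros x hx. destruct (Rle_lt_dec x s1) as [l|l].
  - apply Rle_trans with (1 := hFs x l). rewrite Fal.
    pose proof (exp_ineq1 (g alpha)). lra.
  - apply (rg_F_le _ _ _ _ _ _ rg); lra. }
assert (val : alpha - F alpha / 4 * exp (-2 * t1) <= v t1).
{ apply (log_regular_value_bound F nl alpha (F alpha) v v1 t1 r).
  intros s _. apply maxF. apply (log_regular_le F nl alpha v v1); exact r. }
assert (kap : F alpha / 4 * exp (-2 * t1) = / (4 * g1 alpha)).
{ rewrite Fal. replace (-2 * t1) with (- g alpha + - ln (g1 alpha))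
    by (unfold t1; field).
  rewrite exp_plus, !exp_Ropp, exp_ln by lra.
  field. split; [lra|apply Rgt_not_eq, exp_pos]. }
rewrite kap in val.
assert (small : / (4 * g1 alpha) <= / g1 s1) by (apply Rinv_le_contravar; lra).
assert (hv : s1 <= v t1) by lra.
split; [exact hv|].
assert (va : v t1 <= alpha) by (apply (log_regular_le F nl alpha v v1); exact r).
destruct (rg_secant _ _ _ _ _ _ rg _ _ hv va) as [_ sec].
assert (sec2 : g1 alpha * (alpha - v t1) <= / 4).
{ apply Rle_trans with (g1 alpha * / (4 * g1 alpha)).
  - apply Rmult_le_compat_l; lra.
  - right; field; lra. }
assert (gal : 1 <= g alpha) by (apply (rg_ge1 _ _ _ _ _ _ rg); exact als).
(* [g1] grows at most like g^2, so its logarithm is an arbitrarily small fraction of [g], and 2 t1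
   exceeds g(alpha) by at most such a fraction. *)
assert (lnb : ln (g1 alpha) <= B + delta / 2 * g alpha).
{ pose proof (rg_g1_ratio _ _ _ _ _ _ rg s1 alpha (Rle_refl _) als) as rat.
  assert (b1 : g1 alpha <= C * (g alpha * g alpha)).
  { apply Rmult_le_reg_r with (g s1 ^ 2); [exact gs2|].
    apply Rle_trans with (1 := rat). right; unfold C; field; lra. }
  assert (gg : 0 < g alpha * g alpha) by nra.
  assert (b2 : ln (g1 alpha) <= ln (C * (g alpha * g alpha)))
    by (apply ln_le; lra).
  rewrite ln_mult, ln_mult in b2 by lra.
  assert (b3 : ln (g alpha) <= delta / 4 * g alpha - 1 - ln (delta / 4))
    by (apply ln_le_linear; lra).
  pose proof (Rle_abs (ln C + 2 * (-1 - ln (delta / 4)))) as ab. fold B in ab. lra. }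
assert (Bp : 0 <= B) by apply Rabs_pos.
assert (k2' : B + 1 <= delta / 2 * g alpha).
{ apply Rle_trans with (delta / 2 * (2 * (B + 1) / delta)); [right; field; lra|].
  apply Rmult_le_compat_l; lra. }
replace (2 * (1 - delta) * t1) with ((1 - delta) * (g alpha + ln (g1 alpha)))
  by (unfold t1; field).
assert ((1 - delta) * (g alpha + ln (g1 alpha))
  <= (1 - delta) * (g alpha + (B + delta / 2 * g alpha)))
  by (apply Rmult_le_compat_l; lra).
assert (0 <= delta * (B + delta / 2 * g alpha)) by nra.
lra.
Qed.

Context (c0 C0 : R).
Context (sas : forall delta, 0 < delta < 1 ->
  exists T, singular_asymptotics F g g1 U s1 c0 C0 delta T).

(** Without an intersection on [theta z, z) the difference has one sign there, and the touching
    lemma for that sign produces a double zero, which transversality excludes. The first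
    intersection arises in the same way, starting from the region near t = +oo where v < U. *)
Lemma next_intersection :
  exists theta T, 0 < theta < 1 /\ 0 < T /\
    (forall alpha v v1 z, log_regular F alpha v v1 -> T <= z -> v z = U z ->
      exists z', theta * z <= z' < z /\ v z' = U z') /\
    (forall T0, exists A, forall alpha v v1, A <= alpha -> log_regular F alpha v v1 ->
      exists z, T0 <= z /\ v z = U z).
Proof.
destruct (rg_long_descent _ _ _ _ _ _ rg) as [sigma [kappa [b0 [hs [hk [hb desc]]]]]].
(* Half of the largest value that the race between slope and descent tolerates. *)
set (delta := (sigma - 2) / (2 * (sigma + 2))).
assert (dp : delta * (sigma + 2) = (sigma - 2) / 2) by (unfold delta; field; lra).
assert (hd : 0 < delta < 1).
{ split; [apply Rdiv_lt_0_compat; lra|nra]. }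
destruct (sas delta hd) as [T sa].
destruct (below_singular_touches F g g1 g2 h s1 nl rg U U1 solU c0 C0 delta T sa
  sigma kappa b0 hs hk hb desc hd) as [theta [T' [hth [T'p low]]]]; [lra|].
pose proof (sa_T _ _ _ _ _ _ _ _ _ sa) as Tp.
pose proof (sa_c0 _ _ _ _ _ _ _ _ _ sa) as c0p.
set (Tm := Rmax T' (Rmax (2 * T) (65 / c0))).
assert (m1 : T' <= Tm) by apply Rmax_l.
assert (m2 : 2 * T <= Tm).
{ unfold Tm. apply Rle_trans with (2 := Rmax_r _ _). apply Rmax_l. }
assert (m3 : 65 / c0 <= Tm).
{ unfold Tm. apply Rle_trans with (2 := Rmax_r _ _). apply Rmax_r. }
exists theta, Tm. split; [lra|]. split; [lra|]. split.
- intros alpha v v1 z r hz vz. apply NNPP; intros no.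
  assert (ne : forall t, theta * z <= t < z -> v t <> U t).
  { intros t ht e. apply no; exists t; auto. }
  assert (zz : theta * z < z) by nra.
  pose proof (proj1 r) as sv.
  destruct (Rtotal_order (v (theta * z)) (U (theta * z))) as [lt|[eq|gt]].
  + destruct (low z v v1 sv) as [m [e e1]].
    * lra.
    * rewrite vz. apply (sa_s1 _ _ _ _ _ _ _ _ _ sa); lra.
    * left; apply (log_regular_slope_pos F nl alpha v); exact r.
    * rewrite vz. apply (sa_g_lo _ _ _ _ _ _ _ _ _ sa); lra.
    * apply (log_regular_slope_le_4 F g g1 g2 h s1 nl rg alpha); [exact r|].
      rewrite vz. apply (sa_s1 _ _ _ _ _ _ _ _ _ sa); lra.
    * intros t ht. destruct (Req_dec t z) as [->|n]; [lra|].
      left. apply (difference_constant_sign v v1 (theta * z) z (theta * z) t);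
        auto; lra.
    * apply (regular_singular_transversal alpha v v1 m r e e1).
  + apply (ne (theta * z)); [lra|exact eq].
  + destruct (above_singular_touches F g g1 g2 h s1 rg U U1 solU c0 C0 delta T sa
      z v v1 sv) as [m [e e1]].
    * lra.
    * apply Rlt_le_trans with (c0 * (65 / c0)).
      -- replace (c0 * (65 / c0)) with 65 by (field; lra). lra.
      -- apply Rmult_le_compat_l; lra.
    * intros t ht. apply Rnot_lt_le; intros lt.
      assert (n : t <> z) by (intros ->; lra).
      assert (v (theta * z) < U (theta * z)); [|lra].
      apply (difference_constant_sign v v1 (theta * z) z t (theta * z)); auto; nra.
    * apply (regular_singular_transversal alpha v v1 m r e e1).
- intros T0.
  destruct (regular_solution_start delta (Rmax Tm (T0 / theta)) hd) as [A [As start]].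
  exists A. intros alpha v v1 hA r.
  destruct (start alpha v v1 hA r) as [t1 [ht1 [hv hg]]].
  assert (l1 : Tm <= t1) by (apply Rle_trans with (2 := ht1), Rmax_l).
  assert (l2 : T0 / theta <= t1) by (apply Rle_trans with (2 := ht1), Rmax_r).
  assert (l3 : T0 <= theta * t1).
  { replace T0 with (theta * (T0 / theta)) by (field; lra).
    apply Rmult_le_compat_l; lra. }
  apply NNPP; intros no.
  destruct (is_lim_p_infty_ge U alpha limU) as [X hX].
  set (b := Rmax X t1 + 1).
  assert (bX : X <= b - 1) by (unfold b; pose proof (Rmax_l X t1); lra).
  assert (bt : t1 <= b - 1) by (unfold b; pose proof (Rmax_r X t1); lra).
  assert (ne : forall t, theta * t1 <= t < b -> v t <> U t).
  { intros t ht e. apply no; exists t; split; [lra|exact e]. }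
  pose proof (proj1 r) as sv.
  assert (tt : theta * t1 < t1) by nra.
  destruct (low t1 v v1 sv) as [m [e e1]]; try assumption.
  + lra.
  + left; apply (log_regular_slope_pos F nl alpha v); exact r.
  + apply (log_regular_slope_le_4 F g g1 g2 h s1 nl rg alpha); assumption.
  + intros t ht. left.
    apply (difference_constant_sign v v1 (theta * t1) b (b - 1) t); auto; try lra.
    pose proof (hX _ bX).
    pose proof (log_regular_le F nl alpha v v1 (b - 1) r). lra.
  + apply (regular_singular_transversal alpha v v1 m r e e1).
Qed.

(** One step divides the time by at most 1 / theta, so a first intersection beyond M / theta^N
    leaves room for N further steps above M. *)
Lemma many_intersections (N : nat) (T0 : R) :
  exists A, forall alpha v v1, A <= alpha -> log_regular F alpha v v1 ->
    exists Z : nat -> R,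
      (forall i, (i <= N)%nat -> T0 <= Z i /\ v (Z i) = U (Z i)) /\
      (forall i, (i < N)%nat -> Z (S i) < Z i).
Proof.
destruct next_intersection as [theta [T [hth [Tp [next first]]]]].
set (M := Rmax T T0).
assert (MT : T <= M) by apply Rmax_l. assert (MT0 : T0 <= M) by apply Rmax_r.
assert (chain : forall n z alpha v v1, log_regular F alpha v v1 -> v z = U z ->
  M <= theta ^ n * z -> exists Z : nat -> R, Z 0%nat = z /\
      (forall i, (i <= n)%nat -> T0 <= Z i /\ v (Z i) = U (Z i)) /\
      (forall i, (i < n)%nat -> Z (S i) < Z i)).
{ induction n as [|n IH]; intros z alpha v v1 r vz hz.
  - exists (fun _ => z). split; [reflexivity|]. split; [|intros; lia].
    intros i _. simpl in hz. split; [lra|exact vz].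
  - assert (pw : theta ^ S n <= 1).
    { rewrite <- (pow1 (S n)). apply pow_incr; lra. }
    assert (pw0 : 0 < theta ^ S n) by (apply pow_lt; lra).
    assert (zp : 0 < z) by (destruct (Rlt_le_dec 0 z); [assumption|nra]).
    assert (zM : M <= z) by nra.
    destruct (next alpha v v1 z r) as [z' [hz' vz']]; [lra|exact vz|].
    destruct (IH z' alpha v v1 r vz') as [Z [Z0 [hZ dZ]]].
    { apply Rle_trans with (1 := hz). simpl.
      replace (theta * theta ^ n * z) with (theta ^ n * (theta * z)) by ring.
      apply Rmult_le_compat_l; [left; apply pow_lt; lra|lra]. }
    exists (fun i => match i with O => z | S j => Z j end).
    split; [reflexivity|]. split.
    + intros [|i] hi; [split; [lra|exact vz]|apply hZ; lia].
    + intros [|i] hi; [rewrite Z0; lra|apply dZ; lia]. }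
destruct (first (M / theta ^ N)) as [A hA].
exists A. intros alpha v v1 al r.
destruct (hA alpha v v1 al r) as [z [hz vz]].
destruct (chain N z alpha v v1 r vz) as [Z [_ hZ]]; [|exists Z; exact hZ].
assert (pw : 0 < theta ^ N) by (apply pow_lt; lra).
replace M with (theta ^ N * (M / theta ^ N)) by (field; lra).
apply Rmult_le_compat_l; lra.
Qed.

End ManyIntersections.

(** * Winding of the phase curve of the difference *)

Lemma derive_pos_right (th : R -> R) (x l : R) :
  is_derive th x l -> 0 < l ->
  exists d, 0 < d /\ (forall s, x < s < x + d -> th x < th s) /\
    (forall s, x - d < s < x -> th s < th x).
Proof.
intros e lp. apply is_derive_Reals in e.
destruct (e l lp) as [[d dp] hd]. simpl in hd.
assert (key : forall k, k <> 0 -> Rabs k < d -> 0 < (th (x + k) - th x) / k).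
{ intros k k0 kd. specialize (hd k k0 kd). apply Rabs_def2 in hd. lra. }
exists d. split; [exact dp|]. split; intros s hs.
- assert (q : 0 < (th (x + (s - x)) - th x) / (s - x))
    by (apply key; [lra|rewrite Rabs_pos_eq; lra]).
  replace (x + (s - x)) with s in q by ring.
  assert (0 < (th s - th x) / (s - x) * (s - x))
    by (apply Rmult_lt_0_compat; lra).
  replace ((th s - th x) / (s - x) * (s - x)) with (th s - th x) in * by (field; lra).
  lra.
- assert (q : 0 < (th (x + (s - x)) - th x) / (s - x))
    by (apply key; [lra|rewrite Rabs_left; lra]).
  replace (x + (s - x)) with s in q by ring.
  assert (0 < (th s - th x) / (s - x) * (x - s))
    by (apply Rmult_lt_0_compat; lra).
  replace ((th s - th x) / (s - x) * (x - s)) with (- (th s - th x)) in * by (field; lra).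
  lra.
Qed.

(** A level that is crossed only with positive speed cannot be crossed downwards: the last time at
    which [th >= c] contradicts each of [th m < c], [th m = c] and [th m > c]. *)
Lemma upward_barrier (th dth : R -> R) (c a b : R) :
  (forall t, is_derive th t (dth t)) -> (forall t, th t = c -> 0 < dth t) ->
  a < b -> c <= th a -> c < th b.
Proof.
intros d up ab ca. apply Rnot_le_lt; intros bc.
(* If [th b = c], the positive speed at [b] puts [th] strictly below [c] just before, so a strict
   inequality may be assumed at the right end. *)
assert (exists b', a < b' /\ th b' < c) as [b' [ab' lt]].
{ destruct (Rle_lt_or_eq_dec _ _ bc) as [l|e]; [exists b; auto|].
  destruct (derive_pos_right th b (dth b) (d b) (up b e)) as [r [rp [_ hl]]].
  pose proof (Rmax_l a (b - r)) as q1. pose proof (Rmax_r a (b - r)) as q2.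
  assert (q3 : Rmax a (b - r) < b) by (apply Rmax_lub_lt; lra).
  exists ((Rmax a (b - r) + b) / 2). split; [lra|].
  rewrite <- e. apply hl. lra. }
destruct (completeness (fun t => a <= t <= b' /\ c <= th t)) as [m [ub lub]].
{ exists b'. intros t ht; lra. }
{ exists a. split; [lra|exact ca]. }
assert (am : a <= m) by (apply ub; split; [lra|exact ca]).
assert (mb : m <= b') by (apply lub; intros t ht; lra).
assert (cm : continuity_pt th m) by (eapply continuity_pt_of_derive, d).
assert (near : forall e, 0 < e -> exists r, 0 < r /\
  forall s, Rabs (s - m) < r -> Rabs (th s - th m) < e).
{ intros e he. destruct (cm e he) as [r [rp hr]]. exists r. split; [exact rp|].
  intros s hs. destruct (Req_dec s m) as [->|ne].
  - rewrite Rminus_diag, Rabs_R0. exact he.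
  - apply hr. split; [split; [exact I|auto]|exact hs]. }
destruct (Rtotal_order (th m) c) as [l|[e|g]].
- destruct (near (c - th m)) as [r [rp hr]]; [lra|].
  assert (m <= m - r / 2); [|lra].
  apply lub. intros t [ht hc]. apply Rnot_lt_le; intros q.
  assert (t <= m) by (apply ub; auto).
  assert (z : Rabs (th t - th m) < c - th m)
    by (apply hr; rewrite Rabs_left1; lra).
  apply Rabs_def2 in z. lra.
- destruct (derive_pos_right th m (dth m) (d m) (up m e)) as [r [rp [hg _]]].
  assert (mb2 : m < b').
  { destruct (Req_dec m b') as [->|]; lra. }
  pose proof (Rmin_l (m + r) b') as q1. pose proof (Rmin_r (m + r) b') as q2.
  assert (q3 : m < Rmin (m + r) b') by (apply Rmin_glb_lt; lra).
  set (s := (m + Rmin (m + r) b') / 2).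
  assert (s <= m); [|unfold s in *; lra].
  apply ub. split; [unfold s; lra|].
  assert (th m < th s) by (apply hg; unfold s; lra). lra.
- destruct (near (th m - c)) as [r [rp hr]]; [lra|].
  assert (mb2 : m < b').
  { destruct (Req_dec m b') as [->|]; lra. }
  pose proof (Rmin_l (m + r) b') as q1. pose proof (Rmin_r (m + r) b') as q2.
  assert (q3 : m < Rmin (m + r) b') by (apply Rmin_glb_lt; lra).
  set (s := (m + Rmin (m + r) b') / 2).
  assert (s <= m); [|unfold s in *; lra].
  apply ub. split; [unfold s; lra|].
  assert (z : Rabs (th s - th m) < th m - c)
    by (apply hr; unfold s; rewrite Rabs_pos_eq; lra).
  apply Rabs_def2 in z. lra.
Qed.

(** The derivative of the argument of D1 + i D. At a zero of D it equals 1, and this turns multiples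
    of PI into one-way barriers. *)
Definition angular_speed (D D1 D2 : R -> R) (t : R) : R :=
  (D1 t ^ 2 - D t * D2 t) / (D t ^ 2 + D1 t ^ 2).

(* Total polar angle [th], measured from [D = 0, D1 > 0]: [D = r sin th] and
   [D1 = r cos th]. The start value assumes [D T < 0]. *)
Definition polar_angle (D D1 D2 : R -> R) (T t : R) : R :=
  - acos (D1 T / sqrt (D T ^ 2 + D1 T ^ 2)) + RInt (angular_speed D D1 D2) T t.

Section Polar.

Context (D D1 D2 : R -> R).
Context (dD : forall t : R, is_derive D t (D1 t)) (dD1 : forall t : R, is_derive D1 t (D2 t)).
Context (cD2 : forall t : R, continuous D2 t).
Context (pos : forall t, 0 < D t ^ 2 + D1 t ^ 2).

Let rad (t : R) : R := sqrt (D t ^ 2 + D1 t ^ 2).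

Lemma polar_radius_pos (t : R) : 0 < sqrt (D t ^ 2 + D1 t ^ 2).
Proof. apply sqrt_lt_R0, pos. Qed.

Lemma polar_radius_sq (t : R) :
  sqrt (D t ^ 2 + D1 t ^ 2) * sqrt (D t ^ 2 + D1 t ^ 2) = D t ^ 2 + D1 t ^ 2.
Proof. apply sqrt_sqrt. left; apply pos. Qed.

Lemma angular_speed_continuous (t : R) : continuous (angular_speed D D1 D2) t.
Proof.
assert (cD : continuity_pt D t) by (eapply continuity_pt_of_derive, dD).
assert (cD1 : continuity_pt D1 t) by (eapply continuity_pt_of_derive, dD1).
assert (c2 : continuity_pt D2 t) by (apply continuity_pt_filterlim, cD2).
apply continuity_pt_filterlim.
change (continuity_pt (fun s => (D1 s ^ 2 - D s * D2 s) / (D s ^ 2 + D1 s ^ 2)) t).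
assert (sq : forall u, continuity_pt u t -> continuity_pt (fun s => u s ^ 2) t).
{ intros u cu. apply (continuity_pt_ext (fun s => u s * u s));
    [intros; ring|apply continuity_pt_mult; exact cu]. }
apply continuity_pt_div.
- apply continuity_pt_minus; [apply sq, cD1|apply continuity_pt_mult; assumption].
- apply continuity_pt_plus; apply sq; assumption.
- pose proof (pos t). lra.
Qed.

Lemma polar_angle_derive (T t : R) :
  is_derive (polar_angle D D1 D2 T) t (angular_speed D D1 D2 t).
Proof.
replace (angular_speed D D1 D2 t) with (0 + angular_speed D D1 D2 t) by ring.
apply (is_derive_plus (fun _ => - acos (D1 T / sqrt (D T ^ 2 + D1 T ^ 2)))
  (fun s => RInt (angular_speed D D1 D2) T s)).
- exact (is_derive_const (K := R_AbsRing) (V := R_NormedModule) _ t).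
- apply (is_derive_RInt _ _ T).
  + apply filter_forall. intros s. apply (RInt_correct (V := R_CompleteNormedModule)).
    apply (ex_RInt_continuous (V := R_CompleteNormedModule)).
    intros; apply angular_speed_continuous.
  + apply angular_speed_continuous.
Qed.

Lemma polar_angle_start (T : R) :
  D T < 0 ->
  - PI < polar_angle D D1 D2 T T < 0 /\
  D T = rad T * sin (polar_angle D D1 D2 T T) /\
  D1 T = rad T * cos (polar_angle D D1 D2 T T).
Proof.
intros neg. unfold polar_angle. rewrite RInt_point.
change (zero : R) with 0. rewrite Rplus_0_r. fold (rad T).
assert (rp : 0 < rad T) by apply polar_radius_pos.
assert (rs : rad T * rad T = D T ^ 2 + D1 T ^ 2) by apply polar_radius_sq.
assert (D2p : 0 < D T ^ 2) by nra.
set (x := D1 T / rad T).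
assert (xr : x * rad T = D1 T) by (unfold x; field; lra).
assert (x2 : x * x < 1).
{ apply Rmult_lt_reg_r with (rad T * rad T); [nra|].
  replace (x * x * (rad T * rad T)) with ((x * rad T) * (x * rad T)) by ring.
  rewrite xr. nra. }
assert (hx : -1 < x < 1) by nra.
pose proof (acos_bound_lt x hx) as ab.
split; [lra|].
rewrite sin_neg, cos_neg, sin_acos, cos_acos by lra.
split; [|lra].
assert (s : sqrt (1 - Rsqr x) = - D T / rad T).
{ apply sqrt_lem_1.
  - unfold Rsqr; lra.
  - left; apply Rdiv_lt_0_compat; lra.
  - unfold Rsqr. apply Rmult_eq_reg_r with (rad T * rad T); [|nra].
    replace ((1 - x * x) * (rad T * rad T))
      with (rad T * rad T - (x * rad T) * (x * rad T)) by ring.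
    replace (- D T / rad T * (- D T / rad T) * (rad T * rad T)) with (D T * D T)
      by (field; lra).
    rewrite xr, rs. ring. }
rewrite s. field. lra.
Qed.

(** The unit vectors (D, D1) / rad and (sin th, cos th) rotate with the same speed. Their inner
    product [S] is therefore constant and equal to 1, which forces equality of the vectors. *)
Lemma polar_angle_spec (T t : R) :
  D T < 0 ->
  D t = rad t * sin (polar_angle D D1 D2 T t) /\
  D1 t = rad t * cos (polar_angle D D1 D2 T t).
Proof.
intros neg. destruct (polar_angle_start T neg) as [_ [sT cT]].
set (th := polar_angle D D1 D2 T) in *.
set (S := fun t => (D t * sin (th t) + D1 t * cos (th t)) / rad t).
assert (dS : forall t, is_derive S t 0).
{ intros s. pose proof (dD s) as e. pose proof (dD1 s) as e1.
  pose proof (polar_angle_derive T s) as et. fold th in et.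
  pose proof (pos s) as ps. pose proof (polar_radius_pos s) as rp.
  pose proof (polar_radius_sq s) as rs.
  unfold S, rad. auto_derive.
  - repeat split; try (eexists; eassumption); simpl in *; try lra.
  - derive_at e. derive_at e1. derive_at et. unfold angular_speed.
    replace (D s * (D s * 1) + D1 s * (D1 s * 1)) with (D s ^ 2 + D1 s ^ 2) by ring.
    set (r := sqrt (D s ^ 2 + D1 s ^ 2)) in *.
    rewrite <- rs. field_simplify_eq; [|lra].
    replace (r ^ 2) with (D s ^ 2 + D1 s ^ 2) by (rewrite <- rs; ring).
    ring. }
assert (ST : S T = 1).
{ unfold S. rewrite sT, cT at 1. pose proof (polar_radius_pos T) as rp.
  change (0 < rad T) in rp.
  replace (rad T * sin (th T) * sin (th T) + rad T * cos (th T) * cos (th T))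
    with (rad T * (Rsqr (sin (th T)) + Rsqr (cos (th T)))) by (unfold Rsqr; ring).
  rewrite sin2_cos2. field. lra. }
assert (St : S t = 1).
{ rewrite <- ST. destruct (Rtotal_order t T) as [l|[->|g]]; [|reflexivity|].
  - destruct (mean_value S (fun _ => 0) t T l) as [c [_ e]]; [auto|lra].
  - destruct (mean_value S (fun _ => 0) T t g) as [c [_ e]]; [auto|lra]. }
pose proof (polar_radius_pos t) as rp. change (0 < rad t) in rp.
assert (rs : rad t * rad t = D t ^ 2 + D1 t ^ 2) by apply polar_radius_sq.
pose proof (sin2_cos2 (th t)) as sc. unfold Rsqr in sc.
set (s := sin (th t)) in *. set (c := cos (th t)) in *.
assert (Y : D t * s + D1 t * c = rad t).
{ replace (rad t) with (S t * rad t) by (rewrite St; ring).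
  unfold S. fold s c. field. lra. }
(* Lagrange identity: the squared cross product is the product of the squared norms minus the
   squared inner product. *)
assert (X2 : (D t * c - D1 t * s) * (D t * c - D1 t * s) = 0).
{ replace ((D t * c - D1 t * s) * (D t * c - D1 t * s))
    with ((D t ^ 2 + D1 t ^ 2) * (s * s + c * c)
          - (D t * s + D1 t * c) * (D t * s + D1 t * c)) by ring.
  rewrite sc, Y, <- rs. ring. }
assert (X : D t * c - D1 t * s = 0) by nra.
split.
- replace (D t) with (D t * (s * s + c * c)) by (rewrite sc; ring).
  replace (D t * (s * s + c * c))
    with (s * (D t * s + D1 t * c) + c * (D t * c - D1 t * s)) by ring.
  rewrite X, Y. ring.
- replace (D1 t) with (D1 t * (s * s + c * c)) by (rewrite sc; ring).
  replace (D1 t * (s * s + c * c))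
    with (c * (D t * s + D1 t * c) - s * (D t * c - D1 t * s)) by ring.
  rewrite X, Y. ring.
Qed.

Lemma polar_angle_barrier (T a b : R) (k : Z) :
  D T < 0 -> a < b -> IZR k * PI <= polar_angle D D1 D2 T a ->
  IZR k * PI < polar_angle D D1 D2 T b.
Proof.
intros neg ab ka.
apply (upward_barrier (polar_angle D D1 D2 T) (angular_speed D D1 D2) _ a b);
  [intros; apply polar_angle_derive| |exact ab|exact ka].
intros t e. destruct (polar_angle_spec T t neg) as [z _].
rewrite e, sin_eq_0_1 in z by (exists k; reflexivity).
unfold angular_speed. pose proof (pos t) as p. rewrite z in *.
apply Rdiv_lt_0_compat; lra.
Qed.

(** The angle is a multiple of PI at each zero. Going back from T, where it is negative, the barrier
    makes these multiples strictly decrease, so the zero of index i lies at or below -(i + 1) PI. *)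
Lemma polar_angle_many_zeros (T t0 : R) (N : nat) (Z : nat -> R) :
  D T < 0 -> (forall i, (i <= N)%nat -> t0 <= Z i < T /\ D (Z i) = 0) ->
  (forall i, (i < N)%nat -> Z (S i) < Z i) ->
  polar_angle D D1 D2 T t0 <= - INR (S N) * PI.
Proof.
intros neg hZ dZ. pose proof PI_RGT_0 as pi.
destruct (polar_angle_start T neg) as [[_ thT] _].
set (th := polar_angle D D1 D2 T) in *.
assert (mult : forall i, (i <= N)%nat -> exists k, th (Z i) = IZR k * PI).
{ intros i hi. apply sin_eq_0_0. destruct (hZ i hi) as [_ z].
  destruct (polar_angle_spec T (Z i) neg) as [e _]. fold th in e.
  pose proof (polar_radius_pos (Z i)) as rp. change (0 < rad (Z i)) in rp. nra. }
assert (ind : forall i, (i <= N)%nat -> th (Z i) <= - INR (S i) * PI).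
{ induction i as [|i IH]; intros hi; destruct (mult _ hi) as [k ek].
  - assert (k < 0)%Z.
    { apply Z.nle_gt; intros kp. apply IZR_le in kp.
      destruct (hZ 0%nat hi) as [hz _].
      assert (IZR k * PI < th T)
        by (apply polar_angle_barrier with (Z 0%nat); [exact neg|lra|fold th; lra]).
      nra. }
    assert (k1 : IZR k <= -1) by (apply (IZR_le k (-1)); lia).
    rewrite ek. simpl. nra.
  - assert (bar : IZR k * PI < th (Z i)).
    { apply polar_angle_barrier with (Z (S i)); [exact neg|apply dZ; lia|fold th; lra]. }
    assert (hi' : (i <= N)%nat) by lia. specialize (IH hi').
    rewrite INR_IZR_INZ, <- opp_IZR in IH |- *.
    assert (l : IZR k < IZR (- Z.of_nat (S i))) by nra.
    apply lt_IZR in l.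
    assert (l2 : IZR k <= IZR (- Z.of_nat (S (S i)))) by (apply IZR_le; lia).
    rewrite ek. nra. }
destruct (hZ N (Nat.le_refl N)) as [[hz _] _].
destruct (Req_dec t0 (Z N)) as [->|ne]; [apply ind; lia|].
apply Rnot_lt_le; intros l.
specialize (ind N (Nat.le_refl N)).
rewrite INR_IZR_INZ, <- opp_IZR in ind, l.
assert (IZR (- Z.of_nat (S N)) * PI < th (Z N)).
{ apply polar_angle_barrier with t0; [exact neg|lra|left; exact l]. }
lra.
Qed.

(** The bound does not depend on T, which has to be taken large after a second, larger alpha is
    known. While D < 0 the angle cannot reach -PI, since D vanishes there. *)
Lemma polar_angle_lower (T0 T t0 : R) :
  T0 <= T -> (forall t, T0 <= t <= T -> D t < 0) ->
  - PI + RInt (angular_speed D D1 D2) T0 t0 <= polar_angle D D1 D2 T t0.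
Proof.
intros le neg. pose proof PI_RGT_0 as pi.
assert (nT : D T < 0) by (apply neg; lra).
destruct (polar_angle_start T nT) as [thT _].
assert (ex : forall a b, ex_RInt (angular_speed D D1 D2) a b).
{ intros a b. apply (ex_RInt_continuous (V := R_CompleteNormedModule)).
  intros; apply angular_speed_continuous. }
assert (split : polar_angle D D1 D2 T t0
  = polar_angle D D1 D2 T T0 + RInt (angular_speed D D1 D2) T0 t0).
{ unfold polar_angle.
  rewrite <- (RInt_Chasles (angular_speed D D1 D2) T T0 t0) by apply ex.
  unfold plus; simpl. ring. }
rewrite split. apply Rplus_le_compat_r. apply Rnot_lt_le; intros l.
destruct (intermediate_value (polar_angle D D1 D2 T) T0 T (- PI) le) as [z [hz e]].
- intros; eapply continuity_pt_of_derive, polar_angle_derive.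
- nra.
- destruct (polar_angle_spec T z nT) as [s _].
  rewrite e, sin_neg, sin_PI in s. specialize (neg z hz). lra.
Qed.

End Polar.

(** Closeness of the two curves keeps the cosine of the angle difference positive on all of [t0, T].
    The difference starts in (-PI/2, PI/2), so by continuity it never leaves this interval, where
    its sine determines it. *)
Lemma polar_angle_close (D D1 D2 E E1 E2 : R -> R) (T t0 m eta : R) :
  (forall t, is_derive D t (D1 t)) -> (forall t, is_derive D1 t (D2 t)) ->
  (forall t, continuous D2 t) -> (forall t, 0 < D t ^ 2 + D1 t ^ 2) ->
  (forall t, is_derive E t (E1 t)) -> (forall t, is_derive E1 t (E2 t)) ->
  (forall t, continuous E2 t) -> (forall t, 0 < E t ^ 2 + E1 t ^ 2) ->
  t0 <= T -> D T < 0 -> E T < 0 -> 0 < m -> 2 * eta < m ->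
  (forall t, t0 <= t <= T -> m <= sqrt (E t ^ 2 + E1 t ^ 2)) ->
  (forall t, t0 <= t <= T -> Rabs (D t - E t) + Rabs (D1 t - E1 t) <= eta) ->
  let diff := polar_angle D D1 D2 T t0 - polar_angle E E1 E2 T t0 in
  - (PI / 2) < diff < PI / 2 /\ Rabs (sin diff) <= 2 * eta / m.
Proof.
intros dD dD1 cD2 pD dE dE1 cE2 pE le nD nE mp hm hlow hclose diff.
set (th := polar_angle D D1 D2 T) in *. set (ph := polar_angle E E1 E2 T) in *.
pose proof PI_RGT_0 as pi.
assert (comp : forall t, t0 <= t <= T ->
  0 < cos (th t - ph t) /\ Rabs (sin (th t - ph t)) <= 2 * eta / m).
{ intros t ht.
  destruct (polar_angle_spec D D1 D2 dD dD1 cD2 pD T t nD) as [s1 c1].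
  destruct (polar_angle_spec E E1 E2 dE dE1 cE2 pE T t nE) as [s2 c2].
  fold th in s1, c1. fold ph in s2, c2.
  specialize (hlow t ht). specialize (hclose t ht).
  pose proof (polar_radius_pos D D1 pD t) as r1p.
  pose proof (polar_radius_pos E E1 pE t) as r2p.
  pose proof (polar_radius_sq D D1 pD t) as r1s.
  pose proof (polar_radius_sq E E1 pE t) as r2s.
  set (r1 := sqrt (D t ^ 2 + D1 t ^ 2)) in *.
  set (r2 := sqrt (E t ^ 2 + E1 t ^ 2)) in *.
  set (x := D t - E t) in *. set (x1 := D1 t - E1 t) in *.
  assert (Er : Rabs (E t) <= r2).
  { apply Rabs_le. pose proof (pow2_ge_0 (E1 t)). nra. }
  assert (E1r : Rabs (E1 t) <= r2).
  { apply Rabs_le. pose proof (pow2_ge_0 (E t)). nra. }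
  pose proof (Rabs_pos x). pose proof (Rabs_pos x1).
  assert (cosv : r1 * r2 * cos (th t - ph t) = r2 * r2 + (x * E t + x1 * E1 t)).
  { rewrite cos_minus.
    replace (r1 * r2 * (cos (th t) * cos (ph t) + sin (th t) * sin (ph t)))
      with ((r1 * cos (th t)) * (r2 * cos (ph t))
        + (r1 * sin (th t)) * (r2 * sin (ph t))) by ring.
    rewrite <- s1, <- s2, <- c1, <- c2, r2s. unfold x, x1. ring. }
  assert (sinv : r1 * r2 * sin (th t - ph t) = x * E1 t - x1 * E t).
  { rewrite sin_minus.
    replace (r1 * r2 * (sin (th t) * cos (ph t) - cos (th t) * sin (ph t)))
      with ((r1 * sin (th t)) * (r2 * cos (ph t))
        - (r1 * cos (th t)) * (r2 * sin (ph t))) by ring.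
    rewrite <- s1, <- s2, <- c1, <- c2. unfold x, x1. ring. }
  assert (b1 : Rabs (x * E t + x1 * E1 t) <= eta * r2).
  { apply Rle_trans with (1 := Rabs_triang _ _). rewrite !Rabs_mult.
    pose proof (Rabs_pos (E t)). pose proof (Rabs_pos (E1 t)). nra. }
  assert (b2 : Rabs (x * E1 t - x1 * E t) <= eta * r2).
  { unfold Rminus. apply Rle_trans with (1 := Rabs_triang _ _).
    rewrite Rabs_Ropp, !Rabs_mult.
    pose proof (Rabs_pos (E t)). pose proof (Rabs_pos (E1 t)). nra. }
  assert (r12 : r2 / 2 <= r1).
  { apply Rnot_lt_le; intros l.
    assert (cs : r1 * cos (th t - ph t) = r2 + (x * E t + x1 * E1 t) / r2).
    { apply Rmult_eq_reg_r with r2; [|lra].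
      replace (r1 * cos (th t - ph t) * r2) with (r1 * r2 * cos (th t - ph t)) by ring.
      rewrite cosv. field. lra. }
    assert (q : - eta <= (x * E t + x1 * E1 t) / r2).
    { apply Rmult_le_reg_r with r2; [lra|].
      replace ((x * E t + x1 * E1 t) / r2 * r2) with (x * E t + x1 * E1 t)
        by (field; lra).
      pose proof (Rle_abs (- (x * E t + x1 * E1 t))) as q. rewrite Rabs_Ropp in q. lra. }
    pose proof (COS_bound (th t - ph t)). nra. }
  split.
  - assert (0 < r1 * r2 * cos (th t - ph t)).
    { rewrite cosv. pose proof (Rle_abs (- (x * E t + x1 * E1 t))) as q.
      rewrite Rabs_Ropp in q. nra. }
    assert (0 < r1 * r2) by nra. nra.
  - apply Rmult_le_reg_l with (r1 * r2); [nra|].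
    rewrite <- (Rabs_pos_eq (r1 * r2)) at 1 by nra.
    rewrite <- Rabs_mult, sinv. apply Rle_trans with (1 := b2).
    assert (ep : 0 <= eta) by lra.
    assert (mr : m / 2 <= r1) by lra.
    replace (r1 * r2 * (2 * eta / m)) with (eta * r2 * (r1 * (2 / m))) by (field; lra).
    rewrite <- (Rmult_1_r (eta * r2)) at 1.
    apply Rmult_le_compat_l; [nra|].
    apply Rmult_le_reg_r with (m / 2); [lra|].
    replace (r1 * (2 / m) * (m / 2)) with r1 by (field; lra). lra. }
split; [|apply comp; lra].
assert (cont : forall t, continuity_pt (fun t => th t - ph t) t).
{ intros t. apply continuity_pt_minus; eapply continuity_pt_of_derive;
    [apply (polar_angle_derive D D1 D2 dD dD1 cD2 pD)
    |apply (polar_angle_derive E E1 E2 dE dE1 cE2 pE)]. }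
destruct (polar_angle_start D D1 D2 pD T nD) as [tD _]. fold th in tD.
destruct (polar_angle_start E E1 E2 pE T nE) as [tE _]. fold ph in tE.
assert (startT : - (PI / 2) < th T - ph T < PI / 2).
{ destruct (comp T) as [c _]; [lra|]. split.
  - apply Rnot_le_lt; intros l.
    assert (q : cos (- (th T - ph T)) <= 0) by (apply cos_le_0; lra).
    rewrite cos_neg in q. lra.
  - apply Rnot_le_lt; intros l.
    assert (q : cos (th T - ph T) <= 0) by (apply cos_le_0; lra). lra. }
unfold diff. split.
- apply Rnot_le_lt; intros l.
  destruct (intermediate_value (fun t => th t - ph t) t0 T (- (PI / 2)) le)
    as [z [hz e]]; [auto|nra|].
  destruct (comp z hz) as [c _]. rewrite e, cos_neg, cos_PI2 in c. lra.
- apply Rnot_le_lt; intros l.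
  destruct (intermediate_value (fun t => th t - ph t) t0 T (PI / 2) le)
    as [z [hz e]]; [auto|nra|].
  destruct (comp z hz) as [c _]. rewrite e, cos_PI2 in c. lra.
Qed.

(** [c + 1] serves as a root-free upper bound for the square root of [c]. *)
Lemma Rabs_le_of_sq (x a c : R) : 0 <= c -> x ^ 2 <= a ^ 2 * c -> Rabs x <= (c + 1) * Rabs a.
Proof.
intros c0 h. pose proof (Rabs_pos x). pose proof (Rabs_pos a).
rewrite <- (pow2_abs x), <- (pow2_abs a) in h.
apply Rnot_lt_le; intros l.
assert (((c + 1) * Rabs a) ^ 2 < Rabs x ^ 2).
{ assert (0 <= (c + 1) * Rabs a) by (apply Rmult_le_pos; lra). nra. }
assert (0 <= Rabs a ^ 2) by (apply pow2_ge_0).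
assert (Rabs a ^ 2 * c <= ((c + 1) * Rabs a) ^ 2); [|lra].
replace (((c + 1) * Rabs a) ^ 2) with (Rabs a ^ 2 * (c + 1) ^ 2) by ring.
apply Rmult_le_compat_l; nra.
Qed.

(** * Dependence of the polar angle on alpha *)

Section Family.

Context (F : R -> R) (nl : nonlinearity F) (v v1 : R -> R -> R).
Context (reg : forall alpha, 0 < alpha -> log_regular F alpha (v alpha) (v1 alpha)).

Lemma family_lipschitz (M t0 : R) :
  exists C, 0 < C /\ forall alpha beta t,
    0 < alpha <= M -> 0 < beta <= M -> t0 <= t ->
    Rabs (v alpha t - v beta t) + Rabs (v1 alpha t - v1 beta t) <= C * Rabs (alpha - beta).
Proof.
destruct (nl_lip _ nl M) as [L [L0 hL]].
set (X := exp ((1 + L) * exp (- t0))).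
assert (Xp : 0 < X) by apply exp_pos.
assert (Yp : 0 < X * exp (-2 * t0)) by (apply Rmult_lt_0_compat; [lra|apply exp_pos]).
exists (X + 1 + (X * exp (-2 * t0) + 1)). split; [lra|].
intros alpha beta t ha hb ht.
pose proof (log_regular_dependence F nl alpha beta M L _ _ _ _ t
  (reg alpha (proj1 ha)) (reg beta (proj1 hb)) (proj2 ha) (proj2 hb) L0 hL) as dep.
assert (dep' : (v alpha t - v beta t) ^ 2 + exp (2 * t) * (v1 alpha t - v1 beta t) ^ 2
  <= (alpha - beta) ^ 2 * X).
{ apply Rle_trans with (1 := dep). apply Rmult_le_compat_l; [apply pow2_ge_0|].
  assert (le : (1 + L) * exp (- t) <= (1 + L) * exp (- t0)).
  { apply Rmult_le_compat_l; [lra|].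
    destruct ht as [lt| ->]; [left; apply exp_increasing; lra|lra]. }
  unfold X. destruct le as [lt|eq]; [left; apply exp_increasing; exact lt|rewrite eq; lra]. }
pose proof (exp_pos (2 * t)) as ep.
pose proof (pow2_ge_0 (v alpha t - v beta t)) as s0.
pose proof (pow2_ge_0 (v1 alpha t - v1 beta t)) as s1.
assert (0 <= exp (2 * t) * (v1 alpha t - v1 beta t) ^ 2) by (apply Rmult_le_pos; lra).
assert (a0 : Rabs (v alpha t - v beta t) <= (X + 1) * Rabs (alpha - beta))
  by (apply Rabs_le_of_sq; lra).
assert (a1 : Rabs (v1 alpha t - v1 beta t)
  <= (X * exp (-2 * t0) + 1) * Rabs (alpha - beta)).
{ apply Rabs_le_of_sq; [lra|].
  assert (k : 1 <= exp (-2 * t0) * exp (2 * t)).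
  { rewrite <- exp_plus, <- exp_0.
    destruct ht as [lt| ->]; [left; apply exp_increasing; lra|].
    right; f_equal; ring. }
  pose proof (exp_pos (-2 * t0)) as e0.
  apply Rle_trans with (exp (-2 * t0) * (exp (2 * t) * (v1 alpha t - v1 beta t) ^ 2)).
  - rewrite <- Rmult_assoc. rewrite <- (Rmult_1_l ((v1 alpha t - v1 beta t) ^ 2)) at 1.
    apply Rmult_le_compat_r; lra.
  - replace ((alpha - beta) ^ 2 * (X * exp (-2 * t0)))
      with (exp (-2 * t0) * ((alpha - beta) ^ 2 * X)) by ring.
    apply Rmult_le_compat_l; lra. }
lra.
Qed.

Lemma family_continuity (t alpha : R) :
  0 < alpha -> continuity_pt (fun a => v a t) alpha.
Proof.
intros ha. destruct (family_lipschitz (alpha + 1) t) as [C [Cp hC]].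
intros eps he. exists (Rmin (Rmin 1 alpha) (eps / C)). split.
{ repeat apply Rmin_pos; try lra. apply Rdiv_lt_0_compat; lra. }
intros b [_ hb]. simpl in hb |- *. unfold R_dist in hb |- *.
pose proof (Rmin_l (Rmin 1 alpha) (eps / C)). pose proof (Rmin_r (Rmin 1 alpha) (eps / C)).
pose proof (Rmin_l 1 alpha). pose proof (Rmin_r 1 alpha).
assert (hb2 : Rabs (b - alpha) < eps / C) by lra.
assert (hb1 : Rabs (b - alpha) < Rmin 1 alpha) by lra.
apply Rabs_def2 in hb1.
assert (l : Rabs (v b t - v alpha t) + Rabs (v1 b t - v1 alpha t) <= C * Rabs (b - alpha))
  by (apply hC; lra).
pose proof (Rabs_pos (v1 b t - v1 alpha t)).
assert (C * Rabs (b - alpha) < C * (eps / C)) by (apply Rmult_lt_compat_l; lra).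
replace (C * (eps / C)) with eps in * by (field; lra). lra.
Qed.

Context (U U1 : R -> R) (solU : log_solution F U U1).
Context (limU : is_lim U p_infty p_infty).

Let D (a t : R) : R := v a t - U t.
Let D1 (a t : R) : R := v1 a t - U1 t.
Let D2 (a t : R) : R := - (exp (-2 * t) * F (v a t)) - - (exp (-2 * t) * F (U t)).
Let angle (T t a : R) : R := polar_angle (D a) (D1 a) (D2 a) T t.

Lemma difference_derive (a t : R) : 0 < a -> is_derive (D a) t (D1 a t).
Proof.
intros ha. apply is_derive_Rminus; [apply (proj1 (reg a ha))|apply solU].
Qed.

Lemma difference_derive2 (a t : R) : 0 < a -> is_derive (D1 a) t (D2 a t).
Proof.
intros ha. apply is_derive_Rminus; [apply (proj1 (reg a ha))|apply solU].
Qed.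

Lemma difference_continuous2 (a t : R) : 0 < a -> continuous (D2 a) t.
Proof.
intros ha. apply continuity_pt_filterlim. unfold D2.
assert (ce : continuity_pt (fun s => exp (-2 * s)) t).
{ apply (continuity_pt_of_derive _ _ (-2 * exp (-2 * t))).
  auto_derive; [exact I|ring]. }
assert (c : forall y y1, log_solution F y y1 ->
  continuity_pt (fun s => - (exp (-2 * s) * F (y s))) t).
{ intros y y1 s. apply continuity_pt_opp.
  apply (continuity_pt_mult (fun s => exp (-2 * s)) (fun s => F (y s))); [exact ce|].
  apply (continuity_pt_comp y F);
    [apply (log_solution_continuity F y y1 t s)|apply nonlinearity_continuity, nl]. }
apply (continuity_pt_minus (fun s => - (exp (-2 * s) * F (v a s)))
  (fun s => - (exp (-2 * s) * F (U s)))); eapply c; [apply (proj1 (reg a ha))|exact solU].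
Qed.

Lemma difference_nondegenerate (a t : R) : 0 < a -> 0 < D a t ^ 2 + D1 a t ^ 2.
Proof.
intros ha.
pose proof (pow2_ge_0 (D a t)). pose proof (pow2_ge_0 (D1 a t)).
destruct (Req_dec (D a t) 0) as [e|n].
- assert (D1 a t <> 0).
  { intros e1. apply (regular_singular_transversal F nl U U1 solU limU a
      (v a) (v1 a) t (reg a ha)); unfold D, D1 in *; lra. }
  assert (0 < D1 a t ^ 2) by (rewrite <- Rsqr_pow2; apply Rsqr_pos_lt; assumption). lra.
- assert (0 < D a t ^ 2) by (rewrite <- Rsqr_pow2; apply Rsqr_pos_lt; assumption). lra.
Qed.

Lemma angle_continuity (T t0 a0 r : R) :
  t0 <= T -> 0 < r -> (forall a, Rabs (a - a0) < r -> 0 < a /\ D a T < 0) ->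
  continuity_pt (angle T t0) a0.
Proof.
intros le rp near. pose proof PI_RGT_0 as pi.
destruct (near a0) as [ha0 n0]; [rewrite Rminus_diag, Rabs_R0; exact rp|].
destruct (family_lipschitz (a0 + 1) t0) as [C [Cp hC]].
destruct (continuity_ab_min (fun t => D a0 t ^ 2 + D1 a0 t ^ 2) t0 T le) as [tm [hm _]].
{ intros c _.
  assert (sq : forall u, continuity_pt u c -> continuity_pt (fun s => u s ^ 2) c).
  { intros u cu. apply (continuity_pt_ext (fun s => u s * u s));
      [intros; ring|apply continuity_pt_mult; exact cu]. }
  apply (continuity_pt_plus (fun t => D a0 t ^ 2) (fun t => D1 a0 t ^ 2)); apply sq;
    eapply continuity_pt_of_derive; [apply difference_derive|apply difference_derive2];
    exact ha0. }
set (m := sqrt (D a0 tm ^ 2 + D1 a0 tm ^ 2)).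
assert (mp : 0 < m) by (apply sqrt_lt_R0, difference_nondegenerate; exact ha0).
intros eps he.
set (e := Rmin eps (PI / 2)).
assert (ep : 0 < e) by (apply Rmin_pos; lra).
assert (e1 : e <= eps) by apply Rmin_l. assert (e2 : e <= PI / 2) by apply Rmin_r.
assert (sp : 0 < sin e) by (apply sin_gt_0; lra).
assert (s1 : sin e <= 1) by apply SIN_bound.
(* Yields 3 eta <= m sin e, hence both 2 eta < m and 2 eta / m < sin e. As e <= PI/2, the bound on
   the sine can be inverted. *)
set (d := Rmin (Rmin 1 r) (m * sin e / (3 * C))).
assert (dp : 0 < d).
{ repeat apply Rmin_pos; try lra. apply Rdiv_lt_0_compat; [nra|lra]. }
exists d. split; [exact dp|].
intros a [_ ha]. simpl in ha |- *. unfold R_dist in ha |- *.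
pose proof (Rmin_l (Rmin 1 r) (m * sin e / (3 * C))) as q1.
pose proof (Rmin_r (Rmin 1 r) (m * sin e / (3 * C))) as q2.
pose proof (Rmin_l 1 r) as q3. pose proof (Rmin_r 1 r) as q4.
fold d in q1, q2.
destruct (near a) as [ap na]; [lra|].
set (eta := C * Rabs (a - a0)).
assert (heta : 3 * eta <= m * sin e).
{ unfold eta. replace (m * sin e) with (3 * (C * (m * sin e / (3 * C)))) by (field; lra).
  apply Rmult_le_compat_l; [lra|]. apply Rmult_le_compat_l; lra. }
assert (eta0 : 0 <= eta) by (apply Rmult_le_pos; [lra|apply Rabs_pos]).
assert (ha1 : Rabs (a - a0) < 1) by lra. apply Rabs_def2 in ha1.
assert (ms : m * sin e <= m) by nra.
assert (ms0 : 0 < m * sin e) by nra.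
destruct (polar_angle_close (D a) (D1 a) (D2 a) (D a0) (D1 a0) (D2 a0) T t0 m eta)
  as [[dl dr] sd];
  try (intros; (apply difference_derive || apply difference_derive2 ||
    apply difference_continuous2 || apply difference_nondegenerate); assumption);
  try assumption.
- lra.
- intros t ht. unfold m. apply sqrt_le_1_alt. apply hm; exact ht.
- intros t ht. unfold D, D1.
  replace (v a t - U t - (v a0 t - U t)) with (v a t - v a0 t) by ring.
  replace (v1 a t - U1 t - (v1 a0 t - U1 t)) with (v1 a t - v1 a0 t) by ring.
  apply hC; lra.
- fold (angle T t0 a) (angle T t0 a0) in dl, dr, sd.
  set (diff := angle T t0 a - angle T t0 a0) in *.
  assert (small : 2 * eta / m < sin e).
  { apply Rmult_lt_reg_r with m; [exact mp|].
    replace (2 * eta / m * m) with (2 * eta) by (field; lra). lra. }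
  assert (sdd : Rabs (sin diff) < sin e) by lra.
  apply Rabs_def2 in sdd. destruct sdd as [sd1 sd2].
  apply Rabs_def1.
  + apply Rlt_le_trans with (2 := e1). apply sin_increasing_0; lra.
  + rewrite <- sin_neg in sd2.
    assert (- e < diff) by (apply sin_increasing_0; lra). lra.
Qed.

(* The polar angle at [t0] is continuous in alpha and unbounded below, so
   it meets every residue class modulo 2 pi. *)
Lemma family_changes_sign (t0 : R) :
  (forall N T0, exists A, forall alpha y y1, A <= alpha -> log_regular F alpha y y1 ->
    exists Z : nat -> R,
      (forall i, (i <= N)%nat -> T0 <= Z i /\ y (Z i) = U (Z i)) /\
      (forall i, (i < N)%nat -> Z (S i) < Z i)) ->
  forall A, (exists a, A < a /\ 0 < a /\ v a t0 < U t0) /\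
            (exists a, A < a /\ 0 < a /\ U t0 < v a t0).
Proof.
intros many A. pose proof PI_RGT_0 as pi.
set (a0 := Rmax A 0 + 1).
assert (a0p : 0 < a0) by (unfold a0; pose proof (Rmax_r A 0); lra).
assert (a0A : A < a0) by (unfold a0; pose proof (Rmax_l A 0); lra).
destruct (is_lim_p_infty_ge U a0 limU) as [T1 hT1].
set (c := PI + Rabs (RInt (angular_speed (D a0) (D1 a0) (D2 a0)) T1 t0)).
assert (exists n : nat, c < INR n * (2 * PI)) as [n hn].
{ destruct (INR_unbounded (c / (2 * PI))) as [n hn]. exists n.
  apply Rmult_gt_compat_r with (r := 2 * PI) in hn; [|lra].
  replace (c / (2 * PI) * (2 * PI)) with c in hn by (field; lra). lra. }
(* With indices 0 to 2n + 2 the angle for [b] falls to -(2n + 3) PI or lower, while the angle for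
   [a0] is at least -c > -2n PI. Between these lie -PI/2 - 2n PI, with sine -1, and -3 PI/2 - 2n PI,
   with sine 1. *)
destruct (many (2 * n + 2)%nat t0) as [B hB].
set (b := Rmax B (a0 + 1)).
assert (bB : B <= b) by apply Rmax_l. assert (ba : a0 + 1 <= b) by apply Rmax_r.
assert (bp : 0 < b) by lra.
destruct (hB b (v b) (v1 b) bB (reg b bp)) as [Z [hZ dZ]].
(* The margin 1 above [b] gives every parameter in [a0, b] a full neighbourhood on which D is
   negative at T. *)
destruct (is_lim_p_infty_ge U (b + 1) limU) as [T2 hT2].
set (T := Rmax t0 (Rmax T1 T2)).
assert (Tt : t0 <= T) by apply Rmax_l.
assert (TT1 : T1 <= T) by (apply Rle_trans with (2 := Rmax_r _ _), Rmax_l).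
assert (TT2 : T2 <= T) by (apply Rle_trans with (2 := Rmax_r _ _), Rmax_r).
assert (neg : forall a t, 0 < a -> a <= b + 1 -> T2 <= t -> D a t < 0).
{ intros a t ap al ht. specialize (hT2 t ht).
  pose proof (log_regular_le F nl a (v a) (v1 a) t (reg a ap)). unfold D; lra. }
assert (low : - c <= angle T t0 a0).
{ apply Rle_trans with (- PI + RInt (angular_speed (D a0) (D1 a0) (D2 a0)) T1 t0).
  - pose proof (Rle_abs (- RInt (angular_speed (D a0) (D1 a0) (D2 a0)) T1 t0)) as q.
    rewrite Rabs_Ropp in q. unfold c. lra.
  - apply (polar_angle_lower (D a0) (D1 a0) (D2 a0)); try exact TT1;
    try (intros; (apply difference_derive || apply difference_derive2 ||
      apply difference_continuous2 || apply difference_nondegenerate); assumption).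
    intros t ht. pose proof (hT1 t (proj1 ht)).
    pose proof (log_regular_le F nl a0 (v a0) (v1 a0) t (reg a0 a0p)). unfold D; lra. }
assert (high : angle T t0 b <= - INR (S (2 * n + 2)) * PI).
{ apply (polar_angle_many_zeros (D b) (D1 b) (D2 b)) with Z;
    try (intros; (apply difference_derive || apply difference_derive2 ||
      apply difference_continuous2 || apply difference_nondegenerate); assumption).
  - apply neg; lra.
  - intros i hi. destruct (hZ i hi) as [h1 h2]. split; [split; [exact h1|]|].
    + apply Rnot_le_lt; intros l.
      assert (D b (Z i) < 0) by (apply neg; lra). unfold D in *; lra.
    + unfold D; lra.
  - exact dZ. }
assert (Sn : INR (S (2 * n + 2)) = 2 * INR n + 3).
{ rewrite S_INR, plus_INR, mult_INR. simpl. ring. }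
assert (spec : forall a, a0 < a -> a <= b + 1 ->
  D a t0 = sqrt (D a t0 ^ 2 + D1 a t0 ^ 2) * sin (angle T t0 a) /\
  0 < sqrt (D a t0 ^ 2 + D1 a t0 ^ 2)).
{ intros a h1 h2. assert (ap : 0 < a) by lra.
  split; [|apply sqrt_lt_R0, difference_nondegenerate; exact ap].
  apply (polar_angle_spec (D a) (D1 a) (D2 a));
    try (intros; (apply difference_derive || apply difference_derive2 ||
      apply difference_continuous2 || apply difference_nondegenerate); assumption).
  apply neg; lra. }
assert (hitting : forall m, - INR (S (2 * n + 2)) * PI <= m < - c ->
  exists a, a0 < a /\ a <= b + 1 /\ angle T t0 a = m).
{ intros m hm.
  destruct (intermediate_value (angle T t0) a0 b m) as [a [ha e]].
  - lra.
  - intros a ha. apply (angle_continuity T t0 a (Rmin 1 a)).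
    + exact Tt.
    + apply Rmin_pos; lra.
    + intros x hx. pose proof (Rmin_l 1 a). pose proof (Rmin_r 1 a).
      apply Rabs_def2 in hx. split; [lra|]. apply neg; lra.
  - nra.
  - exists a. split; [|split; [lra|exact e]].
    destruct (Req_dec a a0) as [->|]; lra. }
assert (sinv : forall x, sin (x + 2 * INR n * PI) = sin x) by (intros; apply sin_period).
split.
- destruct (hitting (- (PI / 2) - 2 * INR n * PI)) as [a [h1 [h2 e]]];
    [rewrite Sn; lra|].
  exists a. split; [lra|]. split; [lra|].
  destruct (spec a h1 h2) as [s p]. rewrite e in s.
  assert (v1s : sin (- (PI / 2) - 2 * INR n * PI) = -1).
  { rewrite <- sinv.
    replace (- (PI / 2) - 2 * INR n * PI + 2 * INR n * PI) with (- (PI / 2)) by ring.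
    rewrite sin_neg, sin_PI2. ring. }
  rewrite v1s in s. unfold D in *. lra.
- destruct (hitting (PI / 2 - 2 * INR n * PI - 2 * PI)) as [a [h1 [h2 e]]];
    [rewrite Sn; lra|].
  exists a. split; [lra|]. split; [lra|].
  destruct (spec a h1 h2) as [s p]. rewrite e in s.
  assert (v1s : sin (PI / 2 - 2 * INR n * PI - 2 * PI) = 1).
  { rewrite <- sinv.
    replace (PI / 2 - 2 * INR n * PI - 2 * PI + 2 * INR n * PI)
      with (- (3 * (PI / 2))) by field.
    rewrite sin_neg, sin_3PI2. ring. }
  rewrite v1s in s. unfold D in *. lra.
Qed.

End Family.

(** * From the hypotheses on f and U to the variable t *)

Lemma Rmax_0_contracting (x y : R) : Rabs (Rmax 0 x - Rmax 0 y) <= Rabs (x - y).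
Proof.
unfold Rmax; destruct (Rle_dec 0 x); destruct (Rle_dec 0 y);
  unfold Rabs; repeat destruct Rcase_abs; lra.
Qed.

Lemma continue_in_half_line (k : R -> R) (s : R) :
  (forall x, 0 <= x -> continue_in k (fun t => 0 <= t) x) ->
  continuity_pt (fun x => k (Rmax 0 x)) s.
Proof.
intros c eps he. destruct (c (Rmax 0 s) (Rmax_l 0 s) eps he) as [d [dp hd]].
exists d. split; [exact dp|]. intros x [_ hx]. simpl in hx, hd |- *.
unfold R_dist in *. destruct (Req_dec (Rmax 0 x) (Rmax 0 s)) as [->|ne].
- rewrite Rminus_diag, Rabs_R0. exact he.
- apply hd. split; [split; [apply Rmax_l|auto]|].
  apply Rle_lt_trans with (1 := Rmax_0_contracting x s). exact hx.
Qed.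

Lemma extend_nonneg (f : R -> R) (x : R) : 0 <= x -> extend f x = f x.
Proof. intros hx. unfold extend. rewrite Rmax_right by exact hx. reflexivity. Qed.

Lemma extend_derive (f f' : R -> R) (c : R) :
  D_in f f' (fun t => 0 <= t) c -> 0 < c -> is_derive (extend f) c (f' c).
Proof.
intros d cp. apply is_derive_Reals. intros eps he.
destruct (d eps he) as [r [rp hr]].
assert (mp : 0 < Rmin r c) by (apply Rmin_pos; assumption).
exists (mkposreal _ mp). intros h h0 hh. simpl in hh, hr. unfold R_dist in hr.
pose proof (Rmin_l r c). pose proof (Rmin_r r c).
assert (hc : Rabs h < c) by lra. apply Rabs_def2 in hc.
rewrite !extend_nonneg by lra.
replace ((f (c + h) - f c) / h) with ((f (c + h) - f c) / (c + h - c))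
  by (f_equal; ring).
apply hr. split; [split; [lra|lra]|].
replace (c + h - c) with h by ring. lra.
Qed.

Lemma extend_nonlinearity (f : R -> R) :
  C1_half_line f -> (forall s, 0 <= s -> 0 < f s) -> nonlinearity (extend f).
Proof.
intros [f' hf] pos. constructor.
- intros x. apply pos, Rmax_l.
- intros x hx. unfold extend. rewrite !Rmax_left by lra. reflexivity.
- intros M. set (M' := Rmax 0 M). assert (M0 : 0 <= M') by apply Rmax_l.
  assert (cf : forall s, continuity_pt (extend f) s).
  { intros s. apply continue_in_half_line. intros x hx.
    apply cont_deriv with f'. apply hf; exact hx. }
  assert (cd : forall s, continuity_pt (fun x => Rabs (f' (Rmax 0 x))) s).
  { intros s. apply (continuity_pt_comp (fun x => f' (Rmax 0 x)) Rabs).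
    - apply continue_in_half_line. intros x hx. apply hf; exact hx.
    - apply Rcontinuity_abs. }
  destruct (continuity_ab_maj (fun x => Rabs (f' (Rmax 0 x))) 0 M' M0) as [m [hm _]];
    [auto|].
  set (L := Rabs (f' (Rmax 0 m))).
  exists L. split; [apply Rabs_pos|].
  assert (lip : forall x y, 0 <= x -> x < y -> y <= M' ->
    Rabs (extend f x - extend f y) <= L * Rabs (x - y)).
  { intros x y x0 xy yM.
    destruct (MVT_gen (extend f) x y f') as [c [hc e]];
      rewrite ?Rmin_left, ?Rmax_right in * by lra.
    - intros c hc. apply extend_derive; [apply hf; lra|lra].
    - intros; apply cf.
    - rewrite <- Rabs_Ropp, Ropp_minus_distr, e, Rabs_mult.
      rewrite (Rabs_minus_sym x y).
      apply Rmult_le_compat_r; [apply Rabs_pos|].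
      specialize (hm c). cbv beta in hm. rewrite Rmax_right in hm by lra. apply hm; lra. }
  assert (sym : forall x y, 0 <= x <= M' -> 0 <= y <= M' ->
    Rabs (extend f x - extend f y) <= L * Rabs (x - y)).
  { intros x y hx hy. destruct (Rtotal_order x y) as [l|[->|g]].
    - apply lip; lra.
    - rewrite !Rminus_diag, Rabs_R0. lra.
    - rewrite Rabs_minus_sym, (Rabs_minus_sym x). apply lip; lra. }
  assert (red : forall x, extend f x = extend f (Rmax 0 x)).
  { intros x. unfold extend. rewrite (Rmax_right 0 (Rmax 0 x)) by apply Rmax_l. reflexivity. }
  intros x y hx hy. rewrite (red x), (red y).
  apply Rle_trans with (L * Rabs (Rmax 0 x - Rmax 0 y)).
  + apply sym; (split; [apply Rmax_l|apply Rle_max_compat_l; assumption]).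
  + apply Rmult_le_compat_l; [apply Rabs_pos|apply Rmax_0_contracting].
Qed.

(** This is how the integrability clause of [G1] forces [g] to increase: otherwise 1/g stays above
    the constant 1/g(s). *)
Lemma decreasing_positive_not_integrable (g g1 : R -> R) (s : R) :
  (forall x, s <= x -> is_derive g x (g1 x)) ->
  (forall x, s <= x -> g1 x <= 0) -> (forall x, s <= x -> 0 < g x) ->
  ~ ex_RInt_gen (fun u => / g u) (at_point s) (Rbar_locally p_infty).
Proof.
intros d neg pos [l hl].
destruct (hl (ball l 1)) as [Q B hQ [M hB] prod].
{ exists (mkposreal 1 Rlt_0_1). auto. }
set (G := g s). assert (Gp : 0 < G) by (apply pos; lra).
set (x := Rmax (M + 1) (s + G * (Rabs l + 2))).
assert (x1 : M < x) by (unfold x; pose proof (Rmax_l (M + 1) (s + G * (Rabs l + 2))); lra).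
assert (x2 : s + G * (Rabs l + 2) <= x) by apply Rmax_r.
destruct (prod s x hQ (hB x x1)) as [y [hy by_]]. simpl in hy.
pose proof (Rabs_pos l) as al.
assert (sx : s <= x) by nra.
assert (low : (x - s) * / G <= y).
{ apply (is_RInt_le (fun _ => / G) (fun u => / g u) s x _ _ sx).
  - apply (is_RInt_const s x (/ G)).
  - exact hy.
  - intros z hz. apply Rinv_le_contravar; [apply pos; lra|].
    unfold G. cut (- g s <= - g z); [lra|].
    apply (nondecreasing_of_derive (fun t => - g t) (fun t => - g1 t)); [lra| |].
    + intros t ht. apply is_derive_Ropp, d; lra.
    + intros t ht. assert (g1 t <= 0) by (apply neg; lra). lra. }
assert (low2 : Rabs l + 2 <= y).
{ apply Rle_trans with (2 := low).
  apply Rmult_le_reg_r with G; [exact Gp|].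
  rewrite Rmult_assoc, Rinv_l by lra. lra. }
assert (b : Rabs (y - l) < 1) by exact by_.
apply Rabs_def2 in b. pose proof (Rle_abs l). lra.
Qed.

Lemma rapid_growth_of_G1_G2 (f : R -> R) (q : R) :
  (forall s, 0 <= s -> 0 < f s) -> G1 f q -> G2 f -> 1 <= q < 2 ->
  exists h s1, 0 < s1 /\
    rapid_growth (extend f) (logf f) (Derive (logf f)) (Derive_n (logf f) 2) h s1 /\
    (forall s, s1 <= s -> 1 / 2 <= H f s <= 2).
Proof.
intros fpos [[Mp gpos] [[Mi gint] [[Mz gnz] [_ limH]]]] [_ [s0 [_ [s0p [smooth _]]]]] hq.
assert (iq : 1 / 2 < / q <= 1).
{ split.
  - replace (1 / 2) with (/ 2) by field. apply Rinv_lt_contravar; lra.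
  - rewrite <- Rinv_1. apply Rinv_le_contravar; lra. }
set (g := logf f) in *. set (g1 := Derive g) in *. set (g2 := Derive_n g 2) in *.
(* The midpoint of 1/2 and 1/q. Staying within 1/q - h of the limit gives H > h and H < 2/q - h <
   2. *)
set (h := (1 / 2 + / q) / 2).
apply is_lim_spec in limH.
assert (ep : 0 < / q - h) by (unfold h; lra).
destruct (limH (mkposreal _ ep)) as [MH hH]. simpl in hH.
set (s2 := Rmax (Rmax (Mp + 1) (Mi + 1)) (Rmax (Rmax (Mz + 1) (MH + 1)) (s0 + 1))).
assert (b1 : Mp < s2 /\ Mi < s2 /\ Mz < s2 /\ MH < s2 /\ s0 < s2).
{ unfold s2.
  pose proof (Rmax_l (Rmax (Mp + 1) (Mi + 1)) (Rmax (Rmax (Mz + 1) (MH + 1)) (s0 + 1))).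
  pose proof (Rmax_r (Rmax (Mp + 1) (Mi + 1)) (Rmax (Rmax (Mz + 1) (MH + 1)) (s0 + 1))).
  pose proof (Rmax_l (Mp + 1) (Mi + 1)). pose proof (Rmax_r (Mp + 1) (Mi + 1)).
  pose proof (Rmax_l (Rmax (Mz + 1) (MH + 1)) (s0 + 1)).
  pose proof (Rmax_r (Rmax (Mz + 1) (MH + 1)) (s0 + 1)).
  pose proof (Rmax_l (Mz + 1) (MH + 1)). pose proof (Rmax_r (Mz + 1) (MH + 1)). lra. }
assert (d1 : forall s, s2 <= s -> is_derive g s (g1 s)).
{ intros s hs. apply Derive_correct. destruct (smooth s) as [ex _]; [lra|].
  exact (ex 1%nat (le_S _ _ (le_S _ _ (le_S _ _ (le_S _ _ (le_n 1)))))). }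
assert (d2 : forall s, s2 <= s -> is_derive g1 s (g2 s)).
{ intros s hs. apply (Derive_correct g1). destruct (smooth s) as [ex _]; [lra|].
  exact (ex 2%nat (le_S _ _ (le_S _ _ (le_S _ _ (le_n 2))))). }
assert (gp : forall s, s2 <= s -> 0 < g s) by (intros; apply gpos; lra).
assert (g1nz : forall s, s2 <= s -> g1 s <> 0) by (intros; apply gnz; lra).
assert (Hb : forall s, s2 <= s -> h <= H f s <= 2).
{ intros s hs. assert (q1 : Rabs (H f s - / q) < / q - h) by (apply hH; lra).
  apply Rabs_def2 in q1. unfold h in *. lra. }
assert (Heq : forall s, s2 <= s -> g s * g2 s = H f s * g1 s ^ 2).
{ intros s hs. unfold H. fold g g1 g2. field. apply g1nz; exact hs. }
assert (g2p : forall s, s2 <= s -> 0 < g2 s).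
{ intros s hs. pose proof (Heq s hs) as e. pose proof (Hb s hs) as hb.
  pose proof (gp s hs) as p.
  assert (sq : 0 < g1 s ^ 2) by (rewrite <- Rsqr_pow2; apply Rsqr_pos_lt, g1nz; exact hs).
  assert (hp : 0 < h) by (unfold h; lra).
  destruct (Rlt_le_dec 0 (g2 s)) as [|n]; [assumption|].
  assert (0 < H f s * g1 s ^ 2) by (apply Rmult_lt_0_compat; lra). nra. }
assert (exists s3, s2 <= s3 /\ 0 < g1 s3) as [s3 [hs3 ps3]].
{ apply NNPP; intros no.
  apply (decreasing_positive_not_integrable g g1 s2 d1); [|exact gp|apply gint; lra].
  intros x hx. apply Rnot_lt_le; intros l. apply no. exists x; auto. }
assert (g1mono : forall x y, s3 <= x -> x <= y -> g1 x <= g1 y).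
{ intros x y hx xy. apply (nondecreasing_of_derive g1 g2); [exact xy| |].
  - intros; apply d2; lra.
  - intros; left; apply g2p; lra. }
(* Over the length [1 / g1 s3] the convex positive function [g] gains at least 1. *)
set (s1 := s3 + 1 / g1 s3).
assert (s13 : s3 < s1) by (unfold s1; assert (0 < 1 / g1 s3) by (apply Rdiv_lt_0_compat; lra); lra).
assert (gge : forall s, s1 <= s -> 1 <= g s).
{ intros s hs. destruct (mean_value g g1 s3 s) as [c [hc e]]; [lra|intros; apply d1; lra|].
  assert (g1 s3 <= g1 c) by (apply g1mono; lra).
  assert (g1 s3 * (1 / g1 s3) <= g1 c * (s - s3)).
  { apply Rmult_le_compat; [lra|left; apply Rdiv_lt_0_compat; lra|assumption|].
    unfold s1 in hs. lra. }
  replace (g1 s3 * (1 / g1 s3)) with 1 in * by (field; lra).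
  pose proof (gp s3 hs3). lra. }
exists h, s1. split; [lra|]. split.
- constructor.
  + unfold h; lra.
  + intros s hs. rewrite extend_nonneg by lra. unfold g, logf.
    rewrite exp_ln; [reflexivity|apply fpos; lra].
  + intros; apply d1; lra.
  + intros; apply d2; lra.
  + exact gge.
  + intros s hs. apply Rlt_le_trans with (1 := ps3). apply g1mono; lra.
  + intros s hs. rewrite Heq by lra. apply Rmult_le_compat_r; [apply pow2_ge_0|].
    apply Hb; lra.
  + intros s hs. rewrite Heq by lra. apply Rmult_le_compat_r; [apply pow2_ge_0|].
    apply Hb; lra.
- intros s hs. assert (hb : h <= H f s <= 2) by (apply Hb; lra). unfold h in *. lra.
Qed.

(** * The change of variable r = e^(-t) *)

Lemma radial_equation_derives (f w : R -> R) (r : R) :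
  radial_equation f w -> 0 < r ->
  is_derive w r (Derive w r) /\
  is_derive (Derive w) r (- (/ r * Derive w r) - extend f (w r)).
Proof.
intros [smooth eq] rp. destruct (smooth r rp) as [ex _].
split.
- apply Derive_correct. exact (ex 1%nat (le_S _ _ (le_n 1))).
- replace (- (/ r * Derive w r) - extend f (w r)) with (Derive_n w 2 r)
    by (specialize (eq r rp); lra).
  apply (Derive_correct (Derive w)). exact (ex 2%nat (le_n 2)).
Qed.

Lemma log_solution_of_radial (f w : R -> R) :
  radial_equation f w ->
  log_solution (extend f) (fun t => w (exp (- t)))
    (fun t => - exp (- t) * Derive w (exp (- t))).
Proof.
intros eq t. pose proof (exp_pos (- t)) as ep.
destruct (radial_equation_derives f w (exp (- t)) eq ep) as [d d1].
split.
- auto_derive; [eexists; exact d|]. derive_at d. ring.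
- auto_derive; [eexists; exact d1|]. derive_at d1.
  replace (exp (-2 * t)) with (exp (- t) * exp (- t))
    by (rewrite <- exp_plus; f_equal; ring).
  field. lra.
Qed.

Lemma exp_neg_at_right (d : R) : 0 < d -> exists T, forall t, T <= t -> exp (- t) < d.
Proof.
intros dp. exists (1 - ln d). intros t ht.
rewrite <- (exp_ln d) by exact dp. apply exp_increasing. lra.
Qed.

Lemma log_singular_limit (U : R -> R) :
  filterlim U (at_right 0) (Rbar_locally p_infty) ->
  is_lim (fun t => U (exp (- t))) p_infty p_infty.
Proof.
intros l. apply is_lim_spec. intros M.
destruct (l (fun x => M < x)) as [[d dp] hd]; [exists M; auto|]. simpl in hd.
destruct (exp_neg_at_right d dp) as [T hT]. exists T. intros t ht.
pose proof (exp_pos (- t)) as ep.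
apply hd; [|exact ep]. change (Rabs (exp (- t) - 0) < d).
rewrite Rminus_0_r, Rabs_pos_eq by lra. apply hT; lra.
Qed.

Lemma regular_solution_near_0 (f w : R -> R) (alpha eps : R) :
  regular_solution f alpha w -> 0 < eps ->
  exists d, 0 < d /\ forall r, 0 < r < d -> Rabs (w r - alpha) <= eps * r.
Proof.
intros [_ [w0 l]] he.
destruct (l (fun x => Rabs x < eps)) as [[d dp] hd].
{ exists (mkposreal eps he). intros y hy. change (Rabs (y - 0) < eps) in hy.
  rewrite Rminus_0_r in hy. exact hy. }
simpl in hd. exists d. split; [exact dp|]. intros r hr.
assert (q : Rabs ((w r - w 0) / r) < eps).
{ apply hd; [|lra]. change (Rabs (r - 0) < d).
  rewrite Rminus_0_r, Rabs_pos_eq by lra. lra. }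
rewrite <- w0. unfold Rdiv in q. rewrite Rabs_mult, (Rabs_pos_eq (/ r)) in q
  by (left; apply Rinv_0_lt_compat; lra).
apply Rmult_le_reg_r with (/ r); [apply Rinv_0_lt_compat; lra|].
rewrite Rmult_assoc, Rinv_r by lra. lra.
Qed.

Lemma log_regular_of_regular (f w : R -> R) (alpha : R) :
  regular_solution f alpha w ->
  log_regular (extend f) alpha (fun t => w (exp (- t)))
    (fun t => - exp (- t) * Derive w (exp (- t))).
Proof.
intros r. split; [apply log_solution_of_radial, r|].
apply is_lim_spec. intros [eps he].
destruct (regular_solution_near_0 f w alpha 1 r) as [d [dp hd]]; [lra|].
assert (mp : 0 < Rmin d eps) by (apply Rmin_pos; assumption).
destruct (exp_neg_at_right _ mp) as [T hT]. exists T. intros t ht. simpl.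
pose proof (exp_pos (- t)). assert (q : exp (- t) < Rmin d eps) by (apply hT; lra).
pose proof (Rmin_l d eps). pose proof (Rmin_r d eps).
assert (Rabs (w (exp (- t)) - alpha) <= 1 * exp (- t)) by (apply hd; lra). lra.
Qed.

Lemma inverse_near_infinity_rapid (F g g1 g2 ginv : R -> R) (h s1 : R) :
  rapid_growth F g g1 g2 h s1 -> inverse_near_infinity g ginv ->
  exists T, forall t, T <= t -> s1 <= ginv t /\ g (ginv t) = t.
Proof.
intros rg [S [hS _]]. set (b := Rmax s1 S).
assert (bs : s1 <= b) by apply Rmax_l. assert (bS : S <= b) by apply Rmax_r.
exists (g b). intros t ht.
destruct (rg_unbounded _ _ _ _ _ _ rg t) as [c [hc gc]].
set (e := Rmax b c). assert (be : b <= e) by apply Rmax_l.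
assert (ge : t <= g e) by (apply gc, Rmax_r).
destruct (intermediate_value g b e t be) as [s [hs es]].
- intros x hx. eapply continuity_pt_of_derive, (rg_d1 _ _ _ _ _ _ rg). lra.
- nra.
- rewrite <- es at 1 2 3. rewrite hS by lra. split; [lra|reflexivity].
Qed.

(* Only the leading part [g(U) = 2t - ln (2t) - ln (g1 (ginv (2t))) + O(1)] of
   the expansion is used. *)
Lemma singular_asymptotics_of_expansion (f ginv U g2 : R -> R) (h s1 : R) :
  rapid_growth (extend f) (logf f) (Derive (logf f)) g2 h s1 ->
  (forall s, s1 <= s -> 1 / 2 <= H f s <= 2) ->
  inverse_near_infinity (logf f) ginv -> singular_expansion f ginv U ->
  is_lim (fun t => U (exp (- t))) p_infty p_infty ->
  forall delta, 0 < delta < 1 -> exists T,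
    singular_asymptotics (extend f) (logf f) (Derive (logf f)) (fun t => U (exp (- t)))
      s1 (exp (-1) / 4) (9 * exp 1) delta T.
Proof.
intros rg hH inv expn lim delta hd.
destruct (inverse_near_infinity_rapid _ _ _ _ _ _ _ rg inv) as [Ti hTi].
destruct (is_lim_p_infty_ge _ s1 lim) as [Tu hTu].
set (g := logf f) in *. set (g1 := Derive g) in *.
destruct (expn (1 / 2)) with (P := fun x => Rabs x < 1) as [[r rp] hr]; [lra| |].
{ exists (mkposreal 1 Rlt_0_1). intros y hy. change (Rabs (y - 0) < 1) in hy.
  rewrite Rminus_0_r in hy. exact hy. }
simpl in hr. destruct (exp_neg_at_right r rp) as [Te hTe].
pose proof (rg_g1 _ _ _ _ _ _ rg s1 (Rle_refl _)) as p1.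
pose proof (rg_ge1 _ _ _ _ _ _ rg s1 (Rle_refl _)) as gs1.
assert (gs2 : 0 < g s1 ^ 2) by (apply pow_lt; lra).
set (C := g1 s1 / g s1 ^ 2).
assert (Cp : 0 < C) by (apply Rdiv_lt_0_compat; assumption).
set (m := Rmin delta (1 / 2)).
assert (mp : 0 < m) by (apply Rmin_pos; lra).
assert (m1 : m <= delta) by apply Rmin_l. assert (m2 : m <= 1 / 2) by apply Rmin_r.
(* [K1] collects the bounded terms in g(U) <= 2t + K1, so t >= K1 gives g(U) <= 3t. [K2] does the
   same from below, after 3 ln (2t) <= m t - 3 - 3 ln (m/6) has absorbed the logarithms, including
   that of [g1 s], which is at most of order (2t)^2. *)
set (K1 := ln 8 + 1 - ln (g1 s1)).
set (K2 := ln C + 1 - 3 - 3 * ln (m / 6)).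
set (T := Rmax (Rmax 1 Ti) (Rmax (Rmax Tu Te) (Rmax K1 (K2 / m)))).
assert (hT : 1 <= T /\ Ti <= T /\ Tu <= T /\ Te <= T /\ K1 <= T /\ K2 / m <= T).
{ unfold T.
  pose proof (Rmax_l (Rmax 1 Ti) (Rmax (Rmax Tu Te) (Rmax K1 (K2 / m)))).
  pose proof (Rmax_r (Rmax 1 Ti) (Rmax (Rmax Tu Te) (Rmax K1 (K2 / m)))).
  pose proof (Rmax_l 1 Ti). pose proof (Rmax_r 1 Ti).
  pose proof (Rmax_l (Rmax Tu Te) (Rmax K1 (K2 / m))).
  pose proof (Rmax_r (Rmax Tu Te) (Rmax K1 (K2 / m))).
  pose proof (Rmax_l Tu Te). pose proof (Rmax_r Tu Te).
  pose proof (Rmax_l K1 (K2 / m)). pose proof (Rmax_r K1 (K2 / m)). lra. }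
clearbody T.
assert (main : forall t, T <= t -> let s := ginv (2 * t) in let u := U (exp (- t)) in
  s1 <= s /\ g s = 2 * t /\ s1 <= u /\ exists e, Rabs e < 1 /\
  g u - 2 * t = - ln (2 * t) - ln (g1 s) + ln 4 + ln (H f s) + e).
{ intros t ht s u.
  destruct (hTi (2 * t)) as [hs gs]; [lra|]. fold s in hs, gs.
  split; [exact hs|]. split; [exact gs|].
  assert (hu : s1 <= u) by (left; apply hTu; lra).
  split; [exact hu|].
  pose proof (exp_pos (- t)) as ep.
  assert (q : Rabs ((g (U (exp (- t))) - singular_main_terms f ginv (exp (- t)))
    / Rpower (- ln (exp (- t))) (-1 + 1 / 2)) < 1).
  { apply hr; [|exact ep]. change (Rabs (exp (- t) - 0) < r).
    rewrite Rminus_0_r, Rabs_pos_eq by lra. apply hTe; lra. }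
  unfold singular_main_terms in q. fold g g1 u in q. rewrite ln_exp in q.
  replace (-2 * - t) with (2 * t) in q by ring.
  replace (- - t) with t in q by ring. fold s in q. cbv zeta in q. fold s in q.
  rewrite gs in q.
  assert (g1p : 0 < g1 s) by (apply (rg_g1 _ _ _ _ _ _ rg); exact hs).
  unfold Rdiv in q at 1. rewrite Rabs_mult in q.
  set (R1 := Rpower t (-1 + 1 / 2)) in *.
  assert (R1p : 0 < R1) by apply exp_pos.
  assert (R1le : R1 <= 1).
  { unfold R1, Rpower. apply Rle_trans with (exp 0); [|rewrite exp_0; lra].
    assert (lt : 0 <= ln t) by (rewrite <- ln_1; apply ln_le; lra).
    assert (le0 : (-1 + 1 / 2) * ln t <= 0) by lra.
    destruct le0 as [l|e]; [left; apply exp_increasing; exact l|rewrite e; lra]. }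
  rewrite (Rabs_pos_eq (/ R1)) in q by (left; apply Rinv_0_lt_compat; lra).
  eexists. split; cycle 1.
  - instantiate (1 := g u - (2 * t - 2 * ln (2 * t) + ln (2 * t / g1 s)
      + ln 4 + ln (H f s))).
    rewrite ln_div by lra. ring.
  - apply Rlt_le_trans with R1; [|exact R1le].
    apply Rmult_lt_reg_r with (/ R1); [apply Rinv_0_lt_compat; lra|].
    rewrite Rinv_r by lra. exact q. }
assert (four : ln 8 = ln 4 + ln 2) by (rewrite <- ln_mult by lra; f_equal; ring).
assert (two : ln 2 = ln 4 + ln (1 / 2)) by (rewrite <- ln_mult by lra; f_equal; field).
assert (ln2 : 0 <= ln 2) by (rewrite <- ln_1; apply ln_le; lra).
assert (bounds : forall t, T <= t ->
  2 * t - 2 * m * t <= g (U (exp (- t))) <= 3 * t).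
{ intros t ht. destruct (main t ht) as [hs [gs [hu [e [he eq]]]]].
  set (s := ginv (2 * t)) in *. apply Rabs_def2 in he.
  pose proof (hH s hs) as Hs.
  assert (lH : ln (1 / 2) <= ln (H f s) <= ln 2) by (split; apply ln_le; lra).
  assert (l2t : 0 <= ln (2 * t)) by (rewrite <- ln_1; apply ln_le; lra).
  assert (g1le : g1 s1 <= g1 s) by (apply (rg_g1_le _ _ _ _ _ _ rg); lra).
  assert (lg1 : ln (g1 s1) <= ln (g1 s)) by (apply ln_le; lra).
  split.
  - assert (up : ln (g1 s) <= ln C + 2 * ln (2 * t)).
    { pose proof (rg_g1_ratio _ _ _ _ _ _ rg s1 s (Rle_refl _) hs) as rat.
      assert (b : g1 s <= C * (2 * t * (2 * t))).
      { apply Rmult_le_reg_r with (g s1 ^ 2); [exact gs2|].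
        apply Rle_trans with (1 := rat). rewrite gs. right; unfold C; field; lra. }
      assert (tt : 0 < 2 * t * (2 * t)) by nra.
      replace (ln C + 2 * ln (2 * t)) with (ln (C * (2 * t * (2 * t)))).
      - apply ln_le; lra.
      - rewrite ln_mult, ln_mult by lra. ring. }
    assert (lin : ln (2 * t) <= m / 6 * (2 * t) - 1 - ln (m / 6))
      by (apply ln_le_linear; lra).
    assert (K2 <= m * t).
    { apply Rle_trans with (m * (K2 / m)); [right; field; lra|].
      apply Rmult_le_compat_l; lra. }
    unfold K2 in *. lra.
  - unfold K1 in *. lra. }
assert (equiv : forall t, T <= t ->
  exp (-1) / 4 / t <= exp (-2 * t) * (g1 (U (exp (- t))) * extend f (U (exp (- t))))
    <= 9 * exp 1 / t).
{ intros t ht. destruct (main t ht) as [hs [gs [hu [e [he eq]]]]].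
  destruct (bounds t ht) as [blo bhi].
  set (s := ginv (2 * t)) in *. set (u := U (exp (- t))) in *.
  apply Rabs_def2 in he. pose proof (hH s hs) as Hs.
  assert (g1s : 0 < g1 s) by (apply (rg_g1 _ _ _ _ _ _ rg); exact hs).
  assert (g1u : 0 < g1 u) by (apply (rg_g1 _ _ _ _ _ _ rg); exact hu).
  rewrite (rg_exp _ _ _ _ _ _ rg u hu). fold g.
  assert (id : exp (-2 * t) * (g1 u * exp (g u)) = 2 * H f s / t * (g1 u / g1 s) * exp e).
  { replace (exp (-2 * t) * (g1 u * exp (g u))) with (g1 u * exp (g u - 2 * t)).
    - rewrite eq.
      replace (- ln (2 * t) - ln (g1 s) + ln 4 + ln (H f s) + e)
        with (- ln (2 * t) + (- ln (g1 s) + (ln 4 + (ln (H f s) + e)))) by ring.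
      rewrite !exp_plus, !exp_Ropp, !exp_ln by lra. field. split; lra.
    - replace (g u - 2 * t) with (-2 * t + g u) by ring. rewrite exp_plus. ring. }
  rewrite id.
  (* The quotient g(u)/g(s) lies between 1/2 and 3/2, because g(s) = 2t and t <= g(u) <= 3t; slopes
     vary at most by its square. With 1/2 <= H <= 2 and |e| < 1 the identity above gives the
     constants e^(-1)/4 and 9e. *)
  assert (ratio : / 4 <= g1 u / g1 s <= 9 / 4).
  { destruct (Rle_dec s u) as [su|us].
    - assert (a1 : g1 s <= g1 u) by (apply (rg_g1_le _ _ _ _ _ _ rg); assumption).
      assert (a2 : g1 u <= (3 / 2) ^ 2 * g1 s)
        by (apply (rg_g1_ratio_le _ _ _ _ _ _ rg); [exact hs|exact su|fold g; lra]).
      split; apply Rmult_le_reg_r with (g1 s); try exact g1s;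
        unfold Rdiv; rewrite Rmult_assoc, Rinv_l by lra; lra.
    - assert (a1 : g1 u <= g1 s) by (apply (rg_g1_le _ _ _ _ _ _ rg); lra).
      assert (a2 : g1 s <= 2 ^ 2 * g1 u).
      { apply (rg_g1_ratio_le _ _ _ _ _ _ rg); [exact hu|lra|]. fold g. nra. }
      split; apply Rmult_le_reg_r with (g1 s); try exact g1s;
        unfold Rdiv; rewrite Rmult_assoc, Rinv_l by lra; lra. }
  assert (ee : exp (-1) <= exp e <= exp 1)
    by (split; left; apply exp_increasing; lra).
  pose proof (exp_pos (-1)) as em.
  assert (it : 0 < / t) by (apply Rinv_0_lt_compat; lra).
  assert (Hr : / 4 <= H f s * (g1 u / g1 s) * 2 <= 9) by nra.
  replace (2 * H f s / t * (g1 u / g1 s) * exp e)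
    with (H f s * (g1 u / g1 s) * 2 * exp e * / t) by (field; lra).
  replace (exp (-1) / 4 / t) with (/ 4 * exp (-1) * / t) by (field; lra).
  replace (9 * exp 1 / t) with (9 * exp 1 * / t) by (field; lra).
  split; (apply Rmult_le_compat_r; [lra|]); apply Rmult_le_compat; lra. }
exists T. constructor.
- lra.
- pose proof (exp_pos (-1)). lra.
- pose proof (exp_pos 1). lra.
- intros t ht. left; apply hTu; lra.
- intros t ht. apply Rle_trans with (2 := proj1 (bounds t ht)).
  assert (m * t <= delta * t) by (apply Rmult_le_compat_r; lra). lra.
- intros t ht. apply (bounds t ht).
- intros t ht. apply (equiv t ht).
- intros t ht. apply (equiv t ht).
Qed.

(** * Radial functions of class C^2 in the plane *)

Lemma continuity_pt_eps (f : R -> R) (x eps : R) :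
  continuity_pt f x -> 0 < eps ->
  exists d, 0 < d /\ forall y, Rabs (y - x) < d -> Rabs (f y - f x) < eps.
Proof.
intros c he. destruct (c eps he) as [d [dp hd]]. exists d. split; [exact dp|].
intros y hy. destruct (Req_dec y x) as [->|ne].
- rewrite Rminus_diag, Rabs_R0. exact he.
- apply hd. split; [split; [exact I|auto]|exact hy].
Qed.

Lemma norm2_sym (x y : R) : sqrt (x ^ 2 + y ^ 2) = sqrt (y ^ 2 + x ^ 2).
Proof. f_equal; ring. Qed.

Lemma norm2_sq (x y : R) : sqrt (x ^ 2 + y ^ 2) ^ 2 = x ^ 2 + y ^ 2.
Proof.
rewrite <- Rsqr_pow2. apply Rsqr_sqrt.
pose proof (pow2_ge_0 x). pose proof (pow2_ge_0 y). lra.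
Qed.

Lemma norm2_0 (x : R) : sqrt (x ^ 2 + 0 ^ 2) = Rabs x.
Proof. rewrite <- sqrt_Rsqr_abs. f_equal. unfold Rsqr; ring. Qed.

Lemma norm2_cases (x y : R) : x = 0 /\ y = 0 \/ 0 < x ^ 2 + y ^ 2.
Proof.
pose proof (pow2_ge_0 x). pose proof (pow2_ge_0 y).
destruct (Req_dec x 0) as [ex|nx].
- destruct (Req_dec y 0) as [ey|ny]; [left; auto|right].
  assert (0 < y ^ 2) by (rewrite <- Rsqr_pow2; apply Rsqr_pos_lt; exact ny). lra.
- right. assert (0 < x ^ 2) by (rewrite <- Rsqr_pow2; apply Rsqr_pos_lt; exact nx). lra.
Qed.

Lemma norm2_continuity (x y : R) : continuity_2d_pt (fun u w => sqrt (u ^ 2 + w ^ 2)) x y.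
Proof.
apply (continuity_1d_2d_pt_comp sqrt (fun u w => u ^ 2 + w ^ 2)).
- apply continuity_pt_sqrt. pose proof (pow2_ge_0 x). pose proof (pow2_ge_0 y). lra.
- apply (continuity_2d_pt_ext_loc (fun u w => u * u + w * w)).
  { apply locally_2d_forall. intros; ring. }
  apply continuity_2d_pt_plus; apply continuity_2d_pt_mult;
    (apply continuity_2d_pt_id1 || apply continuity_2d_pt_id2).
Qed.

(** Writing the derivative as s K(s) cancels the 1/s in the gradient of the norm. The partial
    derivative x K then has a meaning at the origin. *)
Lemma radial_derive (G K : R -> R) (x y : R) :
  (forall s, 0 < s -> is_derive G s (s * K s)) -> 0 < x ^ 2 + y ^ 2 ->
  is_derive (fun z => G (sqrt (z ^ 2 + y ^ 2))) x (x * K (sqrt (x ^ 2 + y ^ 2))).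
Proof.
intros d p. assert (sp : 0 < sqrt (x ^ 2 + y ^ 2)) by (apply sqrt_lt_R0; exact p).
assert (ds : is_derive (fun z => sqrt (z ^ 2 + y ^ 2)) x (x / sqrt (x ^ 2 + y ^ 2))).
{ auto_derive; [simpl in p; lra|]. simpl; field. simpl in sp; lra. }
pose proof (is_derive_comp G _ x _ _ (d _ sp) ds) as c.
replace (x * K (sqrt (x ^ 2 + y ^ 2))) with (scal (x / sqrt (x ^ 2 + y ^ 2))
  (sqrt (x ^ 2 + y ^ 2) * K (sqrt (x ^ 2 + y ^ 2)))); [exact c|].
unfold scal; simpl; unfold mult; simpl. field. simpl in sp; lra.
Qed.

Section RadialPlane.

(* [W' = s M], [M' = s P]; the value [P 0] is irrelevant. *)
Context (W M P : R -> R).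
Context (dW : forall s, 0 < s -> is_derive W s (s * M s)).
Context (dM : forall s, 0 < s -> is_derive M s (s * P s)).
Context (cP : forall s, 0 < s -> continuity_pt P s).
Context (W0 : forall eps, 0 < eps ->
  exists d, 0 < d /\ forall s, 0 < s < d -> Rabs (W s - W 0) <= eps * s).
Context (M0 : forall eps, 0 < eps ->
  exists d, 0 < d /\ forall s, 0 < s < d -> Rabs (M s - M 0) < eps).
Context (P0 : forall eps, 0 < eps ->
  exists d, 0 < d /\ forall s, 0 < s < d -> Rabs (s ^ 2 * P s) < eps).

Lemma radial_derive_x (x y : R) :
  is_derive (fun z => W (sqrt (z ^ 2 + y ^ 2))) x (x * M (sqrt (x ^ 2 + y ^ 2))).
Proof.
destruct (norm2_cases x y) as [[-> ->]|p]; [|apply radial_derive; assumption].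
rewrite Rmult_0_l. apply is_derive_Reals. intros eps he.
destruct (W0 (eps / 2)) as [d [dp hd]]; [lra|].
exists (mkposreal d dp). intros k k0 hk. simpl in hk.
rewrite !norm2_0, Rplus_0_l, Rabs_R0.
pose proof (Rabs_pos_lt k k0) as kp.
assert (q : Rabs (W (Rabs k) - W 0) <= eps / 2 * Rabs k) by (apply hd; lra).
rewrite Rminus_0_r. unfold Rdiv. rewrite Rabs_mult, Rabs_inv.
apply Rmult_lt_reg_r with (Rabs k); [exact kp|].
rewrite Rmult_assoc, Rinv_l by lra. nra.
Qed.

Lemma radial_derive_xx (x y : R) :
  is_derive (fun z => z * M (sqrt (z ^ 2 + y ^ 2))) x
    (M (sqrt (x ^ 2 + y ^ 2)) + x ^ 2 * P (sqrt (x ^ 2 + y ^ 2))).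
Proof.
destruct (norm2_cases x y) as [[-> ->]|p].
- replace (M (sqrt (0 ^ 2 + 0 ^ 2)) + 0 ^ 2 * P (sqrt (0 ^ 2 + 0 ^ 2))) with (M 0)
    by (rewrite norm2_0, Rabs_R0; ring).
  apply is_derive_Reals. intros eps he.
  destruct (M0 eps he) as [d [dp hd]]. exists (mkposreal d dp).
  intros k k0 hk. simpl in hk. rewrite Rplus_0_l, !norm2_0, Rmult_0_l, Rminus_0_r.
  pose proof (Rabs_pos_lt k k0) as kp.
  replace (k * M (Rabs k) / k) with (M (Rabs k)) by (field; exact k0).
  apply hd; lra.
- pose proof (radial_derive M P x y dM p) as d.
  replace (M (sqrt (x ^ 2 + y ^ 2)) + x ^ 2 * P (sqrt (x ^ 2 + y ^ 2)))
    with (1 * M (sqrt (x ^ 2 + y ^ 2)) + x * (x * P (sqrt (x ^ 2 + y ^ 2)))) by ring.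
  apply is_derive_Reals.
  apply (derivable_pt_lim_mult (fun z => z) (fun z => M (sqrt (z ^ 2 + y ^ 2)))).
  + apply derivable_pt_lim_id.
  + apply is_derive_Reals, d.
Qed.

Lemma radial_derive_xy (x y : R) :
  is_derive (fun z => x * M (sqrt (x ^ 2 + z ^ 2))) y (x * y * P (sqrt (x ^ 2 + y ^ 2))).
Proof.
destruct (Req_dec x 0) as [->|nx].
- apply (is_derive_ext (fun _ => 0)); [intros; symmetry; apply Rmult_0_l|].
  replace (0 * y * P (sqrt (0 ^ 2 + y ^ 2))) with 0 by ring.
  exact (is_derive_const (K := R_AbsRing) (V := R_NormedModule) 0 y).
- assert (p : 0 < y ^ 2 + x ^ 2).
  { destruct (norm2_cases x y) as [[e _]|q]; [contradiction|lra]. }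
  pose proof (radial_derive M P y x dM p) as d.
  apply (is_derive_ext (fun z => x * M (sqrt (z ^ 2 + x ^ 2)))).
  { intros z. rewrite norm2_sym. reflexivity. }
  rewrite norm2_sym, Rmult_assoc. apply (is_derive_scal _ y x). exact d.
Qed.

Lemma radial_continuity (G : R -> R) (x y : R) :
  (forall s, 0 < s -> continuity_pt G s) ->
  (forall eps, 0 < eps -> exists d, 0 < d /\ forall s, 0 < s < d -> Rabs (G s - G 0) < eps) ->
  continuity_2d_pt (fun u w => G (sqrt (u ^ 2 + w ^ 2))) x y.
Proof.
intros c c0.
(* At 0 only the right-hand continuity of [G] is known; [Rabs] makes it two-sided without changing
   values at norms. *)
apply (continuity_2d_pt_ext_loc (fun u w => G (Rabs (sqrt (u ^ 2 + w ^ 2))))).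
{ apply locally_2d_forall. intros u w.
  rewrite Rabs_pos_eq by apply sqrt_pos. reflexivity. }
apply (continuity_1d_2d_pt_comp (fun s => G (Rabs s))); [|apply norm2_continuity].
destruct (Req_dec (sqrt (x ^ 2 + y ^ 2)) 0) as [->|n].
- intros eps he. destruct (c0 eps he) as [d [dp hd]]. exists d. split; [exact dp|].
  intros s [[_ ne] hs]. simpl in hs |- *. unfold R_dist in *.
  rewrite Rminus_0_r in hs. rewrite Rabs_R0. apply hd. split; [|exact hs].
  apply Rabs_pos_lt. auto.
- pose proof (sqrt_pos (x ^ 2 + y ^ 2)).
  apply (continuity_pt_comp Rabs G); [apply Rcontinuity_abs|].
  apply c. apply Rabs_pos_lt. exact n.
Qed.

(** [P] may blow up at 0, but s^2 P tends to 0 and the quadratic factors of the second derivatives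
    are dominated by s^2. *)
Lemma radial_second_continuity (A : R -> R -> R) (x y : R) :
  (forall u w, continuity_2d_pt A u w) ->
  (forall u w, Rabs (A u w) <= u ^ 2 + w ^ 2) ->
  continuity_2d_pt (fun u w => A u w * P (sqrt (u ^ 2 + w ^ 2))) x y.
Proof.
intros cA bA. destruct (norm2_cases x y) as [[-> ->]|p].
- intros eps. destruct (P0 eps (cond_pos eps)) as [d [dp hd]].
  destruct (norm2_continuity 0 0 (mkposreal d dp)) as [r hr].
  exists r. intros u w hu hw. specialize (hr u w hu hw). cbn [pos] in hr.
  rewrite (norm2_0 0), Rabs_R0, Rminus_0_r in hr.
  rewrite Rabs_pos_eq in hr by apply sqrt_pos.
  assert (A0 : A 0 0 = 0).
  { specialize (bA 0 0). pose proof (Rabs_pos (A 0 0)).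
    apply Rabs_eq_0. simpl in bA. lra. }
  rewrite A0, Rmult_0_l, Rminus_0_r.
  destruct (norm2_cases u w) as [[-> ->]|p].
  + rewrite A0, Rmult_0_l, Rabs_R0. apply cond_pos.
  + assert (sp : 0 < sqrt (u ^ 2 + w ^ 2)) by (apply sqrt_lt_R0; exact p).
    apply Rle_lt_trans with (2 := hd _ (conj sp hr)).
    rewrite !Rabs_mult. apply Rmult_le_compat_r; [apply Rabs_pos|].
    rewrite norm2_sq, (Rabs_pos_eq (u ^ 2 + w ^ 2)) by lra. apply bA.
- apply continuity_2d_pt_mult; [apply cA|].
  apply (continuity_1d_2d_pt_comp P); [|apply norm2_continuity].
  apply cP, sqrt_lt_R0, p.
Qed.

Lemma radial_continuity_M (x y : R) : continuity_2d_pt (fun u w => M (sqrt (u ^ 2 + w ^ 2))) x y.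
Proof.
apply radial_continuity; [|exact M0].
intros s sp. eapply continuity_pt_of_derive, dM, sp.
Qed.

Lemma radial_continuity_W (x y : R) : continuity_2d_pt (fun u w => W (sqrt (u ^ 2 + w ^ 2))) x y.
Proof.
apply radial_continuity.
- intros s sp. eapply continuity_pt_of_derive, dW, sp.
- intros eps he. destruct (W0 1) as [d [dp hd]]; [lra|].
  exists (Rmin d eps). split; [apply Rmin_pos; assumption|].
  intros s hs. pose proof (Rmin_l d eps). pose proof (Rmin_r d eps).
  apply Rle_lt_trans with (1 * s); [apply hd; lra|lra].
Qed.

Lemma continuity_2d_quadratic (x y : R) :
  continuity_2d_pt (fun u w => u ^ 2) x y /\ continuity_2d_pt (fun u w => w ^ 2) x y /\
  continuity_2d_pt (fun u w => u * w) x y.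
Proof.
assert (e : forall a : R, a * a = a ^ 2) by (intros; ring).
repeat split.
- apply (continuity_2d_pt_ext_loc (fun u w => u * u)); [apply locally_2d_forall; auto|].
  apply continuity_2d_pt_mult; apply continuity_2d_pt_id1.
- apply (continuity_2d_pt_ext_loc (fun u w => w * w)); [apply locally_2d_forall; auto|].
  apply continuity_2d_pt_mult; apply continuity_2d_pt_id2.
- apply continuity_2d_pt_mult; [apply continuity_2d_pt_id1|apply continuity_2d_pt_id2].
Qed.

Lemma quadratic_bounds (u w : R) :
  Rabs (u ^ 2) <= u ^ 2 + w ^ 2 /\ Rabs (w ^ 2) <= u ^ 2 + w ^ 2 /\
  Rabs (u * w) <= u ^ 2 + w ^ 2.
Proof.
pose proof (pow2_ge_0 u). pose proof (pow2_ge_0 w).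
rewrite (Rabs_pos_eq (u ^ 2)), (Rabs_pos_eq (w ^ 2)) by assumption.
split; [lra|]. split; [lra|]. apply Rabs_le.
pose proof (pow2_ge_0 (u + w)). pose proof (pow2_ge_0 (u - w)). nra.
Qed.

Lemma radial_derive_y (x y : R) :
  is_derive (fun z => W (sqrt (x ^ 2 + z ^ 2))) y (y * M (sqrt (x ^ 2 + y ^ 2))).
Proof.
apply (is_derive_ext (fun z => W (sqrt (z ^ 2 + x ^ 2))));
  [intros z; rewrite norm2_sym; reflexivity|].
rewrite norm2_sym. apply radial_derive_x.
Qed.

Lemma radial_derive_yy (x y : R) :
  is_derive (fun z => z * M (sqrt (x ^ 2 + z ^ 2))) y
    (M (sqrt (x ^ 2 + y ^ 2)) + y ^ 2 * P (sqrt (x ^ 2 + y ^ 2))).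
Proof.
apply (is_derive_ext (fun z => z * M (sqrt (z ^ 2 + x ^ 2))));
  [intros z; rewrite norm2_sym; reflexivity|].
rewrite norm2_sym. apply radial_derive_xx.
Qed.

Lemma radial_derive_yx (x y : R) :
  is_derive (fun z => y * M (sqrt (z ^ 2 + y ^ 2))) x (x * y * P (sqrt (x ^ 2 + y ^ 2))).
Proof.
apply (is_derive_ext (fun z => y * M (sqrt (y ^ 2 + z ^ 2))));
  [intros z; rewrite norm2_sym; reflexivity|].
rewrite norm2_sym, (Rmult_comm x y). apply radial_derive_xy.
Qed.

Lemma radial_ex_diff (x y : R) : ex_diff_n (fun u w => W (sqrt (u ^ 2 + w ^ 2))) 2 x y.
Proof.
split; [apply radial_continuity_W|].
split; [eexists; apply radial_derive_x|]. split; [eexists; apply radial_derive_y|].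
split.
- apply (ex_diff_n_ext_loc (fun u w => u * M (sqrt (u ^ 2 + w ^ 2)))).
  { apply locally_2d_forall. intros u w. symmetry.
    apply is_derive_unique, radial_derive_x. }
  split.
  { apply continuity_2d_pt_mult; [apply continuity_2d_pt_id1|apply radial_continuity_M]. }
  split; [eexists; apply radial_derive_xx|]. split; [eexists; apply radial_derive_xy|].
  split; (split; [|exact I]).
  + apply (continuity_2d_pt_ext_loc (fun u w =>
      M (sqrt (u ^ 2 + w ^ 2)) + u ^ 2 * P (sqrt (u ^ 2 + w ^ 2)))).
    { apply locally_2d_forall. intros u w. symmetry.
      apply is_derive_unique, radial_derive_xx. }
    apply continuity_2d_pt_plus; [apply radial_continuity_M|].
    apply radial_second_continuity;
      [intros; apply continuity_2d_quadratic|intros; apply quadratic_bounds].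
  + apply (continuity_2d_pt_ext_loc (fun u w => u * w * P (sqrt (u ^ 2 + w ^ 2)))).
    { apply locally_2d_forall. intros u w. symmetry.
      apply is_derive_unique, radial_derive_xy. }
    apply radial_second_continuity;
      [intros; apply continuity_2d_quadratic|intros; apply quadratic_bounds].
- apply (ex_diff_n_ext_loc (fun u w => w * M (sqrt (u ^ 2 + w ^ 2)))).
  { apply locally_2d_forall. intros u w. symmetry.
    apply is_derive_unique, radial_derive_y. }
  split.
  { apply continuity_2d_pt_mult; [apply continuity_2d_pt_id2|apply radial_continuity_M]. }
  split; [eexists; apply radial_derive_yx|]. split; [eexists; apply radial_derive_yy|].
  split; (split; [|exact I]).
  + apply (continuity_2d_pt_ext_loc (fun u w => u * w * P (sqrt (u ^ 2 + w ^ 2)))).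
    { apply locally_2d_forall. intros u w. symmetry.
      apply is_derive_unique, radial_derive_yx. }
    apply radial_second_continuity;
      [intros; apply continuity_2d_quadratic|intros; apply quadratic_bounds].
  + apply (continuity_2d_pt_ext_loc (fun u w =>
      M (sqrt (u ^ 2 + w ^ 2)) + w ^ 2 * P (sqrt (u ^ 2 + w ^ 2)))).
    { apply locally_2d_forall. intros u w. symmetry.
      apply is_derive_unique, radial_derive_yy. }
    apply continuity_2d_pt_plus; [apply radial_continuity_M|].
    apply radial_second_continuity;
      [intros; apply continuity_2d_quadratic|intros; apply quadratic_bounds].
Qed.

Lemma radial_laplacian (x y : R) :
  let u := fun u w => W (sqrt (u ^ 2 + w ^ 2)) in
  let s := sqrt (x ^ 2 + y ^ 2) in
  partial_derive 2 0 u x y + partial_derive 0 2 u x y = 2 * M s + s ^ 2 * P s.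
Proof.
intros u s. unfold s at 2. rewrite norm2_sq.
assert (e1 : partial_derive 2 0 u x y = M s + x ^ 2 * P s).
{ unfold partial_derive. simpl.
  rewrite (Derive_ext _ (fun z => z * M (sqrt (z ^ 2 + y ^ 2)))).
  - apply is_derive_unique, radial_derive_xx.
  - intros z. apply is_derive_unique, radial_derive_x. }
assert (e2 : partial_derive 0 2 u x y = M s + y ^ 2 * P s).
{ unfold partial_derive. simpl.
  rewrite (Derive_ext _ (fun z => z * M (sqrt (x ^ 2 + z ^ 2)))).
  - apply is_derive_unique, radial_derive_yy.
  - intros z. apply is_derive_unique, radial_derive_y. }
rewrite e1, e2. ring.
Qed.

End RadialPlane.

(** * The bifurcation curve *)

(** Take three successive parameters with values below, above and below [l]: the maximum over the
    interval lies above [l], hence in the interior, and is a local one. Minima are symmetric. *)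
Lemma turning_points_of_sign_changes (curve : R -> R * (R -> R -> R)) (l : R) :
  (forall a, 0 < a -> continuity_pt (fun b => fst (curve b)) a) ->
  (forall A, (exists a, A < a /\ 0 < a /\ fst (curve a) < l) /\
             (exists a, A < a /\ 0 < a /\ l < fst (curve a))) ->
  infinitely_many_turning_points_around curve l.
Proof.
intros cont osc. unfold infinitely_many_turning_points_around. split.
{ intros A. destruct (osc A) as [[a [ha [_ la]]] [b [hb [_ lb]]]].
  split; [exists a|exists b]; split; lra. }
set (lam := fun a => fst (curve a)) in *.
assert (near : forall a b x : R, a < x < b -> forall Q : R -> Prop,
  (forall y, a <= y <= b -> Q y) -> locally x Q).
{ intros a b x hx Q hQ.
  assert (mp : 0 < Rmin (x - a) (b - x)) by (apply Rmin_pos; lra).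
  exists (mkposreal _ mp). intros y hy.
  change (Rabs (y - x) < Rmin (x - a) (b - x)) in hy.
  pose proof (Rmin_l (x - a) (b - x)). pose proof (Rmin_r (x - a) (b - x)).
  apply Rabs_def2 in hy. apply hQ. lra. }
intros A. split.
- destruct (osc A) as [[a [hA [ap la]]] _].
  destruct (osc a) as [_ [b [hab [_ lb]]]].
  destruct (osc b) as [[c [hbc [_ lc]]] _].
  destruct (continuity_ab_maj lam a c) as [m [hm hmc]]; [lra|intros; apply cont; lra|].
  assert (lm : l < lam m) by (apply Rlt_le_trans with (1 := lb), hm; lra).
  assert (m <> a) by (intros ->; unfold lam in lm; lra).
  assert (m <> c) by (intros ->; unfold lam in lm; lra).
  exists m. split; [lra|]. split; [exact lm|].
  apply (near a c); [lra|exact hm].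
- destruct (osc A) as [_ [a [hA [ap la]]]].
  destruct (osc a) as [[b [hab [_ lb]]] _].
  destruct (osc b) as [_ [c [hbc [_ lc]]]].
  destruct (continuity_ab_min lam a c) as [m [hm hmc]]; [lra|intros; apply cont; lra|].
  assert (lm : lam m < l) by (apply Rle_lt_trans with (2 := lb), hm; lra).
  assert (m <> a) by (intros ->; unfold lam in lm; lra).
  assert (m <> c) by (intros ->; unfold lam in lm; lra).
  exists m. split; [lra|]. split; [exact lm|].
  apply (near a c); [lra|exact hm].
Qed.

Lemma exp_opp_opp_ln (r : R) : 0 < r -> exp (- - ln r) = r.
Proof. intros rp. rewrite Ropp_involutive. apply exp_ln, rp. Qed.

Section Bifurcation.

Context (f : R -> R) (nl : nonlinearity (extend f)) (v : R -> R -> R) (rho : R -> R).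
Context (hv : forall alpha, 0 < alpha -> regular_solution f alpha (v alpha)).
Context (hrho : forall alpha, 0 < alpha -> first_zero (v alpha) (rho alpha)).

Lemma profile_decreasing (a r s : R) : 0 < a -> 0 < r < s -> v a s < v a r.
Proof.
intros ap hr. assert (lt : ln r < ln s) by (apply ln_increasing; lra).
pose proof (log_regular_increasing _ nl a _ _ (- ln s) (- ln r)
  (log_regular_of_regular f (v a) a (hv a ap))) as q.
cbv beta in q. rewrite !exp_opp_opp_ln in q by lra. apply q. lra.
Qed.

Lemma profile_continuity (a r : R) : 0 < a -> 0 < r -> continuity_pt (fun b => v b r) a.
Proof.
intros ap rp.
pose proof (family_continuity (extend f) nl (fun b t => v b (exp (- t)))
  (fun b t => - exp (- t) * Derive (v b) (exp (- t)))
  (fun b hb => log_regular_of_regular f (v b) b (hv b hb)) (- ln r) a ap) as c.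
cbv beta in c. rewrite exp_opp_opp_ln in c by exact rp. exact c.
Qed.

Lemma rho_lt_of_neg (a r : R) : 0 < a -> 0 < r -> v a r < 0 -> rho a < r.
Proof.
intros ap rp neg. destruct (hrho a ap) as [hp [z _]]. apply Rnot_le_lt; intros l.
destruct (Req_dec r (rho a)) as [e|n]; [rewrite e in neg; lra|].
pose proof (profile_decreasing a r (rho a) ap). lra.
Qed.

Lemma rho_gt_of_pos (a r : R) : 0 < a -> 0 < r -> 0 < v a r -> r < rho a.
Proof.
intros ap rp pos. destruct (hrho a ap) as [hp [z _]]. apply Rnot_le_lt; intros l.
destruct (Req_dec r (rho a)) as [e|n]; [rewrite e in pos; lra|].
pose proof (profile_decreasing a (rho a) r ap). lra.
Qed.

(** The strictly decreasing profile has opposite signs at rho(a) - e and rho(a) + e. Both signs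
    persist for nearby parameters and trap their first zero. *)
Lemma rho_continuity (a : R) : 0 < a -> continuity_pt rho a.
Proof.
intros ap eps he. destruct (hrho a ap) as [hp [z _]].
set (e := Rmin eps (rho a) / 2).
assert (mp : 0 < Rmin eps (rho a)) by (apply Rmin_pos; lra).
pose proof (Rmin_l eps (rho a)). pose proof (Rmin_r eps (rho a)).
assert (he2 : 0 < e /\ e < eps /\ e < rho a) by (unfold e; lra).
assert (p1 : 0 < v a (rho a - e)).
{ rewrite <- z. apply profile_decreasing; lra. }
assert (p2 : v a (rho a + e) < 0).
{ rewrite <- z. apply profile_decreasing; lra. }
destruct (continuity_pt_eps (fun b => v b (rho a - e)) a (v a (rho a - e)))
  as [d1 [d1p h1]]; [apply profile_continuity; lra|exact p1|].
destruct (continuity_pt_eps (fun b => v b (rho a + e)) a (- v a (rho a + e)))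
  as [d2 [d2p h2]]; [apply profile_continuity; lra|lra|].
exists (Rmin a (Rmin d1 d2)). split; [repeat apply Rmin_pos; assumption|].
intros b [_ hb]. simpl in hb |- *. unfold R_dist in hb |- *.
pose proof (Rmin_l a (Rmin d1 d2)). pose proof (Rmin_r a (Rmin d1 d2)).
pose proof (Rmin_l d1 d2). pose proof (Rmin_r d1 d2).
assert (hb1 : Rabs (b - a) < d1) by lra. assert (hb2 : Rabs (b - a) < d2) by lra.
assert (hb0 : Rabs (b - a) < a) by lra. apply Rabs_def2 in hb0.
specialize (h1 b hb1). specialize (h2 b hb2).
apply Rabs_def2 in h1. apply Rabs_def2 in h2.
assert (rho a - e < rho b) by (apply rho_gt_of_pos; lra).
assert (rho b < rho a + e) by (apply rho_lt_of_neg; lra).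
apply Rabs_def1; lra.
Qed.

Lemma profile_value_limit (a eps : R) :
  0 < a -> 0 < eps ->
  exists d, 0 < d /\ forall r, 0 < r < d -> Rabs (extend f (v a r) - extend f a) < eps.
Proof.
intros ap he.
destruct (continuity_pt_eps (extend f) a eps (nonlinearity_continuity _ a nl) he)
  as [d [dp hd]].
destruct (regular_solution_near_0 f (v a) a 1 (hv a ap)) as [d' [dp' hd']]; [lra|].
exists (Rmin d d'). split; [apply Rmin_pos; assumption|].
intros r hr. pose proof (Rmin_l d d'). pose proof (Rmin_r d d').
apply hd. apply Rle_lt_trans with (1 * r); [apply hd'; lra|lra].
Qed.

(** In the variable t the slope is -r v'(r), and near r = 0 it is squeezed between (F(a) - eps)/2
    and (F(a) + eps)/2 times r^2. *)
Lemma profile_slope_limit (a eps : R) :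
  0 < a -> 0 < eps ->
  exists d, 0 < d /\ forall r, 0 < r < d ->
    Rabs (Derive (v a) r / r + extend f a / 2) < eps.
Proof.
intros ap he. destruct (profile_value_limit a eps ap he) as [d [dp hd]].
exists d. split; [exact dp|]. intros r hr.
pose proof (log_regular_of_regular f (v a) a (hv a ap)) as reg.
assert (er : exp (- - ln r) = r) by (apply exp_opp_opp_ln; lra).
assert (near : forall s, - ln r <= s ->
  extend f a - eps <= extend f (v a (exp (- s))) <= extend f a + eps).
{ intros s hs. assert (q : Rabs (extend f (v a (exp (- s))) - extend f a) < eps).
  { apply hd. split; [apply exp_pos|]. apply Rle_lt_trans with r; [|lra].
    rewrite <- er. destruct hs as [l| <-]; [left; apply exp_increasing; lra|lra]. }
  apply Rabs_def2 in q. lra. }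
pose proof (log_regular_slope_bound _ nl a (extend f a + eps) _ _ (- ln r) (- ln r)
  reg (fun s hs => proj2 (near s hs)) (Rle_refl _)) as up.
pose proof (log_regular_slope_lower _ nl a (extend f a - eps) _ _ (- ln r) (- ln r)
  reg (fun s hs => proj1 (near s hs)) (Rle_refl _)) as lo.
cbv beta in up, lo. rewrite er in up, lo.
replace (exp (-2 * - ln r)) with (r * r) in up, lo
  by (rewrite <- er at 1 2; rewrite <- exp_plus; f_equal; ring).
set (q := Derive (v a) r / r).
assert (eq : - r * Derive (v a) r = - q * (r * r)) by (unfold q; field; lra).
rewrite eq in up, lo.
assert (rr : 0 < r * r) by nra.
apply Rmult_le_reg_r in up; [|exact rr]. apply Rmult_le_reg_r in lo; [|exact rr].
apply Rabs_def1; lra.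
Qed.

Lemma profile_nonneg (a r : R) : 0 < a -> 0 <= r <= rho a -> 0 <= v a r.
Proof.
intros ap hr. destruct (hrho a ap) as [hp [z _]].
destruct (hv a ap) as [_ [v0 _]].
destruct (Req_dec r 0) as [->|n0]; [lra|].
destruct (Req_dec r (rho a)) as [->|n1]; [lra|].
left; rewrite <- z. apply profile_decreasing; lra.
Qed.

Lemma bifurcation_dirichlet_solution (a : R) :
  0 < a -> dirichlet_solution f (rho a ^ 2) (snd (bifurcation_curve v rho a)).
Proof.
intros ap. destruct (hrho a ap) as [R0p [z _]]. set (R0 := rho a) in *.
pose proof (hv a ap) as reg. destruct reg as [eq [v0 _]].
set (F := extend f) in *. set (V1 := Derive (v a)).
set (W := fun s => v a (R0 * s)).
set (M := fun s => if Req_dec_T s 0 then - (R0 ^ 2 * F a) / 2 else R0 * V1 (R0 * s) / s).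
set (P := fun s => (-2 * M s - R0 ^ 2 * F (W s)) / s ^ 2).
assert (W_0 : W 0 = a) by (unfold W; rewrite Rmult_0_r; exact v0).
assert (M_0 : M 0 = - (R0 ^ 2 * F a) / 2).
{ unfold M. destruct (Req_dec_T 0 0) as [_|n]; [reflexivity|lra]. }
assert (M_pos : forall s, 0 < s -> M s = R0 * V1 (R0 * s) / s).
{ intros s sp. unfold M. destruct (Req_dec_T s 0) as [e|_]; [lra|reflexivity]. }
assert (dV : forall s, 0 < s -> is_derive (v a) (R0 * s) (V1 (R0 * s)) /\
  is_derive V1 (R0 * s) (- (/ (R0 * s) * V1 (R0 * s)) - F (W s))).
{ intros s sp. apply (radial_equation_derives f (v a)); [exact eq|nra]. }
assert (dW : forall s, 0 < s -> is_derive W s (s * M s)).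
{ intros s sp. destruct (dV s sp) as [d _]. rewrite M_pos by exact sp.
  unfold W. auto_derive; [eexists; exact d|]. derive_at d. field. lra. }
assert (dM : forall s, 0 < s -> is_derive M s (s * P s)).
{ intros s sp. destruct (dV s sp) as [_ d].
  apply (is_derive_ext_loc (fun s => R0 * V1 (R0 * s) / s)).
  - exists (mkposreal s sp). intros t ht. change (Rabs (t - s) < s) in ht.
    apply Rabs_def2 in ht. symmetry; apply M_pos; lra.
  - unfold P. rewrite M_pos by exact sp.
    auto_derive; [split; [eexists; exact d|split; [lra|exact I]]|].
    derive_at d. field. lra. }
assert (cP : forall s, 0 < s -> continuity_pt P s).
{ intros s sp. unfold P.
  apply (continuity_pt_div (fun s => -2 * M s - R0 ^ 2 * F (W s)) (fun s => s ^ 2)).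
  - apply (continuity_pt_minus (fun s => -2 * M s) (fun s => R0 ^ 2 * F (W s))).
    + apply (continuity_pt_scal M). eapply continuity_pt_of_derive, dM, sp.
    + apply (continuity_pt_scal (fun s => F (W s))).
      apply (continuity_pt_comp W F); [|apply nonlinearity_continuity, nl].
      eapply continuity_pt_of_derive, dW, sp.
  - apply (continuity_pt_of_derive _ _ (2 * s)). auto_derive; [exact I|ring].
  - apply Rgt_not_eq. nra. }
assert (W0 : forall eps, 0 < eps ->
  exists d, 0 < d /\ forall s, 0 < s < d -> Rabs (W s - W 0) <= eps * s).
{ intros eps he.
  destruct (regular_solution_near_0 f (v a) a (eps / R0) (hv a ap)) as [d [dp hd]].
  { apply Rdiv_lt_0_compat; lra. }
  exists (d / R0). split; [apply Rdiv_lt_0_compat; lra|].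
  intros s hs. rewrite W_0. unfold W.
  replace (eps * s) with (eps / R0 * (R0 * s)) by (field; lra).
  apply hd. split; [nra|].
  replace d with (R0 * (d / R0)) by (field; lra). apply Rmult_lt_compat_l; lra. }
assert (M0 : forall eps, 0 < eps ->
  exists d, 0 < d /\ forall s, 0 < s < d -> Rabs (M s - M 0) < eps).
{ intros eps he. assert (R2 : 0 < R0 ^ 2) by (apply pow_lt; lra).
  destruct (profile_slope_limit a (eps / R0 ^ 2) ap) as [d [dp hd]].
  { apply Rdiv_lt_0_compat; lra. }
  exists (d / R0). split; [apply Rdiv_lt_0_compat; lra|].
  intros s hs. rewrite M_0, M_pos by lra.
  assert (hs' : 0 < R0 * s < d).
  { split; [nra|]. replace d with (R0 * (d / R0)) by (field; lra).
    apply Rmult_lt_compat_l; lra. }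
  specialize (hd _ hs'). fold F V1 in hd.
  replace (R0 * V1 (R0 * s) / s - - (R0 ^ 2 * F a) / 2)
    with (R0 ^ 2 * (V1 (R0 * s) / (R0 * s) + F a / 2)) by (field; lra).
  rewrite Rabs_mult, (Rabs_pos_eq (R0 ^ 2)) by lra.
  replace eps with (R0 ^ 2 * (eps / R0 ^ 2)) by (field; lra).
  apply Rmult_lt_compat_l; [exact R2|exact hd]. }
assert (P0 : forall eps, 0 < eps ->
  exists d, 0 < d /\ forall s, 0 < s < d -> Rabs (s ^ 2 * P s) < eps).
{ intros eps he. assert (R2 : 0 < R0 ^ 2) by (apply pow_lt; lra).
  destruct (M0 (eps / 4)) as [d1 [d1p h1]]; [lra|].
  destruct (profile_value_limit a (eps / (2 * R0 ^ 2)) ap) as [d2 [d2p h2]].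
  { apply Rdiv_lt_0_compat; lra. }
  exists (Rmin d1 (d2 / R0)).
  split; [apply Rmin_pos; [exact d1p|apply Rdiv_lt_0_compat; lra]|].
  intros s hs. pose proof (Rmin_l d1 (d2 / R0)). pose proof (Rmin_r d1 (d2 / R0)).
  assert (hs1 : 0 < s < d1) by lra.
  assert (hs2 : 0 < R0 * s < d2).
  { split; [nra|]. replace d2 with (R0 * (d2 / R0)) by (field; lra).
    apply Rmult_lt_compat_l; lra. }
  specialize (h1 s hs1). specialize (h2 _ hs2). fold F in h2. fold (W s) in h2.
  rewrite M_0 in h1.
  replace (s ^ 2 * P s) with (-2 * (M s - - (R0 ^ 2 * F a) / 2)
    + - (R0 ^ 2 * (F (W s) - F a))) by (unfold P; field; lra).
  apply Rle_lt_trans with (1 := Rabs_triang _ _).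
  rewrite Rabs_Ropp, !Rabs_mult, (Rabs_pos_eq (R0 ^ 2)) by lra.
  replace (Rabs (-2)) with 2 by (rewrite Rabs_left; lra).
  assert (R0 ^ 2 * Rabs (F (W s) - F a) < R0 ^ 2 * (eps / (2 * R0 ^ 2)))
    by (apply Rmult_lt_compat_l; assumption).
  replace (R0 ^ 2 * (eps / (2 * R0 ^ 2))) with (eps / 2) in * by (field; lra).
  lra. }
assert (sol : forall x y, 2 * M (sqrt (x ^ 2 + y ^ 2))
  + sqrt (x ^ 2 + y ^ 2) ^ 2 * P (sqrt (x ^ 2 + y ^ 2))
  = - (R0 ^ 2 * F (W (sqrt (x ^ 2 + y ^ 2))))).
{ intros x y. destruct (norm2_cases x y) as [[-> ->]|p].
  - rewrite norm2_0, Rabs_R0, M_0, W_0. field.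
  - unfold P. field. apply Rgt_not_eq, sqrt_lt_R0, p. }
assert (ball_nonneg : forall x y, x ^ 2 + y ^ 2 <= 1 -> 0 <= W (sqrt (x ^ 2 + y ^ 2))).
{ intros x y hxy. apply profile_nonneg; [exact ap|]. fold R0.
  pose proof (sqrt_pos (x ^ 2 + y ^ 2)).
  assert (sqrt (x ^ 2 + y ^ 2) <= 1) by (rewrite <- sqrt_1; apply sqrt_le_1_alt; exact hxy).
  split; nra. }
split; [|split].
- intros x y hxy. split; [|split].
  + apply (radial_ex_diff W M P); assumption.
  + apply (ball_nonneg x y). lra.
  + pose proof (radial_laplacian W M P dW dM W0 M0 x y) as lap. cbv zeta in lap.
    change (- (partial_derive 2 0 (fun u w => W (sqrt (u ^ 2 + w ^ 2))) x y
      + partial_derive 0 2 (fun u w => W (sqrt (u ^ 2 + w ^ 2))) x y)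
      = R0 ^ 2 * f (W (sqrt (x ^ 2 + y ^ 2)))).
    rewrite lap, sol. unfold F.
    rewrite extend_nonneg by (apply ball_nonneg; lra). ring.
- intros x y _.
  apply (filterlim_filter_le_1 (F := locally (x, y))).
  + intros Q hQ. apply filter_imp with (2 := hQ). auto.
  + apply (proj1 (continuity_2d_pt_filterlim (fun u w => W (sqrt (u ^ 2 + w ^ 2))) x y)).
    apply (radial_continuity_W W M); assumption.
- intros x y hxy. change (v a (R0 * sqrt (x ^ 2 + y ^ 2)) = 0).
  rewrite hxy, sqrt_1, Rmult_1_r. exact z.
Qed.

Lemma infinitely_many_solutions_of_levels (r0 : R) :
  (forall A, exists a, A < a /\ 0 < a /\ rho a = r0) ->
  infinitely_many_solutions f (r0 ^ 2).
Proof.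
intros lev.
set (pick := fun A => proj1_sig (constructive_indefinite_description _ (lev A))).
assert (hpick : forall A, A < pick A /\ 0 < pick A /\ rho (pick A) = r0).
{ intros A. exact (proj2_sig (constructive_indefinite_description _ (lev A))). }
(* Iterating the choice makes the amplitudes strictly increasing; they are the values at the origin
   and so distinguish the solutions. *)
set (a := fun n => Nat.iter n pick (pick 0)).
assert (ha : forall n, 0 < a n /\ rho (a n) = r0).
{ intros [|n]; apply hpick. }
assert (mono : forall n k, a n < a (n + S k)%nat).
{ intros n k. induction k as [|k IH].
  - rewrite Nat.add_1_r. apply hpick.
  - apply Rlt_trans with (1 := IH). rewrite (Nat.add_succ_r n (S k)). apply hpick. }
exists (fun n => snd (bifurcation_curve v rho (a n))). split.
- intros n. destruct (ha n) as [ap e]. rewrite <- e.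
  apply bifurcation_dirichlet_solution, ap.
- intros m n ne. exists 0, 0. split; [lra|].
  assert (val : forall k, snd (bifurcation_curve v rho (a k)) 0 0 = a k).
  { intros k. simpl. replace (0 * (0 * 1) + 0 * (0 * 1)) with 0 by ring.
    rewrite sqrt_0, Rmult_0_r. apply (hv (a k)), ha. }
  rewrite !val. destruct (Nat.lt_total m n) as [l|[e|g]].
  + pose proof (mono m (n - S m)%nat) as q.
    replace (m + S (n - S m))%nat with n in q by lia. lra.
  + contradiction.
  + pose proof (mono n (m - S n)%nat) as q.
    replace (n + S (m - S n))%nat with m in q by lia. lra.
Qed.

End Bifurcation.

Theorem theorem1p2
  (f : R -> R) (q : R)
  (f_C1 : C1_half_line f)
  (f_pos : forall s, 0 <= s -> 0 < f s)
  (f_G1 : G1 f q)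
  (f_G2 : G2 f)
  (q_range : 1 <= q < 2)
  (ginv : R -> R)
  (ginv_inverse : inverse_near_infinity (logf f) ginv)
  (U : R -> R) (r0 : R)
  (U_singular : radial_singular_solution f U)
  (U_expansion : singular_expansion f ginv U)
  (U_first_zero : first_zero U r0)
  (v : R -> R -> R) (rho : R -> R)
  (v_solution : forall alpha, 0 < alpha -> regular_solution f alpha (v alpha))
  (rho_first_zero : forall alpha, 0 < alpha -> first_zero (v alpha) (rho alpha)) :
  infinitely_many_turning_points_around (bifurcation_curve v rho) (r0 ^ 2) /\
  infinitely_many_solutions f (r0 ^ 2).
Proof.
pose proof (extend_nonlinearity f f_C1 f_pos) as nl.
destruct (rapid_growth_of_G1_G2 f q f_pos f_G1 f_G2 q_range) as [h [s1 [_ [rg hH]]]].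
destruct U_singular as [U_eq U_lim].
pose proof (log_singular_limit U U_lim) as limU.
pose proof (log_solution_of_radial f U U_eq) as solU.
destruct U_first_zero as [r0p [U0 _]].
assert (er : exp (- - ln r0) = r0) by (apply exp_opp_opp_ln; exact r0p).
assert (signs : forall A, (exists a, A < a /\ 0 < a /\ v a r0 < 0) /\
                          (exists a, A < a /\ 0 < a /\ 0 < v a r0)).
{ pose proof (family_changes_sign (extend f) nl (fun b t => v b (exp (- t)))
    (fun b t => - exp (- t) * Derive (v b) (exp (- t)))
    (fun b hb => log_regular_of_regular f (v b) b (v_solution b hb))
    _ _ solU limU (- ln r0)
    (many_intersections _ _ _ _ _ _ nl rg _ _ solU limU _ _
      (singular_asymptotics_of_expansion f ginv U _ h s1 rg hH ginv_inverse
        U_expansion limU))) as osc.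
  cbv beta in osc. rewrite er, U0 in osc. exact osc. }
assert (osc : forall A, (exists a, A < a /\ 0 < a /\ rho a < r0) /\
                        (exists a, A < a /\ 0 < a /\ r0 < rho a)).
{ intros A. destruct (signs A) as [[a [hA [ap na]]] [b [hB [bp pb]]]].
  split; [exists a|exists b]; split; try assumption; split; try assumption.
  - apply (rho_lt_of_neg f nl v rho); assumption.
  - apply (rho_gt_of_pos f nl v rho); assumption. }
assert (cont : forall a, 0 < a -> continuity_pt rho a)
  by (apply (rho_continuity f nl v rho); assumption).
split.
- apply turning_points_of_sign_changes.
  + intros a ap. simpl.
    apply (continuity_pt_mult rho (fun b => rho b * 1)); [auto|].
    apply (continuity_pt_mult rho (fun _ => 1)); [auto|].
    apply continuity_pt_const. intros x y; reflexivity.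
  + intros A. destruct (osc A) as [[a [hA [ap la]]] [b [hB [bp lb]]]].
    assert (0 < rho a) by (apply rho_first_zero; exact ap).
    split; [exists a|exists b]; split; try assumption; split; try assumption; simpl; nra.
- apply (infinitely_many_solutions_of_levels f nl v rho v_solution rho_first_zero).
  intros A. destruct (osc A) as [[a [hA [ap la]]] _].
  destruct (osc a) as [_ [b [hB [bp lb]]]].
  destruct (intermediate_value rho a b r0) as [c [hc e]];
    [lra|intros; apply cont; lra|nra|].
  exists c. split; [lra|]. split; [lra|exact e].
Qed.
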